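(* Let $G$ and $H$ be finite groups whose Burnside rings $B(G)$ and $B(H)$ are isomorphic (as rings). Then $G$ and $H$ are of the same order type, i.e. $|G(d)| = |H(d)|$ for every integer $d \geq 1$.
   Context: For a finite group $G$, the Burnside ring $B(G)$ is the Grothendieck ring of isomorphism classes of finite $G$-sets, with addition induced by disjoint union and multiplication induced by Cartesian product (with diagonal action). For a finite group $G$ and an integer $d \geq 1$, put $G(d) = \{x \in G \mid x^d = 1\}$. Two finite groups $G_1$ and $G_2$ are said to be of the same order type if and only if $|G_1(d)| = |G_2(d)|$ for all $d = 1, 2, \ldots$; equivalently, for every $n \geq 1$ the groups $G_1$ and $G_2$ have the same number of elements of order $n$. *)

(* Defs.v *)
From HB Require Import structures.
From mathcomp Require Import all_boot all_fingroup all_solvable all_algebra.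
From mathcomp Require Import boolp.

Set Implicit Arguments.
Unset Strict Implicit.
Unset Printing Implicit Defensive.

Import GRing.Theory.
Local Open Scope quotient_scope.

Section Actions.

Variable G : finGroupType.
Implicit Types T U V : finType.
Local Open Scope group_scope.

Definition action_iso T U (to : {action G &-> T}) (uo : {action G &-> U}) :=
  exists2 f : T -> U, bijective f & forall x a, f (to x a) = uo (f x) a.

Lemma action_isoI T U (to : {action G &-> T}) (uo : {action G &-> U})
    (f : T -> U) (g : U -> T) :
    cancel f g -> cancel g f -> (forall x a, f (to x a) = uo (f x) a) ->
  action_iso to uo.
Proof. by move=> fK gK fa; exists f => //; exists g. Qed.

Lemma action_iso_refl T (to : {action G &-> T}) : action_iso to to.
Proof. exact: (@action_isoI _ _ _ _ id id). Qed.

Lemma action_iso_sym T U (to : {action G &-> T}) (uo : {action G &-> U}) :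
  action_iso to uo -> action_iso uo to.
Proof.
move=> [f [g fK gK] fa]; apply: (action_isoI gK fK) => y a.
by apply: (can_inj fK); rewrite fa !gK.
Qed.

Lemma action_iso_trans T U V (to : {action G &-> T}) (uo : {action G &-> U})
    (vo : {action G &-> V}) :
  action_iso to uo -> action_iso uo vo -> action_iso to vo.
Proof.
move=> [f bf fa] [g bg ga]; exists (g \o f); first exact: bij_comp.
by move=> x a; rewrite /= fa ga.
Qed.

Definition triv_fun T (x : T) (_ : G) := x.

Fact triv_fun1 T : (@triv_fun T)^~ 1 =1 id. Proof. by []. Qed.
Fact triv_funM T (x : T) : act_morph (@triv_fun T) x. Proof. by []. Qed.
Definition triv_action T := TotalAction (@triv_fun1 T) (@triv_funM T).

Section Binary.

Variables (T U : finType) (to : {action G &-> T}) (uo : {action G &-> U}).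

Definition sum_fun (z : T + U) (a : G) : T + U :=
  match z with inl x => inl (to x a) | inr y => inr (uo y a) end.

Fact sum_fun1 : sum_fun^~ 1 =1 id.
Proof. by case=> x; rewrite /= act1. Qed.
Fact sum_funM z : act_morph sum_fun z.
Proof. by case: z => x a b; rewrite /= actM. Qed.
Definition sum_action := TotalAction sum_fun1 sum_funM.

Definition prod_fun (z : T * U) (a : G) : T * U := (to z.1 a, uo z.2 a).

Fact prod_fun1 : prod_fun^~ 1 =1 id.
Proof. by case=> x y; rewrite /prod_fun !act1. Qed.
Fact prod_funM z : act_morph prod_fun z.
Proof. by move=> a b; rewrite /prod_fun !actM. Qed.
Definition prod_action := TotalAction prod_fun1 prod_funM.

End Binary.

Lemma sum_action_iso (T U T' U' : finType)
    (to : {action G &-> T}) (uo : {action G &-> U})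
    (to' : {action G &-> T'}) (uo' : {action G &-> U'}) :
  action_iso to to' -> action_iso uo uo' ->
  action_iso (sum_action to uo) (sum_action to' uo').
Proof.
move=> [f [g fK gK] fa] [h [k hK kK] ha].
apply: (@action_isoI _ _ _ _
  (fun z => match z with inl x => inl (f x) | inr y => inr (h y) end)
  (fun z => match z with inl x => inl (g x) | inr y => inr (k y) end)).
- by case=> x; rewrite ?fK ?hK.
- by case=> x; rewrite ?gK ?kK.
- by case=> x a /=; rewrite ?fa ?ha.
Qed.

Lemma prod_action_iso (T U T' U' : finType)
    (to : {action G &-> T}) (uo : {action G &-> U})
    (to' : {action G &-> T'}) (uo' : {action G &-> U'}) :
  action_iso to to' -> action_iso uo uo' ->
  action_iso (prod_action to uo) (prod_action to' uo').
Proof.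
move=> [f [g fK gK] fa] [h [k hK kK] ha].
apply: (@action_isoI _ _ _ _
  (fun z => (f z.1, h z.2)) (fun z => (g z.1, k z.2))).
- by case=> x y /=; rewrite fK hK.
- by case=> x y /=; rewrite gK kK.
- by case=> x y a /=; rewrite /prod_fun /= fa ha.
Qed.

End Actions.

(* A finite G-set, with underlying set {0, ..., n - 1} so that these form a   *)
(* small type; mk_gset and mk_gsetP show that an action of G on any finite    *)
(* type is represented up to isomorphism. The library's actions are right     *)
(* actions; letting a act through a^-1 turns them into left actions and is    *)
(* compatible with isomorphisms, sums and products.                           *)
Record gset (G : finGroupType) := GSet {
  gset_card : nat;
  gset_act : {action G &-> 'I_gset_card}
}.

HB.instance Definition _ (G : finGroupType) := gen_eqMixin (gset G).
HB.instance Definition _ (G : finGroupType) := gen_choiceMixin (gset G).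

Section Classes.

Variable G : finGroupType.
Implicit Types X Y Z : gset G.

Section Transport.

Variables (T : finType) (to : {action G &-> T}).
Local Open Scope group_scope.

Definition ord_fun (i : 'I_#|T|) (a : G) := enum_rank (to (enum_val i) a).

Fact ord_fun1 : ord_fun^~ 1 =1 id.
Proof. by move=> i; rewrite /ord_fun act1 enum_valK. Qed.
Fact ord_funM i : act_morph ord_fun i.
Proof. by move=> a b; rewrite /ord_fun enum_rankK actM. Qed.

Definition mk_gset : gset G := GSet (TotalAction ord_fun1 ord_funM).

Lemma mk_gsetP : action_iso to (gset_act mk_gset).
Proof.
exists enum_rank; first exact: enum_rank_bij.
by move=> x a; rewrite /= /ord_fun enum_rankK.
Qed.

End Transport.

Definition gset0 : gset G := mk_gset (triv_action G void).
Definition gset1 : gset G := mk_gset (triv_action G unit).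
Definition gset_sum X Y := mk_gset (sum_action (gset_act X) (gset_act Y)).
Definition gset_prod X Y := mk_gset (prod_action (gset_act X) (gset_act Y)).

Definition gset_iso X Y : bool := `[< action_iso (gset_act X) (gset_act Y) >].

Lemma gset_iso_refl : reflexive gset_iso.
Proof. by move=> X; apply/asboolP/action_iso_refl. Qed.

Lemma gset_iso_sym : symmetric gset_iso.
Proof. by move=> X Y; apply/asboolP/asboolP => /action_iso_sym. Qed.

Lemma gset_iso_trans : transitive gset_iso.
Proof.
by move=> Y X Z /asboolP XY /asboolP YZ; apply/asboolP/(action_iso_trans XY).
Qed.

Canonical gset_iso_equiv :=
  EquivRel gset_iso gset_iso_refl gset_iso_sym gset_iso_trans.

Definition gset_class := {eq_quot gset_iso}.

HB.instance Definition _ : EqQuotient _ gset_iso gset_class :=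
  EqQuotient.on gset_class.
HB.instance Definition _ := Choice.on gset_class.

Lemma pi_gsetP X Y : action_iso (gset_act X) (gset_act Y) <->
  \pi_gset_class X = \pi_gset_class Y.
Proof. by split=> [XY | /eqmodP/asboolP//]; apply/eqmodP/asboolP. Qed.

Lemma gset_repr X :
  action_iso (gset_act X) (gset_act (generic_quotient.repr (\pi_gset_class X))).
Proof. by apply/pi_gsetP; rewrite reprK. Qed.

Definition class_of (T : finType) (to : {action G &-> T}) : gset_class :=
  \pi_gset_class (mk_gset to).

Lemma class_ofP (T U : finType)
    (to : {action G &-> T}) (uo : {action G &-> U}) :
  action_iso to uo <-> class_of to = class_of uo.
Proof.
have [tP uP] := (mk_gsetP to, mk_gsetP uo).
split=> [tu | /pi_gsetP tu].
  apply/pi_gsetP; apply: action_iso_trans (action_iso_sym tP) _.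
  exact: action_iso_trans tu uP.
exact: action_iso_trans (action_iso_trans tP tu) (action_iso_sym uP).
Qed.

Lemma class_ofW (P : gset_class -> Prop) :
    (forall (T : finType) (to : {action G &-> T}), P (class_of to)) ->
  forall c, P c.
Proof.
move=> Pto; elim/quotW=> X; have := Pto _ (gset_act X); congr P.
by apply/esym/pi_gsetP/mk_gsetP.
Qed.

Definition class0 : gset_class := \pi_gset_class gset0.
Definition class1 : gset_class := \pi_gset_class gset1.
Definition class_add := lift_op2 gset_class gset_sum.
Definition class_mul := lift_op2 gset_class gset_prod.

Section ClassOf.

Variables (T U : finType) (to : {action G &-> T}) (uo : {action G &-> U}).

Let repr_class_of (V : finType) (vo : {action G &-> V}) :
  action_iso (gset_act (generic_quotient.repr (class_of vo))) vo.
Proof.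
apply: action_iso_sym; apply: action_iso_trans (mk_gsetP vo) _.
exact: gset_repr.
Qed.

Lemma class_of_add :
  class_add (class_of to) (class_of uo) = class_of (sum_action to uo).
Proof.
by unlock class_add; apply/class_ofP/sum_action_iso; apply: repr_class_of.
Qed.

Lemma class_of_mul :
  class_mul (class_of to) (class_of uo) = class_of (prod_action to uo).
Proof.
by unlock class_mul; apply/class_ofP/prod_action_iso; apply: repr_class_of.
Qed.

End ClassOf.

Lemma class_addA : associative class_add.
Proof.
elim/class_ofW=> T to; elim/class_ofW=> U uo; elim/class_ofW=> V vo.
rewrite !class_of_add; apply/class_ofP; apply: (@action_isoI _ _ _ _ _
  (fun w => match w with inl x => inl (inl x) | inr (inl y) => inl (inr y)
                       | inr (inr z) => inr z end)
  (fun w => match w with inl (inl x) => inl x | inl (inr y) => inr (inl y)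
                       | inr z => inr (inr z) end)).
- by case=> [|[]].
- by case=> [[]|].
- by case=> [|[]].
Qed.

Lemma class_addC : commutative class_add.
Proof.
elim/class_ofW=> T to; elim/class_ofW=> U uo.
rewrite !class_of_add; apply/class_ofP; apply: (@action_isoI _ _ _ _ _
  (fun w => match w with inl x => inr x | inr y => inl y end)
  (fun w => match w with inl x => inr x | inr y => inl y end)); by case.
Qed.

Lemma class_add0 : left_id class0 class_add.
Proof.
elim/class_ofW=> T to; rewrite class_of_add; apply/class_ofP.
by exists (fun w : void + T =>
    match w with inl x => match x with end | inr y => y end);
  [exists inr; first by case=> [[]|] | case=> [[]|]].
Qed.

Lemma class_mulA : associative class_mul.
Proof.
elim/class_ofW=> T to; elim/class_ofW=> U uo; elim/class_ofW=> V vo.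
rewrite !class_of_mul; apply/class_ofP; apply: (@action_isoI _ _ _ _ _
  (fun w => ((w.1, w.2.1), w.2.2)) (fun w => (w.1.1, (w.1.2, w.2)))) => //.
- by case=> ? [].
- by case=> [[]].
Qed.

Lemma class_mulC : commutative class_mul.
Proof.
elim/class_ofW=> T to; elim/class_ofW=> U uo.
rewrite !class_of_mul; apply/class_ofP; apply: (@action_isoI _ _ _ _ _
  (fun w => (w.2, w.1)) (fun w => (w.2, w.1))); by case.
Qed.

Lemma class_mul1 : left_id class1 class_mul.
Proof.
elim/class_ofW=> T to; rewrite class_of_mul; apply/class_ofP.
by exists snd => //; exists (pair tt) => // -[[]].
Qed.

Lemma class_mulDl : left_distributive class_mul class_add.
Proof.
elim/class_ofW=> T to; elim/class_ofW=> U uo; elim/class_ofW=> V vo.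
rewrite !(class_of_mul, class_of_add); apply/class_ofP.
apply: (@action_isoI _ _ _ _ _
  (fun w => match w.1 with inl x => inl (x, w.2) | inr y => inr (y, w.2) end)
  (fun w => match w with inl p => (inl p.1, p.2) | inr p => (inr p.1, p.2)
            end)).
- by case=> [[]].
- by case=> [[]|[]].
- by case=> [[]].
Qed.

Lemma class_mul0 : left_zero class0 class_mul.
Proof.
elim/class_ofW=> T to; rewrite class_of_mul; apply/class_ofP.
by exists fst; [exists (fun w : void => match w with end) => [[[]]|[]]
  | case=> [[]]].
Qed.

HB.instance Definition _ :=
  GRing.isNmodule.Build gset_class class_addA class_addC class_add0.
HB.instance Definition _ :=
  GRing.Nmodule_isComPzSemiRing.Build gset_class
    class_mulA class_mulC class_mul1 class_mulDl class_mul0.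

End Classes.

Section Grothendieck.

Variable S : comPzSemiRingType.
Local Open Scope ring_scope.
Implicit Types x y z : S * S.

(* (a, b) stands for the formal difference a - b; S need not be cancellative. *)
Definition groth_eq x y : bool :=
  `[< exists k, x.1 + y.2 + k = y.1 + x.2 + k >].

Lemma groth_eq_refl : reflexive groth_eq.
Proof. by move=> x; apply/asboolP; exists 0. Qed.

Lemma groth_eq_sym : symmetric groth_eq.
Proof. by move=> x y; apply/asboolP/asboolP => -[k e]; exists k. Qed.

Lemma groth_eq_trans : transitive groth_eq.
Proof.
move=> y x z /asboolP[k e] /asboolP[l f]; apply/asboolP.
exists (y.1 + y.2 + k + l).
transitivity ((x.1 + y.2 + k) + (y.1 + z.2 + l)).
  by rewrite (AC (2*4) (1*4*5*(3*2*6)))/=.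
rewrite e f (AC (3*3) (4*2*(1*5*3*6)))/=.
by rewrite !addrA.
Qed.

Canonical groth_equiv :=
  EquivRel groth_eq groth_eq_refl groth_eq_sym groth_eq_trans.

Definition groth := {eq_quot groth_eq}.

HB.instance Definition _ : EqQuotient _ groth_eq groth := EqQuotient.on groth.
HB.instance Definition _ := Choice.on groth.

Lemma grothP x y :
  reflect (exists k, x.1 + y.2 + k = y.1 + x.2 + k)
          (\pi_groth x == \pi_groth y).
Proof. by rewrite eqmodE; apply: asboolP. Qed.

Lemma groth_eqI x y : x.1 + y.2 = y.1 + x.2 -> groth_eq x y.
Proof. by move=> e; apply/asboolP; exists 0; rewrite e. Qed.

Lemma groth_repr x : groth_eq x (generic_quotient.repr (\pi_groth x)).
Proof. by apply/eqmodP; rewrite reprK. Qed.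

Definition groth0 : groth := lift_cst groth (0, 0).
Canonical pi_groth0_morph := PiConst groth0.
Definition groth1 : groth := lift_cst groth (1, 0).
Canonical pi_groth1_morph := PiConst groth1.

Definition pair_opp x : S * S := (x.2, x.1).
Definition pair_add x y : S * S := (x.1 + y.1, x.2 + y.2).
Definition pair_mul x y : S * S :=
  (x.1 * y.1 + x.2 * y.2, x.1 * y.2 + x.2 * y.1).

Definition groth_opp := lift_op1 groth pair_opp.
Lemma pi_groth_opp : {morph \pi : x / pair_opp x >-> groth_opp x}.
Proof.
move=> x; unlock groth_opp; apply/eqmodP/asboolP => /=.
have /asboolP[k e] := groth_repr x; exists k.
by rewrite [x.2 + _]addrC -e [x.1 + _]addrC.
Qed.
Canonical pi_groth_opp_morph := PiMorph1 pi_groth_opp.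

Definition groth_add := lift_op2 groth pair_add.
Lemma pi_groth_add : {morph \pi : x y / pair_add x y >-> groth_add x y}.
Proof.
move=> x y; unlock groth_add; apply/eqmodP/asboolP => /=.
have /asboolP[k e] := groth_repr x; have /asboolP[l f] := groth_repr y.
exists (k + l).
by rewrite (AC (2*2*2) (1*3*5*(2*4*6)))/= e f (AC (3*3) (1*4*(2*5)*(3*6))).
Qed.
Canonical pi_groth_add_morph := PiMorph2 pi_groth_add.

Lemma pair_mulC : commutative pair_mul.
Proof.
move=> x y; rewrite /pair_mul [x.1 * y.1]mulrC [x.2 * y.2]mulrC.
by rewrite [x.1 * y.2 + _]addrC [x.1 * y.2]mulrC [x.2 * y.1]mulrC.
Qed.

Lemma pair_mul_eq x x' y :
  groth_eq x x' -> groth_eq (pair_mul x y) (pair_mul x' y).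
Proof.
move=> /asboolP[k e]; apply/asboolP; exists (k * y.1 + k * y.2) => /=.
transitivity ((x.1 + x'.2 + k) * y.1 + (x'.1 + x.2 + k) * y.2).
  by rewrite !mulrDl (AC (2*2*2) (1*4*5*(3*2*6))).
transitivity ((x'.1 + x.2 + k) * y.1 + (x.1 + x'.2 + k) * y.2).
  by rewrite e.
by rewrite !mulrDl (AC (3*3) (1*5*(4*2)*(3*6))).
Qed.

Definition groth_mul := lift_op2 groth pair_mul.
Lemma pi_groth_mul : {morph \pi : x y / pair_mul x y >-> groth_mul x y}.
Proof.
move=> x y; unlock groth_mul; apply/eqmodP.
apply: groth_eq_trans (pair_mul_eq y (groth_repr x)) _.
rewrite [pair_mul _ y]pair_mulC [in X in groth_eq _ X]pair_mulC.
exact/pair_mul_eq/groth_repr.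
Qed.
Canonical pi_groth_mul_morph := PiMorph2 pi_groth_mul.

Lemma groth_addA : associative groth_add.
Proof.
elim/quotW=> x; elim/quotW=> y; elim/quotW=> z; rewrite !piE.
by rewrite /pair_add /= !addrA.
Qed.

Lemma groth_addC : commutative groth_add.
Proof.
elim/quotW=> x; elim/quotW=> y; rewrite !piE /pair_add.
by rewrite [x.1 + _]addrC [x.2 + _]addrC.
Qed.

Lemma groth_add0 : left_id groth0 groth_add.
Proof. by elim/quotW=> -[a b]; rewrite !piE /pair_add /= !add0r. Qed.

Lemma groth_addN : left_inverse groth0 groth_opp groth_add.
Proof.
elim/quotW=> x; rewrite !piE; apply/eqmodP/groth_eqI.
by rewrite /= addr0 add0r addrC.
Qed.

Lemma groth_mulA : associative groth_mul.
Proof.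
elim/quotW=> x; elim/quotW=> y; elim/quotW=> z; rewrite !piE.
rewrite /pair_mul /= !mulrDl !mulrDr !mulrA.
by congr (\pi_groth (_, _)); rewrite (AC (2*2) (1*4*(2*3))).
Qed.

Lemma groth_mulC : commutative groth_mul.
Proof.
by elim/quotW=> x; elim/quotW=> y; rewrite !piE pair_mulC.
Qed.

Lemma groth_mul1 : left_id groth1 groth_mul.
Proof.
by elim/quotW=> -[a b]; rewrite !piE /pair_mul /= !mul1r !mul0r !addr0.
Qed.

Lemma groth_mulDl : left_distributive groth_mul groth_add.
Proof.
elim/quotW=> x; elim/quotW=> y; elim/quotW=> z; rewrite !piE.
rewrite /pair_mul /pair_add /= !mulrDl.
by congr (\pi_groth (_, _)); rewrite addrACA.
Qed.

HB.instance Definition _ :=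
  GRing.isZmodule.Build groth groth_addA groth_addC groth_add0 groth_addN.
HB.instance Definition _ :=
  GRing.Zmodule_isComPzRing.Build groth
    groth_mulA groth_mulC groth_mul1 groth_mulDl.

End Grothendieck.

Definition burnside (G : finGroupType) : comPzRingType := groth (gset_class G).

Definition same_order_type (G H : finGroupType) : Prop :=
  forall d : nat, (0 < d)%N ->
    #|('Ldiv_d() : {set G})%g| = #|('Ldiv_d() : {set H})%g|.

(* Main.v *)
Require Import Defs.
From mathcomp Require Import all_boot all_fingroup all_solvable all_algebra.
From mathcomp Require Import boolp.

Set Implicit Arguments.
Unset Strict Implicit.
Unset Printing Implicit Defensive.

Import GroupScope GRing.Theory.

(** The marks of a finite [G]-set, the numbers of its points fixed by the
    subgroups [K] of [G], embed the Burnside ring of [G] into the ring of integer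
    functions on the conjugacy classes of subgroups. The image consists of the
    combinations of the marks of the sets [G / U], and also of the functions that
    satisfy the Cauchy-Frobenius congruences ([integralP]); call them integral.
    A ring morphism from the Burnside ring to the integers is a mark
    ([burnside_hom_mark]), so a ring isomorphism yields a bijection [s] between
    the classes of subgroups of [G] and [H] that transports integral functions
    ([burnside_iso_integral_iso]).

    Suppose first that [s] fixes the trivial group. The number of orbits of a
    [G]-set is the average of its marks over the cyclic groups [<[g]>]; averaging
    over [H] through [s] gives a second functional with integral values. The
    coefficient of a cyclic group [C] in the first one is the quotient of the
    product of the [p - 1], for [p] dividing [#|C|], by
    [#|'N(C) : C| * radical #|C|], and this denominator is an invariant of the
    ring, being the least integer whose product with the indicator of the class
    of [C] is integral ([integral_indicator_cyclic]). Comparing the two functionals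
    on the marks of [G / C], by induction on [C], shows that they coincide: [s]
    respects cyclicity and the number of elements generating a conjugate of [C]
    ([cyclic_weight]). It also respects the order of [C] ([cyclic_order]):
    congruences modulo primes reduce this to [p]-groups, and there the size of
    the other groups in the support of an integral function controls the
    divisibility of its values ([pgroup_support_dvd]). Elements of
    given order are then equally numerous in [G] and [H].

    In general [s] maps the trivial group to some [V]. The least integral multiple
    of the indicator of [V] is then [#|H|], which forces [V] to be normal and
    cyclic of squarefree order ([base_normal], [base_cyclic], [base_Sylow]). Let
    [p] be the largest prime dividing [#|V|] and [Q] the subgroup of order [p] of
    [V]. A [p]-subgroup of [H] that does not contain [Q] must have order 1, or at
    most 2 if [p = 2]: transporting to [G] suitable integral functions supported
    near it contradicts the orbit count or the control by supports
    ([base_unique_line]). This is what is needed for the exchange of each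
    [p']-group [W] with [Q <*> W] to preserve integral functions
    ([integral_swap]). Composing [s] with this exchange replaces [V] by its
    [p']-part, and iterating leads to the first case
    ([integral_iso_normalise]). *)

(** * Conjugacy classes of subgroups and marks *)

Section Conjugacy.

Local Open Scope nat_scope.
Local Open Scope group_scope.
Variable gT : finGroupType.
Implicit Types (K L U V P : {group gT}) (g h : gT).

Definition conjugate K L := [exists g, (K :^ g)%G == L].

Lemma conjugateP K L : reflect (exists g, L = (K :^ g)%G) (conjugate K L).
Proof.
by apply: (iffP existsP) => -[g] => [/eqP<- | ->]; exists g.
Qed.

Lemma conjugate_refl K : conjugate K K.
Proof. by apply/conjugateP; exists 1; apply/val_inj; rewrite /= conjsg1. Qed.

Lemma conjugateJ K g : conjugate K (K :^ g)%G.
Proof. by apply/conjugateP; exists g. Qed.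

Lemma conjugate_sym K L : conjugate K L = conjugate L K.
Proof.
apply/conjugateP/conjugateP => -[g ->]; exists g^-1; apply/val_inj.
  by rewrite /= conjsgK.
by rewrite /= conjsgK.
Qed.

Lemma conjugate_trans K L V : conjugate K L -> conjugate L V -> conjugate K V.
Proof.
move=> /conjugateP[g ->] /conjugateP[h ->]; apply/conjugateP; exists (g * h).
by apply/val_inj; rewrite /= conjsgM.
Qed.

Lemma conjugate_card K L : conjugate K L -> #|L| = #|K|.
Proof. by case/conjugateP=> g ->; rewrite /= cardJg. Qed.

Lemma conjugate_eql K L : conjugate K L -> conjugate K =1 conjugate L.
Proof.
move=> KL V; apply/idP/idP; last exact: conjugate_trans.
by apply: conjugate_trans; rewrite conjugate_sym.
Qed.

(** Picked from the predicate [conjugate K] alone, so that conjugate groups get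
    the same representative. *)
Definition class_rep K := odflt K [pick L | conjugate K L].

Lemma class_repP K : conjugate K (class_rep K).
Proof.
by rewrite /class_rep; case: pickP => // /(_ K); rewrite conjugate_refl.
Qed.

Lemma class_rep_eq K L : (class_rep K == class_rep L) = conjugate K L.
Proof.
apply/eqP/idP => [e | KL].
  by rewrite (conjugate_eql (class_repP K)) e conjugate_sym class_repP.
rewrite /class_rep (eq_pick (conjugate_eql KL)).
by case: pickP => // /(_ L); rewrite conjugate_refl.
Qed.

Definition is_rep K := class_rep K == K.

Lemma is_rep_rep K : is_rep (class_rep K).
Proof. by rewrite /is_rep class_rep_eq conjugate_sym class_repP. Qed.

Lemma is_rep_inj K L : is_rep K -> is_rep L -> conjugate K L -> K = L.
Proof.
move=> /eqP rK /eqP rL KL; apply: etrans (esym rK) _; apply: etrans rL.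
by apply/eqP; rewrite class_rep_eq.
Qed.

Lemma conjugate_norm K : 'N(K) = setT -> forall L, conjugate K L -> L = K.
Proof.
move=> nK L /conjugateP[g ->]; apply/val_inj/normP.
by rewrite nK inE.
Qed.

Lemma conjugate_normal K L : K <| [set: gT] -> conjugate K L -> L = K.
Proof.
case/andP=> _ nK; apply: conjugate_norm.
by apply/eqP; rewrite eqEsubset subsetT.
Qed.

Lemma conjugate_cyclic K L : conjugate K L -> cyclic L = cyclic K.
Proof. by case/conjugateP=> g ->; rewrite /= cyclicJ. Qed.

Lemma conjugate_card_index K L :
  conjugate K L -> #|'N(L) : L| = #|'N(K) : K|.
Proof. by case/conjugateP=> g ->; rewrite /= normJ indexJg. Qed.

Lemma card_norm_index K : (#|'N(K) : K| * #|K| = #|'N(K)|)%N.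
Proof. by rewrite mulnC Lagrange // normG. Qed.

Definition mark U K : nat := #|'Fix_(rcosets U [set: gT] | 'Rs)(K)|.

(** Counting the elements of the fixed cosets avoids the division by the order
    of [U] in the usual formula for marks. *)
Lemma mark_card U K :
  (mark U K * #|U|)%N = #|[set g | K :^ g \subset U]|.
Proof.
have -> : #|[set g | K :^ g \subset U]| = #|[set g | K \subset U :^ g]|.
  rewrite -(card_imset _ (@invg_inj gT)); congr #|pred_of_set _|.
  apply/setP=> g; rewrite !inE; apply/imsetP/idP => [[h] | sKU].
    by rewrite inE => sKU ->; rewrite -sub_conjg.
  by exists g^-1; rewrite ?invgK // inE sub_conjgV.
rewrite /mark -[RHS]sum1_card.
rewrite (partition_big (fun g => U :* g)
  (mem 'Fix_(rcosets U [set: gT] | 'Rs)(K))) /=; last first.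
  move=> g; rewrite inE => sKU; rewrite inE sub_afixRs_norms sKU andbT.
  by apply/rcosetsP; exists g; rewrite ?inE.
rewrite -sum_nat_const; apply: eq_bigr => A; rewrite inE.
case/andP=> /rcosetsP[g _ ->]; rewrite sub_afixRs_norms => sKU.
rewrite sum1dep_card -(card_rcoset U g); congr #|pred_of_set _|; apply/setP=> h.
rewrite !inE; apply/idP/andP => [/rcoset_eqP hU | [_ /eqP <-]]; last first.
  exact: rcoset_refl.
by rewrite -sub_afixRs_norms hU sub_afixRs_norms.
Qed.

Lemma mark_gt0P U K : reflect (exists g, K :^ g \subset U) (0 < mark U K)%N.
Proof.
have -> : (0 < mark U K)%N = (0 < mark U K * #|U|)%N.
  by rewrite muln_gt0 cardG_gt0 andbT.
rewrite mark_card card_gt0; set A := finset _.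
by apply: (iffP (set0Pn A)) => -[g Kg]; exists g; move: Kg; rewrite inE.
Qed.

Lemma markJ U K g : mark U (K :^ g)%G = mark U K.
Proof.
apply/eqP; rewrite -(eqn_pmul2r (cardG_gt0 U)) !mark_card; apply/eqP.
rewrite -[RHS](card_imset _ (mulgI g^-1)); congr #|pred_of_set _|.
apply/setP=> h; rewrite inE /=; rewrite -conjsgM; apply/idP/imsetP => [sK|[k]].
  by exists (g * h); rewrite ?mulKg // inE.
by rewrite inE => sK ->; rewrite mulKVg.
Qed.

Lemma mark_conjugate U K L : conjugate K L -> mark U L = mark U K.
Proof. by case/conjugateP=> g ->; rewrite markJ. Qed.

Lemma mark_dvd U K : (0 < mark U K)%N -> #|K| %| #|U|.
Proof. by case/mark_gt0P=> g /cardSg; rewrite cardJg. Qed.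

Lemma mark_gt0_card U K : (0 < mark U K)%N -> #|K| = #|U| -> conjugate U K.
Proof.
case/mark_gt0P=> g sKU eKU; rewrite conjugate_sym; apply/conjugateP; exists g.
by apply/esym/val_inj/eqP; rewrite eqEcard sKU /= cardJg eKU /=.
Qed.

Lemma mark_self U : mark U U = #|'N(U) : U|.
Proof.
apply/eqP; rewrite -(eqn_pmul2r (cardG_gt0 U)) mark_card card_norm_index.
by apply/eqP; congr #|pred_of_set _|; apply/setP=> g; rewrite !inE.
Qed.

Lemma mark1 U : (mark U 1%G * #|U|)%N = #|[set: gT]|.
Proof.
rewrite mark_card; congr #|pred_of_set _|; apply/setP=> g.
by rewrite !inE conjs1g sub1G.
Qed.

Lemma mark_normal U K : K <| [set: gT] -> K \subset U ->
  (mark U K * #|U|)%N = #|[set: gT]|.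
Proof.
move=> /andP[_ nK] sKU; rewrite mark_card; congr #|pred_of_set _|.
apply/setP=> g; rewrite !inE.
by have /normP-> : g \in 'N(K) by rewrite (subsetP nK) ?inE.
Qed.

Lemma mark_normal_gt0 U K : K <| [set: gT] -> (0 < mark U K)%N -> K \subset U.
Proof.
move=> /andP[_ nK] /mark_gt0P[g].
by have /normP-> : g \in 'N(K) by rewrite (subsetP nK) ?inE.
Qed.

(** The Cauchy-Frobenius count of the orbits of [P / U] on the fixed points of
    [U], multiplied by the order of [U] so that the sum runs over [P]. *)
Lemma card_fix_dvd (T : finType) (to : {action gT &-> T}) (S : {set T}) U P :
    [acts [set: gT], on S | to] -> U <| P ->
  #|P| %| \sum_(g in P) #|'Fix_(S | to)(U <*> <[g]>)|.
Proof.
move=> actS /andP[_ nUP].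
have actP : [acts P, on S :&: 'Fix_to(U) | to].
  apply: actsI; first exact: subset_trans (subsetT _) actS.
  exact: acts_fix_norm.
have /= <- : \sum_(g in P) #|'Fix_(S :&: 'Fix_to(U) | to)[g]|
    = \sum_(g in P) #|'Fix_(S | to)(U <*> <[g]>)|.
  apply: eq_bigr => g _; congr #|pred_of_set _|.
  rewrite -setIA; congr (_ :&: _).
  by rewrite /= afix_gen afixU afix_cycle.
by rewrite (Frobenius_Cauchy actP) dvdn_mull.
Qed.

End Conjugacy.

(** * The congruences between marks *)

Section Integral.

Local Open Scope group_scope.
Local Open Scope ring_scope.
Variable gT : finGroupType.
Implicit Types (K L U V P : {group gT}) (x y : {group gT} -> int) (g h : gT).

(** The Cauchy-Frobenius congruence for [P / U], summed over [P] instead. *)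
Definition congruence_at (x : {group gT} -> int) U P :=
  (#|P|%:Z %| \sum_(g in P) x (U <*> <[g]>)%G)%Z.

Definition class_function (x : {group gT} -> int) :=
  forall K g, x (K :^ g)%G = x K.

(** These functions are exactly the integer combinations of marks, that is the
    image of the Burnside ring in the product of copies of the integers indexed
    by the classes of subgroups: see [integral_span]. *)
Definition integral (x : {group gT} -> int) :=
  class_function x /\ forall U P, U <| P -> congruence_at x U P.

(** By [integralP] the congruences over [p]-groups [P / U], for all primes [p],
    imply all the others. *)
Definition integral_at (p : nat) (x : {group gT} -> int) :=
  forall U P, U <| P -> p.-nat #|P : U| -> congruence_at x U P.

Lemma class_function_conj x K L : class_function x -> conjugate K L -> x L = x K.
Proof. by move=> xJ /conjugateP[g ->]; apply: xJ. Qed.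

Lemma integral_fix (T : finType) (to : {action gT &-> T}) (S : {set T}) :
    [acts [set: gT], on S | to] ->
  forall U P, U <| P -> congruence_at (fun K => #|'Fix_(S | to)(K)|%:Z) U P.
Proof.
move=> actS U P nUP; rewrite /congruence_at -(big_morph _ PoszD (erefl 0%:Z)).
exact: card_fix_dvd.
Qed.

Lemma integral_mark U : integral (fun K => (mark U K)%:Z).
Proof.
split=> [K g | V P]; first by rewrite markJ.
by apply: integral_fix; apply: actsRs_rcosets.
Qed.

Lemma integral_sum (I : finType) (c : I -> int) (y : I -> {group gT} -> int) :
  (forall i, integral (y i)) -> integral (fun K => \sum_i c i * y i K).
Proof.
move=> yB; split=> [K g | U P nUP].
  by apply: eq_bigr => i _; rewrite (proj1 (yB i)).
rewrite /congruence_at exchange_big /=; apply: rpred_sum => i _.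
by rewrite -mulr_sumr; apply/dvdz_mull/(proj2 (yB i)).
Qed.

Lemma integralB x y : integral x -> integral y -> integral (fun K => x K - y K).
Proof.
move=> [xJ xB] [yJ yB]; split=> [K g | U P nUP]; first by rewrite xJ yJ.
by rewrite /congruence_at sumrB; apply: rpredB; [apply: xB | apply: yB].
Qed.

Lemma integralZ c x : integral x -> integral (fun K => c * x K).
Proof.
move=> [xJ xB]; split=> [K g | U P nUP]; first by rewrite xJ.
by rewrite /congruence_at -mulr_sumr; apply/dvdz_mull/xB.
Qed.

End Integral.

(** * The congruences characterise the combinations of marks *)

Section Membership.

Local Open Scope group_scope.
Local Open Scope ring_scope.
Variable gT : finGroupType.
Implicit Types (K L U V P : {group gT}) (x y : {group gT} -> int) (g h : gT).

Lemma joing_cycle_in U g : g \in U -> (U <*> <[g]>)%G = U.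
Proof.
by move=> Ug; apply/val_inj/joing_idPl; rewrite cycle_subG.
Qed.

Lemma joing_cycle_card U g : g \notin U -> (#|U| < #|U <*> <[g]>|)%N.
Proof.
move=> Ug; apply: proper_card; rewrite properE joing_subl /=.
by apply: contra Ug => /(subset_trans (joing_subr _ _)); rewrite cycle_subG.
Qed.

Lemma sum_joing_cycle x U P : U \subset P ->
  \sum_(g in P) x (U <*> <[g]>)%G
    = #|U|%:Z * x U + \sum_(g in P :\: U) x (U <*> <[g]>)%G.
Proof.
move=> sUP; rewrite (big_setID U) /= (setIidPr sUP); congr (_ + _).
rewrite (eq_bigr (fun=> x U)) => [|g Ug]; last by rewrite joing_cycle_in.
by rewrite sumr_const -mulr_natl natz.
Qed.

Lemma congruence_top x U P : U <| P -> congruence_at x U P ->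
    (forall g, g \in P -> g \notin U -> x (U <*> <[g]>)%G = 0) ->
  (#|P : U|%:Z %| x U)%Z.
Proof.
move=> nUP; rewrite /congruence_at sum_joing_cycle ?normal_sub // => + x0.
rewrite [\sum_(g in _) _]big1 ?addr0 => [|g]; last first.
  by rewrite inE => /andP[Ug Pg]; apply: x0.
by rewrite -(Lagrange (normal_sub nUP)) PoszM dvdz_mul2l // eqz_nat -lt0n cardG_gt0.
Qed.

Lemma Sylow_over (p : nat) U (G : {group gT}) : U <| G ->
  exists P : {group gT}, [/\ U <| P, P \subset G & #|P : U| = (#|G : U|`_p)%N].
Proof.
move=> nUG; have [Q sylQ] := Sylow_exists p (G / U).
have [P defQ sUP sPG] := inv_quotientS nUG (pHall_sub sylQ).
have nUP : U <| P := normalS sUP sPG nUG.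
exists P; split=> //.
by rewrite -!card_quotient ?normal_norm // -(card_Hall sylQ) defQ.
Qed.

(** Triangularity: the value at a largest group [U] of the support is divisible
    by the index of [U] in its normaliser, as the congruences at the Sylow
    subgroups over [U] show prime by prime; hence it can be cleared by a
    multiple of the marks of [G / U], and one goes down. *)
Lemma integral_span (S : pred {group gT}) x :
    class_function x -> (forall p, prime p -> integral_at p x) ->
    (forall U K, S U -> (0 < mark U K)%N -> S K) ->
    (forall K, x K != 0 -> S K) ->
  exists2 c : {group gT} -> int, forall U, c U != 0 -> S U &
    forall K, x K = \sum_(U : {group gT}) c U * (mark U K)%:Z.
Proof.
move=> xJ xB Sdown xS.
have [n] : exists n, forall K, x K != 0 -> (#|K| < n)%N.
  by exists #|[set: gT]|.+1 => K _; rewrite ltnS subset_leq_card ?subsetT.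
elim: n x xJ xB xS => [|n IHn] x xJ xB xS xn.
  exists (fun=> 0) => [U|K]; first by rewrite eqxx.
  rewrite big1 => [|U _]; last by rewrite mul0r.
  by apply/eqP; apply: contraT => /xn.
have idx U : #|U| = n -> (#|'N(U) : U|%:Z %| x U)%Z.
  move=> Un; rewrite dvdzE /=; apply/dvdn_partP=> [|p]; first exact: indexg_gt0.
  rewrite mem_primes => /andP[p_pr _].
  have [P [nUP sPN iP]] := Sylow_over p (normalG U); rewrite -iP.
  have pP : p.-nat #|P : U| by rewrite iP part_pnat.
  apply: (congruence_top nUP (xB p p_pr U P nUP pP)) => g _ Ug.
  apply/eqP; apply: contraT => /xn; rewrite ltnS leqNgt -Un.
  by rewrite joing_cycle_card.
(* Only one group per class, lest a multiple be subtracted several times. *)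
pose c U := if is_rep U && (#|U| == n) then (x U %/ #|'N(U) : U|%:Z)%Z else 0.
pose y K := \sum_(U : {group gT}) c U * (mark U K)%:Z.
have yB : integral y by apply: integral_sum => U; apply: integral_mark.
have cS U : c U != 0 -> S U.
  rewrite /c; case: ifP => [_|]; last by rewrite eqxx.
  by move=> cU; apply: xS; apply: contraNneq cU => ->; rewrite div0z.
have c_card U : c U != 0 -> #|U| = n.
  by rewrite /c; case: ifP => [/andP[_ /eqP]|]; rewrite ?eqxx.
have y_neq0 K : y K != 0 -> exists2 U, c U != 0 & (0 < mark U K)%N.
  move=> yK; have [U cU|all0] := pickP (fun U => (c U != 0) && (0 < mark U K)%N).
    by case/andP: cU; exists U.
  case/negP: yK; rewrite /y big1 // => U _; have := all0 U.
  case: eqP => [-> _|_ /= /negbT]; first by rewrite mul0r.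
  by rewrite -eqn0Ngt => /eqP->; rewrite mulr0.
have [||||d dS defx] := IHn (fun K => x K - y K).
- by move=> K g; rewrite xJ (proj1 yB).
- move=> p p_pr U P nUP pP; rewrite /congruence_at sumrB; apply: rpredB.
    exact: xB p_pr _ _ _ _.
  exact: (proj2 yB).
- move=> K xyK; have [xK|] := eqVneq (x K) 0; last exact: xS.
  have /y_neq0[U /cS SU] : y K != 0 by rewrite xK sub0r oppr_eq0 in xyK.
  exact: Sdown.
- move=> K xyK; have leKn : (#|K| <= n)%N.
    have [xK|/xn //] := eqVneq (x K) 0.
    have /y_neq0[U /c_card<-] : y K != 0 by rewrite xK sub0r oppr_eq0 in xyK.
    by move/mark_dvd/dvdn_leq; apply; apply: cardG_gt0.
  rewrite ltn_neqAle leKn andbT; apply: contraNneq xyK => Kn.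
  have rK := class_repP K; have rn := conjugate_card rK.
  rewrite subr_eq0 /y (bigD1 (class_rep K)) //= big1 => [|U neU].
    rewrite /c is_rep_rep rn Kn eqxx /= addr0 -(mark_conjugate _ rK) mark_self.
    rewrite divzK ?(class_function_conj xJ rK) //.
    by rewrite -(class_function_conj xJ rK) idx // rn.
  have [-> | cU] := eqVneq (c U) 0; first by rewrite mul0r.
  have [-> | ] := posnP (mark U K); first by rewrite mulr0.
  move=> /mark_gt0_card UK; case/eqP: neU.
  have {}UK : conjugate U K by rewrite UK // Kn c_card.
  apply: is_rep_inj (is_rep_rep _) _.
    by move: cU; rewrite /c; case: (is_rep U); rewrite ?eqxx.
  exact: conjugate_trans UK rK.
exists (fun U => d U + c U) => [U|K].
  by have [-> | /cS //] := eqVneq (c U) 0; rewrite addr0; apply: dS.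
rewrite -[x K](subrK (y K)) defx -big_split /=.
by apply: eq_bigr => U _; rewrite mulrDl.
Qed.

Lemma integralP x :
  class_function x -> (forall p, prime p -> integral_at p x) -> integral x.
Proof.
move=> xJ xB.
have [//|//|c _ defx] := @integral_span predT x xJ xB.
have [yJ yB] : integral (fun K => \sum_(U : {group gT}) c U * (mark U K)%:Z).
  by apply: integral_sum => U; apply: integral_mark.
split=> // U P nUP; rewrite /congruence_at; under eq_bigr do rewrite defx.
exact: yB.
Qed.

Lemma integral_marks x : integral x ->
  exists c : {group gT} -> int,
    forall K, x K = \sum_(U : {group gT}) c U * (mark U K)%:Z.
Proof.
move=> [xJ xB]; have [|//|//|c _ defx] := @integral_span predT x xJ; last by exists c.
by move=> p _ U P nUP _; apply: xB.
Qed.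

(** Peeling off the marks as above only uses sets [G / U] with [U] in the
    support, each of which has a multiple of [#|G| / d] points. *)
Lemma integral_support_dvd x (d : nat) :
    integral x -> (forall K, x K != 0 -> (#|K| %| d)%N) ->
  (#|[set: gT]|%:Z %| d%:Z * x 1%G)%Z.
Proof.
move=> [xJ xB] xd.
have [||c cd defx] := @integral_span (fun K => #|K| %| d)%N x xJ _ _ xd.
- by move=> p _ U P nUP _; apply: xB.
- by move=> U K dU /mark_dvd/dvdn_trans; apply.
rewrite defx mulr_sumr; apply: rpred_sum => U _.
have [->|/cd /dvdnP[k ->]] := eqVneq (c U) 0; first by rewrite mul0r mulr0 dvdz0.
rewrite mulrCA -PoszM mulnAC -mulnA mark1 PoszM mulrA; apply: dvdz_mull.
exact: dvdzz.
Qed.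

End Membership.

(** * Multiples of indicators of classes *)

Section Indicators.

Local Open Scope ring_scope.
Local Open Scope nat_scope.
Local Open Scope group_scope.
Variable gT : finGroupType.
Implicit Types (K L U V W P : {group gT}) (x y : {group gT} -> int) (g h : gT).
Implicit Types (p m : nat).

Definition indicator V K : int := conjugate V K.

Lemma indicator_class V : class_function (indicator V).
Proof.
move=> K g; rewrite /indicator; congr (Posz (nat_of_bool _)).
by rewrite ![conjugate V _]conjugate_sym (conjugate_eql (conjugateJ K g)).
Qed.

Lemma congruence_indicator m V U P :
  congruence_at (fun K => m%:Z * indicator V K)%R U P
    = (#|P| %| m * #|[set g in P | conjugate V (U <*> <[g]>)%G]|).
Proof.
rewrite /congruence_at -mulr_sumr /indicator -(big_morph _ PoszD (erefl 0%:Z)).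
rewrite -PoszM dvdzE /=; congr (_ %| (_ * _)%N); rewrite -[RHS]sum1_card.
rewrite [RHS](eq_bigl (fun g => (g \in P) && conjugate V (U <*> <[g]>)%G)).
  by rewrite [RHS]big_mkcondr /=; apply: eq_bigr => g _; case: conjugate.
by move=> g; rewrite inE.
Qed.

(** The sum in a congruence is constant on the cosets of [U]. *)
Lemma congruence_dvd x U P :
    U <| P -> (forall K, U \subset K -> K \subset P -> (#|P : U|%:Z %| x K)%Z) ->
  congruence_at x U P.
Proof.
move=> nUP xd; have sUP := normal_sub nUP.
have FU g u : u \in U -> (U <*> <[u * g]>)%G = (U <*> <[g]>)%G.
  move=> Uu; apply/val_inj/eqP; rewrite /= eqEsubset !join_subG !joing_subl.
  rewrite !cycle_subG groupM ?(subsetP (joing_subl _ _) u) //=.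
    have {1}-> : g = u^-1 * (u * g) by rewrite mulKg.
    rewrite groupM ?groupV ?(subsetP (joing_subl _ _) u) //.
    by rewrite (subsetP (joing_subr _ _)) ?cycle_id.
  by rewrite (subsetP (joing_subr _ _)) ?cycle_id.
rewrite /congruence_at (partition_big (fun g => U :* g) (mem (rcosets U P))) /=.
  apply: rpred_sum => _ /rcosetsP[h Ph ->].
  rewrite (eq_bigr (fun=> x (U <*> <[h]>)%G)) => [|g]; last first.
    case/andP=> _ /eqP/rcoset_eqP/rcosetP[u Uu ->]; exact/congr1/FU.
  rewrite sumr_const.
  have -> : #|[pred g in P | U :* g == U :* h]| = #|U|.
    rewrite -(card_rcoset U h); apply: eq_card => g; rewrite !inE.
    apply/andP/idP => [[_ /eqP<-]|Ug]; first exact: rcoset_refl.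
    split; last by apply/eqP/rcoset_eqP.
    by case/rcosetP: Ug => u Uu ->; rewrite groupM // (subsetP sUP).
  rewrite -mulr_natl natz -(Lagrange sUP) PoszM dvdz_mul //.
  by apply: xd; rewrite ?joing_subl // join_subG sUP cycle_subG.
by move=> g Pg; apply/rcosetsP; exists g.
Qed.

Lemma integral_at_dvd p x : (forall K, ((#|[set: gT]|`_p)%N%:Z %| x K)%Z) ->
  integral_at p x.
Proof.
move=> px U P nUP pP; apply: congruence_dvd => // K _ _.
apply: dvdz_trans (px K); rewrite dvdzE /=.
rewrite -(part_pnat_id pP) partn_dvd ?cardG_gt0 //.
exact: dvdn_trans (dvdn_indexg _ _) (cardSg (subsetT _)).
Qed.

Lemma integral_at_p'part_dvd p q x : prime q -> q != p ->
    (forall K, ((#|[set: gT]|`_p^')%N%:Z %| x K)%Z) ->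
  integral_at q x.
Proof.
move=> q_pr neq_qp px; apply: integral_at_dvd => K; apply: dvdz_trans (px K).
have p'q : p^'.-nat (#|[set: gT]|`_q)%N.
  by apply: sub_in_pnat (part_pnat q _) => r _ /eqnP->; rewrite !inE.
by rewrite dvdzE /= -(part_pnat_id p'q) partn_dvd ?dvdn_part.
Qed.

Lemma integral_card_indicator V :
  integral (fun K => #|[set: gT]|%:Z * indicator V K)%R.
Proof.
apply: integralP => [K g|p p_pr]; first by rewrite indicator_class.
by apply: integral_at_dvd => K; rewrite dvdz_mulr // dvdzE /= dvdn_part.
Qed.

Lemma integral_indicator_of_prime p m V : #|[set: gT]|`_p^' %| m ->
    integral_at p (fun K => m%:Z * indicator V K)%R ->
  integral (fun K => m%:Z * indicator V K)%R.
Proof.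
move=> p'm mB; apply: integralP => [K g|q q_pr]; first by rewrite indicator_class.
have [-> //|neq_qp] := eqVneq q p.
by apply: integral_at_p'part_dvd neq_qp _ => // K; rewrite dvdz_mulr // dvdzE.
Qed.

Lemma sum_conj_dvd (T : {set {group gT}}) P (F : {group gT} -> nat) d :
    [acts P, on T | 'JG] ->
    (forall V g, g \in P -> F (V :^ g)%G = F V) ->
    (forall V, V \in T -> d %| #|P : 'N_P(V)| * F V) ->
  d %| \sum_(V in T) F V.
Proof.
move=> actP FJ dF.
rewrite (partition_big (orbit 'JG P) (mem (orbit 'JG P @: T))) /=; last first.
  by move=> V TV; apply: imset_f.
apply: dvdn_sum => _ /imsetP[V TV ->].
rewrite (eq_bigr (fun=> F V)) => [|W]; last first.
  case/andP=> _ /eqP oW.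
  have /orbitP[g Pg <-] : W \in orbit 'JG P V by rewrite -oW orbit_refl.
  exact: FJ.
rewrite sum_nat_const (eq_card (B := mem (orbit 'JG P V))) => [|W].
  by rewrite card_orbit astab1JG; apply: dF.
rewrite unfold_in; apply/andP/idP => [[_ /eqP<-]|oW]; first exact: orbit_refl.
by rewrite -(acts_sub_orbit _ actP) in TV; rewrite (subsetP TV) // (orbit_eqP oW).
Qed.

Lemma card_joing_cycle U V : U <| V ->
  #|[set g in V | U <*> <[g]> == V]| =
    if cyclic (V / U) then (#|U| * totient #|V : U|)%N else 0%N.
Proof.
move=> nUV; have nVU := normal_norm nUV.
have genE g : g \in V -> (U <*> <[g]> == V) = generator (V / U) (coset U g).
  move=> Vg; have Ng : g \in 'N(U) by apply: (subsetP nVU).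
  have nUg : <[g]> \subset 'N(U) by rewrite cycle_subG.
  have sW : U <*> <[g]> \subset V by rewrite join_subG normal_sub // cycle_subG.
  rewrite /generator -quotient_cycle // -(quotientYidl nUg) eq_sym.
  apply/eqP/eqP => [{1}-> // | eV]; apply: (quotient_inj nUV _ eV).
  exact: normalS (joing_subl _ _) sW nUV.
case: ifP => [/cyclicP[a defV] | ncV]; last first.
  apply/eqP; rewrite cards_eq0 -subset0; apply/subsetP=> g.
  rewrite !inE => /andP[Vg]; rewrite genE // => /eqP defV.
  by rewrite defV cycle_cyclic in ncV.
rewrite -card_quotient // {1}defV totient_gen mulnC -sum1_card.
rewrite (partition_big (coset U) (mem [set z | generator (V / U) z])) /=.
  rewrite defV -sum_nat_const; apply: eq_bigr => z; rewrite inE -defV => gz.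
  have /morphimP[h Nh Vh defz] : z \in V / U.
    by rewrite (eqP gz) cycle_id.
  rewrite sum1dep_card -(card_rcoset U h); apply: eq_card => g; rewrite !inE.
  apply/idP/idP => [/andP[/andP[Vg _] /eqP eg]|Ug].
    by apply/(rcoset_kercosetP (subsetP nVU _ Vg) Nh); rewrite eg.
  have Vg : g \in V.
    by case/rcosetP: Ug => u Uu ->; rewrite groupM // (subsetP (normal_sub nUV)).
  have eg : coset U g = z.
    by rewrite defz; apply/(rcoset_kercosetP (subsetP nVU _ Vg) Nh).
  by rewrite Vg genE // eg gz eqxx.
by move=> g; rewrite !inE => /andP[Vg]; rewrite genE.
Qed.

(** [P] permutes by conjugation the groups [W] over [U] conjugate to [V], and
    [#|U| * totient #|W : U|] elements of [P] generate a given one over [U].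
    When [#|W : U|] is [p ^ a] with [a > 0] this only provides [p ^ a.-1],
    whence one more factor [p] in the hypothesis; but then [V] has a normal
    subgroup of index [p]. *)
Lemma integral_at_indicator p m V : prime p ->
    #|'N(V) : V|`_p %| m ->
    p * #|'N(V) : V|`_p %| m \/ (forall W, W <| V -> #|V : W| != p) ->
  integral_at p (fun K => m%:Z * indicator V K)%R.
Proof.
move=> p_pr im im' U P nUP pP; rewrite congruence_indicator.
have sUP := normal_sub nUP; have nPU := normal_norm nUP.
pose T := [set W : {group gT} | [&& conjugate V W, U \subset W & W \subset P]].
pose F (W : {group gT}) := #|[set g in W | U <*> <[g]> == W]|.
have -> : #|[set g in P | conjugate V (U <*> <[g]>)%G]| = \sum_(W in T) F W.
  rewrite -sum1_card (partition_big (fun g => (U <*> <[g]>)%G) (mem T)) /=.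
    apply: eq_bigr => W; rewrite inE => /and3P[VW sUW sWP].
    rewrite sum1dep_card /F; congr #|pred_of_set _|; apply/setP=> g; rewrite !inE.
    apply/andP/andP => [[/andP[Pg _] /eqP<-]|[Wg /eqP eW]].
      by rewrite eqxx (subsetP (joing_subr _ _)) ?cycle_id.
    have eW' : (U <*> <[g]>)%G = W by apply: val_inj.
    by rewrite eW' eqxx VW (subsetP sWP).
  move=> g; rewrite !inE => /andP[Pg ->]; rewrite joing_subl /=.
  by rewrite join_subG sUP cycle_subG.
rewrite big_distrr /=; apply: (sum_conj_dvd (P := P)).
- apply/subsetP=> g Pg; rewrite !inE /=; apply/subsetP=> W.
  rewrite !inE /= => /and3P[VW sUW sWP].
  rewrite (conjugate_trans VW (conjugateJ _ _)) -(normP (subsetP nPU g Pg)).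
  by rewrite conjSg sUW -(conjGid Pg) conjSg.
- move=> W g Pg; congr (_ * _)%N; rewrite /F -[RHS](cardJg _ g).
  congr #|pred_of_set _|; apply/setP=> h; rewrite mem_conjg !inE /= mem_conjg.
  congr (_ && _).
  rewrite -(inj_eq (@conjsg_inj _ g^-1)) conjsgK conjYg /= -cycleJ.
  by have /normP-> : g^-1 \in 'N(U) by rewrite groupV (subsetP nPU).
move=> W; rewrite inE => /and3P[VW sUW sWP].
have nUW : U <| W := normalS sUW sWP nUP.
rewrite /F card_joing_cycle //; case: ifP => [cW|]; last by rewrite !muln0.
have pW : p.-nat #|W : U| := pnat_dvd (indexSg sUW sWP) pP.
rewrite -(Lagrange (subsetIl P 'N(W))) mulnC dvdn_pmul2l; last exact: indexg_gt0.
have sWN : W \subset 'N_P(W) by rewrite subsetI sWP normG.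
rewrite -(Lagrange (subset_trans sUW sWN)) mulnCA dvdn_pmul2l ?cardG_gt0 //.
rewrite mulnC -(Lagrange_index sWN sUW).
have iW : #|'N_P(W) : W| %| #|'N(V) : V|`_p.
  have pNW : p.-nat #|'N_P(W) : W|.
    apply: pnat_dvd pP; apply: dvdn_trans (indexSg (subset_trans sUW sWN) (subsetIl _ _)).
    by rewrite -(Lagrange_index sWN sUW) dvdn_mulr.
  rewrite -(part_pnat_id pNW) -(conjugate_card_index VW).
  by rewrite partn_dvd ?indexg_gt0 // indexSg ?subsetIr.
have [a eWU] := p_natP pW; case: a eWU => [|a] eWU.
  by rewrite eWU expn0 muln1 (_ : totient 1 = 1%N) // mul1n; apply: dvdn_trans iW im.
rewrite eWU totient_pfactor //= expnS.
suff im2 : p * #|'N(V) : V|`_p %| m.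
  rewrite mulnA (mulnAC p.-1) dvdn_mul // dvdn_mull //.
  by apply: dvdn_trans im2; rewrite mulnC dvdn_pmul2l ?prime_gt0.
case: im' => // noW; case/conjugateP: (VW) => h defW.
have pWU : p.-group (W / U) by rewrite /pgroup card_quotient ?normal_norm.
have [||Q [_ nQW cQ]] := @normal_pgroup p _ a (W / U)%G (W / U)%G pWU.
- exact: normal_refl.
- by rewrite card_quotient ?normal_norm // eWU pfactorK // leqnSn.
have [E defQ sUE nEW] := inv_quotientN nUW nQW.
have iEW : #|W : E| = p.
  have sEW := normal_sub nEW; apply/eqP.
  rewrite -(eqn_pmul2r (indexg_gt0 E U)) (Lagrange_index sEW sUE) eWU.
  rewrite -card_quotient ?(subset_trans sEW) ?normal_norm // -defQ cQ.
  by rewrite expnS.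
have eW : V :^ h = W by rewrite defW.
have := noW (E :^ h^-1)%G; rewrite -(normalJ _ _ h) /= conjsgKV eW => /(_ nEW).
by rewrite -(indexJg _ _ h) /= conjsgKV eW iEW eqxx.
Qed.

End Indicators.

(** * Radicals of integers *)

Section Radical.

Local Open Scope nat_scope.
Implicit Types (p n : nat).

Definition radical n := \prod_(p <- primes n) p.
(** The totient of the radical. *)
Definition totient_radical n := \prod_(p <- primes n) p.-1.

Lemma radical_gt0 n : 0 < radical n.
Proof.
rewrite /radical big_seq; apply: prodn_cond_gt0 => p.
by rewrite mem_primes => /andP[/prime_gt0].
Qed.

Lemma totient_radical_gt0 n : 0 < totient_radical n.
Proof.
rewrite /totient_radical big_seq; apply: prodn_cond_gt0 => p.
by rewrite mem_primes => /andP[/prime_gt1]; case: p => [|[]].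
Qed.

Lemma leq_totient_radical n : totient_radical n <= radical n.
Proof. by apply: leq_prod => p _; apply: leq_pred. Qed.

Lemma totient_radicalE n : 0 < n -> totient n * radical n = n * totient_radical n.
Proof.
move=> n_gt0; have en : n = \prod_(p <- primes n) p ^ logn p n.
  by rewrite {1}(prod_prime_decomp n_gt0) prime_decompE big_map.
rewrite totientE // [X in _ = X * _]en /radical /totient_radical -!big_split /=.
rewrite big_seq [RHS]big_seq.
apply: eq_bigr => p pn; have : 0 < logn p n by rewrite logn_gt0.
by case: (logn p n) => // e _ /=; rewrite expnS mulnC mulnA mulnAC.
Qed.

Lemma partn_radical p n : prime p ->
  (radical n)`_p = if p \in primes n then p else 1.
Proof.
move=> p_pr; have := primes_uniq n.
have : all prime (primes n) by apply/allP=> q; rewrite mem_primes => /andP[].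
rewrite /radical; elim: (primes n) => [_ _|q s IHs /= /andP[q_pr s_pr]].
  by rewrite big_nil partn1.
case/andP=> qs uqs; have s_gt0 : 0 < \prod_(r <- s) r.
  rewrite big_seq; apply: prodn_cond_gt0 => r rs.
  by rewrite prime_gt0 // (allP s_pr).
rewrite big_cons partnM ?(prime_gt0 q_pr) //.
rewrite inE; have [epq|neq_pq] := eqVneq p q.
  by rewrite IHs // epq (negPf qs) muln1 part_pnat_id // pnat_id.
have -> : q`_p = 1 by rewrite part_p'nat // p'natE // dvdn_prime2.
by rewrite mul1n IHs.
Qed.

Lemma dvdn_radical_totient s r : {subset primes s <= primes r} ->
  totient_radical s <= totient_radical r.
Proof.
move=> sr; rewrite /totient_radical.
have r_pr p : p \in primes r -> 0 < p.-1.
  by rewrite mem_primes => /andP[/prime_gt1]; case: p => [|[]].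
rewrite [X in _ <= X](bigID (mem (primes s))) /=.
rewrite -[X in X <= _]muln1 leq_mul //; last first.
  by rewrite big_seq_cond; apply: prodn_cond_gt0 => p /andP[/r_pr].
rewrite -[X in _ <= X]big_filter leq_eqVlt; apply/orP; left; apply/eqP/perm_big.
apply: uniq_perm; rewrite ?filter_uniq ?primes_uniq // => p.
by rewrite mem_filter; apply/idP/andP => [ps|[]//]; split=> //; apply: sr.
Qed.

End Radical.

(** * Cyclic groups, p-groups and congruences modulo p *)

Section IntegralFunctions.

Local Open Scope group_scope.
Local Open Scope ring_scope.
Local Open Scope nat_scope.
Variable gT : finGroupType.
Implicit Types (C D E K L U V W P Q : {group gT}) (x y : {group gT} -> int).
Implicit Types (p m : nat).

Lemma scaled_indicatorE m V K :
  (m%:Z * indicator V K)%R = if conjugate V K then m%:Z else 0%R.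
Proof. by rewrite /indicator -PoszM; case: conjugate; rewrite ?muln1 ?muln0. Qed.

Lemma cyclic_index_subgroup C p : cyclic C -> p %| #|C| ->
  exists2 E : {group gT}, E \subset C & #|C : E| = p.
Proof.
case/cyclicP=> a -> pC; exists <[a ^+ p]>%G; first exact: cycleX.
have p_gt0 : (0 < p)%N by apply: dvdn_gt0 pC; apply: order_gt0.
apply/eqP; rewrite -(eqn_pmul2l (cardG_gt0 <[a ^+ p]>)) Lagrange ?cycleX //=.
by rewrite -!/#[_] orderXdiv // divnK.
Qed.

Lemma cyclic_sub_norm C E : cyclic C -> E \subset C -> 'N(C) \subset 'N(E).
Proof.
move=> cC sEC; apply/subsetP=> g /normP nC; apply/normP/eqP.
by rewrite (eq_subG_cyclic (K := E) (H := (E :^ g)%G) cC) ?cardJg //= -nC conjSg.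
Qed.

Lemma integral_indicator_self m V :
  integral (fun K => m%:Z * indicator V K)%R -> #|'N(V) : V| %| m.
Proof.
case=> _ /(_ V 'N(V)%G (normalG V)) xB.
have := congruence_top (normalG V) xB; rewrite scaled_indicatorE conjugate_refl.
rewrite dvdzE; apply=> g _ Vg; rewrite scaled_indicatorE.
case: ifP => // VW; have := joing_cycle_card Vg.
by rewrite (conjugate_card VW : #|V <*> <[g]>| = _) ltnn.
Qed.

(** In the congruence at [E] in its normaliser, [#|'N(E) : 'N(C)|] conjugates
    of [C] contain [E], and each is generated over [E] by [p.-1 * #|E|]
    elements. *)
Lemma integral_indicator_index p m C E : prime p -> cyclic C ->
    E \subset C -> #|C : E| = p ->
    integral (fun K => m%:Z * indicator C K)%R ->
  p * #|'N(C) : C| %| p.-1 * m.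
Proof.
move=> p_pr cC sEC iE [_ /(_ E 'N(E)%G (normalG E))].
have nEC := cyclic_sub_norm cC sEC.
rewrite congruence_indicator /=.
set A := [set g in _ | _].
have -> : #|A| = (#|'N(E) : 'N(C)| * (p.-1 * #|E|))%N.
  rewrite -sum1_card.
  rewrite (partition_big (fun g => (E <*> <[g]>)%G)
    (mem (orbit 'JG 'N(E) C))) /=; last first.
    move=> g; rewrite inE => /andP[Ng /conjugateP[h eW]].
    apply/orbitP; exists h; last by rewrite eW.
    have sEW : E \subset C :^ h.
      by rewrite -[C :^ h]/(gval (C :^ h)%G) -eW joing_subl.
    have cW : cyclic (C :^ h) by rewrite cyclicJ.
    apply/normP/eqP; rewrite (eq_subG_cyclic (K := E) (H := (E :^ h)%G) cW) //=.
      by rewrite cardJg.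
    by rewrite conjSg.
  rewrite (eq_bigr (fun=> (p.-1 * #|E|)%N)) => [|W /orbitP[h Nh <-]].
    rewrite sum_nat_const; congr (_ * _)%N.
    by rewrite card_orbit astab1JG (setIidPr nEC).
  rewrite sum1dep_card.
  have eE : E :^ h = E by apply/normP.
  have sEW : E \subset C :^ h by rewrite -eE conjSg.
  have cE : #|C| = (p * #|E|)%N by rewrite mulnC -iE Lagrange.
  have -> : (p.-1 * #|E|)%N = #|C :^ h :\: E|.
    rewrite cardsD (setIidPr sEW) cardJg cE -{2}(prednK (prime_gt0 p_pr)) mulSn.
    by rewrite addKn.
  have cW : cyclic (C :^ h) by rewrite cyclicJ.
  apply: eq_card => g; rewrite !inE; apply/andP/andP => [[_ /eqP eW]|[Eg Wg]].
    have {}eW : E <*> <[g]> = C :^ h by rewrite -[LHS]/(gval (E <*> <[g]>)%G) eW.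
    split; last by rewrite -eW (subsetP (joing_subr _ _)) ?cycle_id.
    apply/negP=> Eg; have := congr1 (fun A : {set gT} => #|A|) eW.
    rewrite /= -[E <*> _]/(gval (E <*> <[g]>)%G) joing_cycle_in // cardJg cE.
    by apply/eqP; rewrite ltn_eqF // ltn_Pmull ?prime_gt1.
  have Ng : g \in 'N(E).
    apply: (subsetP _ g Wg); apply: sub_abelian_norm => //.
    exact: cyclic_abelian.
  have sgW : E <*> <[g]> \subset C :^ h by rewrite join_subG sEW cycle_subG.
  have /eqP eW : E <*> <[g]> == C :^ h.
    rewrite eqEcard sgW cardJg cE.
    have iEg := Lagrange (joing_subl E <[g]>).
    have : #|E <*> <[g]> : E| %| p.
      rewrite -(dvdn_pmul2l (cardG_gt0 E)) iEg mulnC -cE -(cardJg C h).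
      exact: cardSg.
    rewrite -iEg mulnC; case/primeP: (p_pr) => _ pP /pP/orP[] /eqP e; last first.
      by rewrite e leqnn.
    by have := joing_cycle_card Eg; rewrite -iEg e muln1 ltnn.
  have {}eW : (E <*> <[g]>)%G = (C :^ h)%G by apply: val_inj.
  by move: Ng; rewrite inE => ->; rewrite eW eqxx conjugateJ.
rewrite -(Lagrange nEC) mulnC mulnCA dvdn_pmul2l ?indexg_gt0 //.
rewrite -card_norm_index -{1}(Lagrange sEC) iE mulnA [X in _ %| X]mulnA.
by rewrite mulnAC dvdn_pmul2r ?cardG_gt0 // mulnC (mulnC m).
Qed.

(** The values of an integral function on a [p]-group [D] and at the trivial group
    are linked as soon as the rest of the support has small order: subtracting
    the right multiple of the marks of [G / D] leaves a support of order
    dividing [#|D| / p]. *)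
Lemma pgroup_support_dvd p D x : prime p -> p.-group D -> p %| #|D| -> integral x ->
    (forall K, x K != 0 -> ~~ conjugate D K -> #|K| %| #|D| %/ p) ->
    (#|[set: gT]|%:Z %| ((#|D| %/ p)%:Z * x 1%G)%R)%Z ->
  ((p * #|'N(D) : D|)%:Z %| x D)%Z.
Proof.
move=> p_pr pD pdD xB xD x1; set d := (#|D| %/ p)%N in xD x1.
have dp : (d * p)%N = #|D| by rewrite divnK.
have d_gt0 : (0 < d)%N by rewrite -(ltn_pmul2r (prime_gt0 p_pr)) dp cardG_gt0.
have lt_dD : (d < #|D|)%N by rewrite -dp ltn_Pmulr ?prime_gt1.
have /dvdzP[c defc] : (#|'N(D) : D|%:Z %| x D)%Z.
  apply: congruence_top (normalG D) (proj2 xB _ _ (normalG D)) _ => g _ Dg.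
  have ltD := joing_cycle_card Dg; apply/eqP; apply: contraTT ltD => /xD xW.
  rewrite -leqNgt; have [DW|/xW] := boolP (conjugate D (D <*> <[g]>)%G).
    by rewrite (conjugate_card DW : #|D <*> <[g]>| = _).
  by move/(dvdn_leq d_gt0) => led; rewrite (leq_trans led) // ltnW.
pose y K := (x K - c * (mark D K)%:Z)%R.
have yB : integral y by apply: integralB => //; apply: integralZ; apply: integral_mark.
have yd K : y K != 0 -> #|K| %| d.
  rewrite /y; have [DK | nDK] := boolP (conjugate D K).
    rewrite (class_function_conj (proj1 xB) DK) (mark_conjugate _ DK) mark_self.
    by rewrite defc subrr eqxx.
  have [xK|xK _] := eqVneq (x K) 0; last exact: xD.
  have [->|] := posnP (mark D K); first by rewrite xK mulr0 subr0 eqxx.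
  move=> mDK _; have dK := mark_dvd mDK.
  have neK : #|K| != #|D| by apply: contra nDK => /eqP; apply: mark_gt0_card.
  have [b eD] := p_natP pD; have pK : p.-nat #|K| := pnat_dvd dK pD.
  have [a eK] := p_natP pK.
  case: b eD => [|b] eD; first by rewrite eD dvdn1 (gtn_eqF (prime_gt1 p_pr)) in pdD.
  rewrite /d eD expnS mulKn ?prime_gt0 // eK dvdn_Pexp2l ?prime_gt1 //.
  move: dK neK; rewrite eD eK dvdn_Pexp2l ?prime_gt1 // leq_eqVlt.
  by case/predU1P=> [->|]; rewrite ?eqxx.
have := integral_support_dvd yB yd; rewrite /y mulrBr rpredBl //.
have eN : #|[set: gT]| = d * mark D 1 * p by rewrite -(mark1 D) -dp mulnCA mulnA.
have mk_gt0 : 0 < d * mark D 1.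
  by have := cardG_gt0 [set: gT]%G; rewrite eN muln_gt0 => /andP[].
rewrite [(c * _)%R]mulrC mulrA -PoszM eN.
move=> H; have : ((d * mark D 1)%:Z * p%:Z %| ((d * mark D 1)%:Z * c)%R)%Z := H.
rewrite dvdz_mul2l ?eqz_nat -?lt0n // => pc.
by rewrite defc PoszM; apply: dvdz_mul.
Qed.

Lemma cyclic_Sylow_complement C p : cyclic C ->
  exists2 E : {group gT}, E <| C & #|E| = #|C|`_p^'.
Proof.
move=> cC; exists 'O_p^'(C)%G; first exact: pcore_normal.
exact: card_Hall (nilpotent_pcore_Hall _ (abelian_nil (cyclic_abelian cC))).
Qed.

(** For a cyclic group the sufficient condition of [integral_at_indicator] is also
    necessary, so the index on the right, which determines the denominator of
    the weight of [C], is an invariant of the ring. *)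
Lemma integral_indicator_cyclic m C : cyclic C ->
  integral (fun K => m%:Z * indicator C K)%R
    <-> #|'N(C) : C| * radical #|C| %| m.
Proof.
move=> cC; split=> [mB | mC].
  apply/dvdn_partP=> [|p]; first by rewrite muln_gt0 indexg_gt0 radical_gt0.
  rewrite mem_primes => /andP[p_pr _].
  rewrite partnM ?indexg_gt0 ?radical_gt0 // partn_radical // mem_primes p_pr.
  rewrite cardG_gt0 /=; case: ifP => [pC|_]; last first.
    rewrite muln1; apply: dvdn_trans (integral_indicator_self mB).
    exact: dvdn_part.
  have [E sEC iE] := cyclic_index_subgroup cC pC.
  have := integral_indicator_index p_pr cC sEC iE mB.
  move/(dvdn_trans (dvdn_mul (dvdnn p) (dvdn_part p _))); rewrite mulnC.
  have p'p1 : p^'.-nat p.-1.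
    by case: p p_pr {pC iE} => [|[|q]] // p_pr; rewrite p'natE // gtnNdvd.
  by rewrite Gauss_dvdr // (pnat_coprime _ p'p1) // pnatM part_pnat pnat_id.
apply: integralP => [K g|p p_pr]; first by rewrite indicator_class.
have iC : #|'N(C) : C|`_p %| m.
  apply: dvdn_trans (dvdn_part _ _) (dvdn_trans _ mC); exact: dvdn_mulr.
apply: integral_at_indicator => //.
have [pC | npC] := boolP (p %| #|C|); [left | right] => [|W nWC].
  apply: dvdn_trans mC; rewrite mulnC dvdn_mul ?dvdn_part //.
  have <- : (radical #|C|)`_p = p.
    by rewrite partn_radical // mem_primes p_pr cardG_gt0 pC.
  exact: dvdn_part.
by apply: contraNneq npC => <-; apply: dvdn_indexg.
Qed.

(** A group over [U] inside [P] has the same [p']-part as [U] when [P / U] is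
    a [p]-group, so truncation preserves the congruences at [p]; the factor
    takes care of the other primes. *)
Lemma integral_block p (k : nat) x : prime p -> integral x ->
  integral (fun K => (#|[set: gT]|`_p^')%N%:Z *
                  (if (#|K|`_p^')%N == k then x K else 0))%R.
Proof.
move=> p_pr [xJ xB]; apply: integralP => [K g|q q_pr]; first by rewrite xJ /= cardJg.
have [-> | neq_qp] := eqVneq q p; last first.
  by apply: integral_at_p'part_dvd neq_qp _ => // K; apply: dvdz_mulr.
move=> U P nUP pP; have sUP := normal_sub nUP.
have cK (K : {group gT}) : U \subset K -> K \subset P -> #|K|`_p^' = #|U|`_p^'.
  move=> sUK sKP; rewrite -(Lagrange sUK) partnM ?indexg_gt0 //.
  rewrite [X in (_ * X)%N]part_p'nat ?muln1 // pnatNK.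
  exact: pnat_dvd (indexSg sUK sKP) pP.
rewrite /congruence_at -mulr_sumr; apply: dvdz_mull.
rewrite (eq_bigr (fun g => if #|U|`_p^' == k then x (U <*> <[g]>)%G else 0%R)).
  by case: eqP => _; [apply: xB | rewrite big1 ?dvdz0].
by move=> g Pg; rewrite cK ?joing_subl // join_subG sUP cycle_subG.
Qed.

(** The prime ideals of residue characteristic [p] of the ring of integral functions
    at [U] and at [V] coincide. *)
Definition congruent p U V := forall x, integral x -> (p%:Z %| (x U - x V)%R)%Z.

Lemma congruent_sym p U V : congruent p U V -> congruent p V U.
Proof. by move=> UV x /UV; rewrite -opprB rpredN. Qed.

Lemma congruent_trans p U V W :
  congruent p U V -> congruent p V W -> congruent p U W.
Proof.
move=> UV VW x xB; rewrite -(subrK (x V) (x U)) -addrA.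
by apply: rpredD; [apply: UV | apply: VW].
Qed.

(** A Sylow [p]-subgroup of [P] acts on the points fixed by [U], and the points
    it fixes are those fixed by [P]. *)
Lemma congruent_normal p U P : prime p -> U <| P -> p.-nat #|P : U| ->
  congruent p U P.
Proof.
move=> p_pr nUP pP.
have [Q sylQ] := Sylow_exists p P.
have [sUP nPU] := andP nUP; have [sQP pQ] := (pHall_sub sylQ, pHall_pgroup sylQ).
have nUQ : Q \subset 'N(U) := subset_trans sQP nPU.
have eUQ : (U * Q)%g = P.
  rewrite -(norm_joinEr nUQ); apply/eqP; rewrite eqEsubset join_subG sUP sQP /=.
  rewrite -indexg_eq1; have : p.-nat #|P : U <*> Q|.
    exact: pnat_dvd (indexgS _ (joing_subl _ _)) pP.
  move=> pi; apply/eqP/(@pnat_1 p) => //.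
  apply: pnat_dvd (indexgS _ (joing_subr U Q)) _.
  by case/and3P: sylQ.
have mk V : (p%:Z %| ((mark V U)%:Z - (mark V P)%:Z)%R)%Z.
  have actQ : [acts Q, on 'Fix_(rcosets V [set: gT] | 'Rs)(U) | 'Rs].
    apply: actsI; last exact: acts_fix_norm.
    exact: subset_trans (subsetT _) (actsRs_rcosets _ _).
  have := pgroup_fix_mod pQ actQ.
  rewrite -setIA -afixM eUQ -/(mark V U) -/(mark V P) => e.
  by rewrite -eqz_mod_dvd; apply/eqP; rewrite !modz_nat e.
move=> x /integral_marks[c defx].
rewrite !defx -sumrB; apply: rpred_sum => V _.
by rewrite -mulrBr; apply/dvdz_mull/mk.
Qed.

(** If [K] has order prime to [p], the marks of [G / Q], where [Q / K] is a Sylow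
    subgroup of ['N(K) / K], are prime to [p] at [K], hence do not vanish
    at [W], which thus has a conjugate inside [Q]. *)
Lemma congruent_p'part_dvd p K W : prime p -> p^'.-nat #|K| -> congruent p K W ->
  #|W|`_p^' %| #|K|.
Proof.
move=> p_pr p'K KW; have [Q [nKQ sQN iQ]] := Sylow_over p (normalG K).
have pQ : p.-nat #|Q : K| by rewrite iQ part_pnat.
have hallK : p^'.-Hall(Q) K.
  by rewrite /pHall (normal_sub nKQ) /pgroup p'K pnatNK.
have mK : (mark Q K * #|Q|)%N = #|'N(K)|.
  rewrite mark_card; congr #|pred_of_set _|; apply/setP=> g; rewrite !inE.
  apply/idP/idP => [sKQ|nK]; last exact: subset_trans nK (normal_sub nKQ).
  by rewrite (sub_normal_Hall hallK nKQ sKQ) /pgroup cardJg.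
have mp : ~~ (p %| mark Q K).
  have -> : mark Q K = #|'N(K) : K|`_p^'.
    apply/eqP; rewrite -(eqn_pmul2r (cardG_gt0 Q)) mK -card_norm_index.
    rewrite -(Lagrange (normal_sub nKQ)) iQ mulnCA.
    by rewrite [X in _ == (_ * X)%N]mulnC partnC ?indexg_gt0 // mulnC.
  by rewrite -p'natE // part_pnat.
have /mark_gt0P[g sWQ] : 0 < mark Q W.
  rewrite lt0n; apply: contraNneq mp => e.
  by have := KW _ (integral_mark Q); rewrite e subr0 dvdzE.
rewrite -(cardJg W g) (card_Hall hallK); apply: partn_dvd => //.
exact: cardSg.
Qed.

Lemma congruent_cyclic_dvd p U W : prime p -> cyclic U -> congruent p U W ->
  #|W|`_p^' %| #|U|`_p^'.
Proof.
move=> p_pr cU UW; have [E nEU cE] := cyclic_Sylow_complement p cU.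
rewrite -cE; apply: congruent_p'part_dvd => //; first by rewrite cE part_pnat.
apply: congruent_trans UW; apply: congruent_normal => //.
rewrite -divgS ?normal_sub // cE -{1}(partnC p (cardG_gt0 U)) mulnK //.
exact: part_pnat.
Qed.

Lemma congruent_pgroup p U W : prime p -> p.-group U -> congruent p U W ->
  p.-group W.
Proof.
move=> p_pr pU UW; have : congruent p 1%G W.
  apply: congruent_trans UW; apply: congruent_normal => //.
    exact: normal1.
  by rewrite indexg1.
move/(congruent_p'part_dvd p_pr); rewrite cards1 dvdn1 => /(_ isT)/eqP e.
by rewrite /pgroup -(partnC p (cardG_gt0 W)) e muln1 part_pnat.
Qed.

(** Already the multiples of indicators separate classes. *)
Lemma congruent_conj_eq U V :
  (forall x, integral x -> x U = x V) -> conjugate U V.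
Proof.
move/(_ _ (integral_card_indicator U)); rewrite !scaled_indicatorE conjugate_refl.
case: conjugate => // /eqP; rewrite eqz_nat.
by rewrite -(negPf (lt0n_neq0 (cardG_gt0 [set: gT]%G))) => ->.
Qed.

End IntegralFunctions.

(** * Bijections of classes preserving the integrality conditions *)

Section IntegralIso.

Local Open Scope group_scope.
Local Open Scope ring_scope.
Local Open Scope nat_scope.

(** What an isomorphism of Burnside rings amounts to on marks: mutually inverse
    bijections of classes, given on subgroups, that transport integral
    functions. *)
Definition integral_iso (gT hT : finGroupType)
    (s : {group gT} -> {group hT}) (t : {group hT} -> {group gT}) :=
  [/\ forall x, integral x -> integral (x \o s), forall x, integral x -> integral (x \o t),
      forall K, conjugate K (t (s K)) & forall L, conjugate L (s (t L))].

Lemma integral_iso_sym (gT hT : finGroupType)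
    (s : {group gT} -> {group hT}) (t : {group hT} -> {group gT}) :
  integral_iso s t -> integral_iso t s.
Proof. by case. Qed.

Section Basics.

Variables (gT hT : finGroupType).
Variables (s : {group gT} -> {group hT}) (t : {group hT} -> {group gT}).
Hypothesis st : integral_iso s t.
Implicit Types (K U : {group gT}) (L V : {group hT}) (p m : nat).

Lemma integral_iso_conj K U : conjugate K U -> conjugate (s K) (s U).
Proof.
case: st => sB _ _ _ KU; apply: congruent_conj_eq => x /sB[xJ _].
exact/esym/(class_function_conj xJ KU).
Qed.

Lemma integral_iso_congruent p K U : congruent p K U -> congruent p (s K) (s U).
Proof. by case: st => sB _ _ _ KU x /sB/KU. Qed.

End Basics.

Section Adjunction.

Variables (gT hT : finGroupType).
Variables (s : {group gT} -> {group hT}) (t : {group hT} -> {group gT}).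
Hypothesis st : integral_iso s t.
Implicit Types (K U : {group gT}) (L V : {group hT}) (p m : nat).

Lemma integral_iso_conjE K U : conjugate (s K) (s U) = conjugate K U.
Proof.
have [_ _ tsK _] := st; apply/idP/idP => [sKU|]; last exact: (integral_iso_conj st).
have := integral_iso_conj (integral_iso_sym st) sKU.
move/(conjugate_trans (tsK K))/conjugate_trans; apply.
by rewrite conjugate_sym tsK.
Qed.

Lemma integral_iso_conj_adj K L : conjugate (s K) L = conjugate K (t L).
Proof.
have [_ _ _ stL] := st; rewrite -integral_iso_conjE.
apply/idP/idP => /conjugate_trans; apply; first exact: stL.
by rewrite conjugate_sym stL.
Qed.

Lemma integral_iso_indicatorE m K :
  integral (fun L => m%:Z * indicator (s K) L)%R <->
  integral (fun U => m%:Z * indicator K U)%R.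
Proof.
have [sB tB _ _] := st; split=> [/sB|/tB]; congr integral; apply/funext=> U /=.
  by rewrite !scaled_indicatorE integral_iso_conjE.
by rewrite !scaled_indicatorE integral_iso_conj_adj.
Qed.

(** [#|H|] clears every indicator, whereas the indicator of the trivial group
    of [G] needs [#|G|]. *)
Lemma integral_iso_dvd_card : #|[set: gT]| %| #|[set: hT]|.
Proof.
have NB := integral_card_indicator (s 1%G).
have := integral_indicator_self ((integral_iso_indicatorE _ _).1 NB).
by rewrite norm1 indexg1.
Qed.

End Adjunction.

Section Comparison.

Variables (gT hT : finGroupType).
Variables (s : {group gT} -> {group hT}) (t : {group hT} -> {group gT}).
Hypothesis st : integral_iso s t.
Implicit Types (K U : {group gT}) (L V : {group hT}) (p m : nat).

Lemma integral_iso_card : #|[set: gT]| = #|[set: hT]|.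
Proof.
apply/eqP; rewrite eqn_dvd (integral_iso_dvd_card st).
exact: integral_iso_dvd_card (integral_iso_sym st).
Qed.

Lemma integral_iso_index_radical U : cyclic U -> cyclic (s U) ->
  #|'N(U) : U| * radical #|U| = #|'N(s U) : s U| * radical #|s U|.
Proof.
move=> cU csU; apply/eqP; rewrite eqn_dvd; apply/andP; split.
  apply/(integral_indicator_cyclic _ cU)/(integral_iso_indicatorE st).
  exact/integral_indicator_cyclic.
apply/(integral_indicator_cyclic _ csU)/(integral_iso_indicatorE st).
exact/integral_indicator_cyclic.
Qed.

End Comparison.

End IntegralIso.

(** * Numbers of generators *)

Section Weights.

Local Open Scope group_scope.
Local Open Scope ring_scope.
Local Open Scope nat_scope.
Variable gT : finGroupType.
Implicit Types (K L U : {group gT}) (x : {group gT} -> int).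

Definition weight U := #|[set g | conjugate U <[g]>%G]|.

Lemma weight_cyclic U : (0 < weight U) = cyclic U.
Proof.
rewrite card_gt0; apply/set0Pn/cyclicP => [[g]|[g eU]].
  rewrite inE conjugate_sym => /conjugateP[h eU].
  by exists (g ^ h)%g; rewrite cycleJ -[RHS]/(gval (<[g]> :^ h)%G) -eU.
by exists g; rewrite inE (_ : <[g]>%G = U) ?conjugate_refl //; apply: val_inj.
Qed.

Lemma weight_card U : cyclic U ->
  weight U * #|'N(U)| = totient #|U| * #|[set: gT]|.
Proof.
case/cyclicP=> a eU; rewrite -(Lagrange (subsetT 'N(U))) mulnCA.
rewrite mulnC; congr (_ * _); rewrite /weight -sum1_card.
rewrite (partition_big (fun g => <[g]>%G) (mem (orbit 'JG [set: gT] U))) /=.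
  rewrite (eq_bigr (fun=> totient #|U|)) => [|L /orbitP[h _ <-]].
    rewrite sum_nat_const mulnC card_orbit astab1JG.
    by rewrite setTI.
  rewrite sum1dep_card eU totient_gen -[RHS](card_imset _ (@conjg_inj _ h)).
  apply: eq_card => g; rewrite !inE. apply/andP/imsetP => [[_ /eqP eg]|[k]].
    exists (g ^ h^-1)%g; last by rewrite conjgKV.
    have {}eg : <[g]> = U :^ h := congr1 val eg.
    by rewrite inE /generator cycleJ eg conjsgK eU.
  rewrite inE /generator => /eqP ek ->.
  have eL : <[k ^ h]>%G = (U :^ h)%G.
    by apply: val_inj; rewrite /= cycleJ -ek -eU.
  by rewrite eL conjugateJ eqxx.
move=> g; rewrite inE => /conjugateP[h eg]; apply/orbitP; exists h.
  exact: in_setT.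
exact: esym.
Qed.

Lemma weight_radical U : cyclic U ->
  weight U * (#|'N(U) : U| * radical #|U|) = totient_radical #|U| * #|[set: gT]|.
Proof.
move=> cU; apply/eqP; rewrite -(eqn_pmul2r (cardG_gt0 U)); apply/eqP.
transitivity (weight U * (#|'N(U) : U| * #|U|) * radical #|U|).
  by rewrite -!mulnA (mulnC (radical _)).
rewrite card_norm_index weight_card // mulnAC totient_radicalE ?cardG_gt0 //.
by rewrite [#|U| * _]mulnC mulnAC.
Qed.

(** For the marks of a [G]-set the quotient is the number of orbits. *)
Lemma integral_sum_cycle x : integral x ->
  (#|[set: gT]|%:Z %| (\sum_(g : gT) x <[g]>%G)%R)%Z.
Proof.
case=> _ /(_ 1%G [set: gT]%G (normal1 _)); rewrite /congruence_at.
congr (_ %| _)%Z; apply: eq_big => [g|g _]; first by rewrite inE.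
by congr x; apply: val_inj; rewrite /= joing1G.
Qed.

Lemma sum_weight (T : finType) (f : T -> {group gT}) x : class_function x ->
  (\sum_(i : T) x (f i) =
   \sum_(K | is_rep K) x K * #|[set i | conjugate K (f i)]|%:Z)%R.
Proof.
move=> xJ; rewrite (partition_big (fun i => class_rep (f i)) (@is_rep gT)) /=.
  apply: eq_bigr => K rK; rewrite (eq_bigr (fun=> x K)) => [|i /eqP <-].
    rewrite sumr_const -mulr_natr natz; congr (_ * Posz _)%R.
    apply: eq_card => i; rewrite [RHS]inE -[LHS]/(class_rep (f i) == K).
    by rewrite -[X in _ == X](eqP rK) class_rep_eq conjugate_sym.
  exact/esym/class_function_conj/class_repP.
by move=> i _; apply: is_rep_rep.
Qed.

End Weights.

(** * Bijections fixing the trivial group: weights of cyclic groups *)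

Section NormalisedCount.

Local Open Scope group_scope.
Local Open Scope ring_scope.
Local Open Scope nat_scope.

Lemma conjugate_trivg (gT : finGroupType) (U : {group gT}) :
  conjugate 1%G U -> U = 1%G.
Proof. exact: conjugate_normal (normal1 _). Qed.

Lemma normalised_sym (gT hT : finGroupType)
    (s : {group gT} -> {group hT}) (t : {group hT} -> {group gT}) :
  integral_iso s t -> s 1%G = 1%G -> t 1%G = 1%G.
Proof. by move=> [_ _ /(_ 1%G) ts1 _] s1; apply: conjugate_trivg; rewrite s1 in ts1. Qed.

Lemma ltn_totient_radical n : 1 < n -> totient_radical n < radical n.
Proof.
move=> n_gt1; rewrite /totient_radical /radical.
have p_pr : all prime (primes n) by apply/allP=> p; rewrite mem_primes => /andP[].
have : primes n != [::] by rewrite primes_eq0 -leqNgt.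
case: (primes n) p_pr => // p s /= /andP[p_pr s_pr] _; rewrite !big_cons.
have s_le : \prod_(j <- s) j.-1 <= \prod_(j <- s) j.
  by apply: leq_prod => q _; apply: leq_pred.
have s_gt0 : 0 < \prod_(j <- s) j.
  rewrite big_seq; apply: prodn_cond_gt0 => q qs; exact/prime_gt0/(allP s_pr).
apply: leq_ltn_trans (leq_mul (leqnn _) s_le) _.
by rewrite ltn_pmul2r // ltn_predL prime_gt0.
Qed.

Lemma totient_ndvd n : 1 < n -> ~~ (n %| totient n).
Proof.
move=> n_gt1; have n_gt0 := ltnW n_gt1; apply/negP=> /dvdnP[k ek].
have := totient_radicalE n_gt0; rewrite ek mulnAC mulnC => /eqP.
rewrite eqn_pmul2l // => /eqP e; have := ltn_totient_radical n_gt1.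
rewrite -e; case: k e ek => [e|k _ _]; last by rewrite ltnNge leq_pmull.
by move/eqP; rewrite mul0n (gtn_eqF _) // totient_gt0.
Qed.

Lemma weight1 (gT : finGroupType) : @weight gT 1%G = 1.
Proof.
apply/eqP; have := weight_card (cyclic1 gT); rewrite norm1 cards1 => /eqP.
by rewrite eqn_pmul2r // cardG_gt0.
Qed.

(** The difference of the two orbit-counting functionals, evaluated on the marks
    of [G / U], only involves [U] once the two agree on proper subgroups. *)
Lemma weight_congruence (gT hT : finGroupType)
    (s : {group gT} -> {group hT}) (t : {group hT} -> {group gT})
    (U : {group gT}) : integral_iso s t ->
    (forall K : {group gT}, #|K| < #|U| -> 0 < mark U K ->
       weight K = weight (s K)) ->
  (#|[set: gT]|%:Z %|
     (#|'N(U) : U|%:Z * ((weight U)%:Z - (weight (s U))%:Z))%R)%Z.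
Proof.
move=> st IH; have mB := integral_mark U.
have [_ /(_ _ mB) mtB _ _] := st.
have := integral_sum_cycle mtB; rewrite -(integral_iso_card st).
move/(rpredB (integral_sum_cycle mB)).
rewrite (sum_weight (fun g : gT => <[g]>%G) (proj1 mB)).
rewrite (sum_weight (fun h : hT => t <[h]>%G) (proj1 mB)) -sumrB.
rewrite (bigD1 (class_rep U)) ?is_rep_rep //= big1 ?addr0 => [|K]; last first.
  case/andP=> rK neK; rewrite -mulrBr.
  have eK : #|[set i | conjugate K (t <[i]>%G)]| = weight (s K).
    by apply: eq_card => h; rewrite !inE (integral_iso_conj_adj st).
  have [->|mK] := posnP (mark U K); first by rewrite mul0r.
  rewrite eK -[#|_|]/(weight K) IH ?subrr ?mulr0 // ltn_neqAle.
  rewrite (dvdn_leq _ (mark_dvd mK)) // andbT; apply: contraNneq neK => cK.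
  by rewrite -(eqP rK) class_rep_eq conjugate_sym mark_gt0_card.
have rU := class_repP U; rewrite -mulrBr (mark_conjugate _ rU) mark_self.
congr (_ %| (_ * (Posz _ - Posz _))%R)%Z; apply: eq_card => g.
  by rewrite !inE -(conjugate_eql rU).
by rewrite !inE -(integral_iso_conj_adj st) -(conjugate_eql (integral_iso_conj st rU)).
Qed.

Section Counting.

Variables (gT hT : finGroupType).
Variables (s : {group gT} -> {group hT}) (t : {group hT} -> {group gT}).
Hypotheses (st : integral_iso s t) (s1 : s 1%G = 1%G).
Implicit Types (K U D : {group gT}) (L : {group hT}) (p : nat).

Let N_gt0 : 0 < #|[set: gT]|. Proof. exact: cardG_gt0 [set: gT]%G. Qed.

Lemma cyclic_proper_complement U p : cyclic U -> prime p -> p %| #|U| ->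
  exists D : {group gT}, [/\ D \subset U, #|D| = #|U|`_p^', #|D| < #|U|,
    cyclic D & congruent p D U].
Proof.
move=> cU p_pr pU; have [D nDU cD] := cyclic_Sylow_complement p cU.
have sDU := normal_sub nDU; exists D; split=> //.
- rewrite cD -[X in _ < X](partnC p (cardG_gt0 U)) ltn_Pmull ?part_gt0 //.
  by rewrite p_part_gt1 mem_primes p_pr cardG_gt0.
- exact: cyclicS cU.
apply: congruent_normal => //.
rewrite -divgS // cD -{1}(partnC p (cardG_gt0 U)) mulnK ?part_gt0 //.
exact: part_pnat.
Qed.

(** If [s U] were not cyclic, [weight_congruence] would make [#|U|] divide its
    totient. If it is, both weights have the denominator of
    [integral_indicator_cyclic], and their numerators, products of factors
    [p.-1], differ by a multiple of [radical #|U|] that is too small not to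
    vanish. *)
Lemma cyclic_weight U : cyclic U ->
  [/\ cyclic (s U), {subset primes #|s U| <= primes #|U|}
    & weight U = weight (s U)].
Proof.
have [n] := ubnP #|U|; elim: n U => // n IHn U leUn cU.
have [U1|U_gt1] := leqP #|U| 1.
  have -> : U = 1%G by apply/val_inj/card1_trivg/eqP; rewrite eqn_leq U1 cardG_gt0.
  by rewrite s1 !weight1 !cards1; split=> //; apply: cyclic1.
have IH K : #|K| < #|U| -> 0 < mark U K ->
  [/\ cyclic (s K), {subset primes #|s K| <= primes #|K|}
    & weight K = weight (s K)].
- move=> ltKU /mark_gt0P[g sKU]; apply: IHn; first exact: leq_trans ltKU _.
  by rewrite -(cyclicJ K g); apply: cyclicS cU.
have [|k ek] := dvdzP (weight_congruence st (U := U) _).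
  by move=> K ltKU mK; have [] := IH K ltKU mK.
have csU : cyclic (s U).
  rewrite -weight_cyclic lt0n; apply: contraNneq (totient_ndvd U_gt1) => ws.
  move: ek; rewrite ws subr0 -PoszM => ek.
  have /dvdnP[j ej] : #|[set: gT]| %| #|'N(U) : U| * weight U.
    by have := dvdz_mull k (dvdzz #|[set: gT]|%:Z); rewrite -ek.
  apply/dvdnP; exists j; apply/eqP; rewrite -(eqn_pmul2r N_gt0) -weight_card //.
  by rewrite mulnAC -ej -card_norm_index mulnC mulnAC.
have prU : {subset primes #|s U| <= primes #|U|}.
  move=> p; rewrite !mem_primes !cardG_gt0 /= => /andP[p_pr psU].
  rewrite p_pr /=; apply: contraLR psU => npU.
  set q := pdiv #|U|; have q_pr : prime q by apply: pdiv_prime.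
  have [D [sDU cD ltDU cyD DU]] := cyclic_proper_complement cU q_pr (pdiv_dvd _).
  have [|csD prD _] := IH D ltDU; first by apply/mark_gt0P; exists 1%g; rewrite conjsg1.
  have := congruent_cyclic_dvd q_pr csD (integral_iso_congruent st DU).
  move=> dDU; apply: contra (npU) => psU.
  have neq_pq : p != q by apply: contraNneq npU => ->; apply: pdiv_dvd.
  have : p \in primes #|s D|.
    rewrite mem_primes p_pr cardG_gt0 /=; apply: dvdn_trans (dvdn_part q^' _).
    apply: dvdn_trans dDU; rewrite -[X in X %| _](part_pnat_id (pi := q^')).
      exact: partn_dvd.
    by rewrite p'natE // dvdn_prime2 // eq_sym.
  move/prD; rewrite mem_primes => /and3P[_ _ pD].
  exact: dvdn_trans pD (cardSg sDU).
split=> //.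
have [[n_eq wU] wsU] := (integral_iso_index_radical st cU csU, weight_radical cU,
  weight_radical csU).
rewrite -n_eq -(integral_iso_card st) in wsU.
have le_tot := dvdn_radical_totient prU.
have [k' ek'] : exists k' : nat,
    totient_radical #|U| - totient_radical #|s U| = k' * radical #|U|.
  exists `|k|; suff e : (totient_radical #|U| - totient_radical #|s U|)%:Z
      = (k * (radical #|U|)%:Z)%R by rewrite -[LHS]/(absz (Posz _)) e abszM.
  have N_neq0 : #|[set: gT]|%:Z != 0%R by rewrite eqz_nat -lt0n.
  apply: (mulIf N_neq0); rewrite mulrAC -ek -subzn // mulrBl -!PoszM -wU -wsU.
  by rewrite !PoszM -mulrBl mulrC mulrAC.
have e0 : totient_radical #|U| = totient_radical #|s U|.
  apply/eqP; rewrite eqn_leq le_tot andbT -subn_eq0 ek'.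
  case: k' ek' => // k' /eqP; rewrite eqn_leq => /andP[_].
  rewrite leqNgt; case/negP; apply: leq_trans (leq_pmull _ (ltn0Sn k')).
  apply: leq_trans (leq_totient_radical _); rewrite -{2}[totient_radical #|U|]subn0.
  by rewrite ltn_sub2l ?totient_radical_gt0.
apply/eqP; rewrite e0 -wsU in wU; move/eqP: wU; rewrite eqn_pmul2r //.
by rewrite muln_gt0 indexg_gt0 radical_gt0.
Qed.

End Counting.

End NormalisedCount.

(** * Bijections fixing the trivial group: orders of cyclic groups *)

Section OrderType.

Local Open Scope group_scope.
Local Open Scope ring_scope.
Local Open Scope nat_scope.

(** Going down to the [p']-part of [U], whose order is known by induction. *)
Lemma order_p'part (gT hT : finGroupType)
    (s : {group gT} -> {group hT}) (t : {group hT} -> {group gT}) :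
    integral_iso s t -> s 1%G = 1%G -> forall (U : {group gT}) (p : nat),
    cyclic U -> prime p -> p %| #|U| ->
    (forall K : {group gT}, cyclic K -> #|K| < #|U| -> #|s K| = #|K|) ->
  #|s U|`_p^' = #|U|`_p^'.
Proof.
move=> st s1 U p cU p_pr pU IH.
have [D [sDU cD ltDU cyD DU]] := cyclic_proper_complement cU p_pr pU.
have [[csU _ _] [csD _ _]] := (cyclic_weight st s1 cU, cyclic_weight st s1 cyD).
have sDsU := integral_iso_congruent st DU.
have e := congruent_cyclic_dvd p_pr csD sDsU.
have e' := congruent_cyclic_dvd p_pr csU (congruent_sym sDsU).
have p'D : p^'.-nat #|D| by rewrite cD part_pnat.
apply/eqP; rewrite eqn_dvd; move: e e'; rewrite (IH D) // (part_pnat_id p'D).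
by rewrite cD => -> ->.
Qed.

(** If two primes divide [#|U|], the previous lemma determines [#|s U|].
    If [U] is a [p]-group and [s U] is larger, then the marks of [G / U],
    transported, are supported on [s U] and on much smaller groups, and
    [pgroup_support_dvd] makes their value at [s U] too divisible. *)
Lemma order_leq (gT hT : finGroupType)
    (s : {group gT} -> {group hT}) (t : {group hT} -> {group gT}) :
    integral_iso s t -> s 1%G = 1%G -> forall U : {group gT}, cyclic U ->
    (forall K : {group gT}, cyclic K -> #|K| < #|U| -> #|s K| = #|K|) ->
  #|s U| <= #|U|.
Proof.
move=> st s1 U cU IH; have [U_le1|U_gt1] := leqP #|U| 1.
  have -> : U = 1%G by apply/val_inj/card1_trivg/eqP; rewrite eqn_leq U_le1 cardG_gt0.
  by rewrite s1 !cards1.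
have p'part p p_pr pU := order_p'part (p := p) st s1 cU p_pr pU IH.
set p := pdiv #|U|; have p_pr : prime p by apply: pdiv_prime.
have pU : p %| #|U| := pdiv_dvd _.
have [p'U1 | p'U_gt1] := leqP (#|U|`_p^') 1; last first.
  set q := pdiv (#|U|`_p^'); have q_pr : prime q by apply: pdiv_prime.
  have qU : q %| #|U| by apply: dvdn_trans (pdiv_dvd _) (dvdn_part _ _).
  have neq_qp : q != p.
    have := part_pnat p^' #|U|; move/(pnat_dvd (pdiv_dvd _)).
    by rewrite -/q p'natE // dvdn_prime2 // eq_sym.
  have pq' (n : nat) : 0 < n -> n`_p = (n`_q^')`_p.
    move=> n_gt0; rewrite -partnI; apply: eq_in_partn => r _.
    by rewrite !inE andbC; have [->|//] := eqVneq r p; rewrite eq_sym neq_qp.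
  have e_p : #|s U|`_p = #|U|`_p.
    by rewrite (pq' _ (cardG_gt0 U)) (pq' _ (cardG_gt0 (s U))) (p'part q q_pr qU).
  rewrite -(partnC p (cardG_gt0 U)) -(partnC p (cardG_gt0 (s U))).
  by rewrite e_p (p'part p p_pr pU).
have p'U : #|U|`_p^' = 1 by apply/eqP; rewrite eqn_leq p'U1 part_gt0.
have pgU : p.-group U.
  by rewrite /pgroup -(partnC p (cardG_gt0 U)) p'U muln1 part_pnat.
have pgsU : p.-group (s U).
  by rewrite /pgroup -(partnC p (cardG_gt0 (s U))) p'part // p'U muln1 part_pnat.
rewrite leqNgt; apply/negP=> ltU.
have [[|a] eU] := p_natP pgU; first by rewrite eU in U_gt1.
have [[|b] esU] := p_natP pgsU; first by rewrite eU esU ltnNge expn_gt0 prime_gt0 in ltU.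
have leab : a < b by move: ltU; rewrite eU esU ltn_exp2l ?prime_gt1.
have dU : #|s U| %/ p = p ^ b by rewrite esU expnS mulKn ?prime_gt0.
have [csU _ _] := cyclic_weight st s1 cU.
have [_ tB _ _] := st; have xB := tB _ (integral_mark U).
have := pgroup_support_dvd p_pr pgsU _ xB.
rewrite {1}esU expnS dvdn_mulr // => /(_ isT); rewrite dU => H.
have {H} : ((p * #|'N(s U) : s U|)%:Z %| (mark U (t (s U)))%:Z)%Z.
  apply: H => [K /= mK|].
    rewrite (integral_iso_conj_adj st) => nUK.
    have {mK} mK : 0 < mark U (t K) by rewrite lt0n.
    have ctK : cyclic (t K).
      by case/mark_gt0P: mK => g sK; rewrite -(cyclicJ _ g); apply: cyclicS cU.
    have ltK : #|t K| < #|U|.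
      rewrite ltn_neqAle (dvdn_leq _ (mark_dvd mK)) // andbT.
      by apply: contra nUK => /eqP; apply: mark_gt0_card.
    have [_ _ _ /(_ K) stK] := st.
    rewrite -(conjugate_card stK) IH //; apply: dvdn_trans (mark_dvd mK) _.
    by rewrite eU dvdn_exp2l.
  rewrite /= (normalised_sym st s1) -(integral_iso_card st) -(mark1 U) -PoszM mulnC.
  by rewrite dvdzE /= eU dvdn_mul // dvdn_exp2l.
have [_ _ /(_ U) UtsU _] := st; rewrite (mark_conjugate _ UtsU) mark_self.
have := integral_iso_index_radical st cU csU.
have rad e : radical (p ^ e.+1) = p.
  by rewrite /radical primesX // primes_prime // big_seq1.
rewrite eU esU !rad => /eqP; rewrite eqn_pmul2r ?prime_gt0 // => /eqP ->.
rewrite dvdzE /= => /(dvdn_leq (indexg_gt0 _ _)).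
by rewrite leqNgt ltn_Pmull ?prime_gt1 ?indexg_gt0.
Qed.

(** A smaller [s U] is excluded by the same bound for [t]. *)
Lemma cyclic_order (gT hT : finGroupType)
    (s : {group gT} -> {group hT}) (t : {group hT} -> {group gT}) :
    integral_iso s t -> s 1%G = 1%G -> forall U : {group gT}, cyclic U ->
  #|s U| = #|U|.
Proof.
move=> st s1; have ts := integral_iso_sym st; have t1 := normalised_sym st s1.
suff both n : (forall U : {group gT}, cyclic U -> #|U| < n -> #|s U| = #|U|) /\
    (forall L : {group hT}, cyclic L -> #|L| < n -> #|t L| = #|L|).
  by move=> U cU; apply: (both #|U|.+1).1.
(* Stated for any pair of groups, since it is applied to [s] and to [t]. *)
have step (gT' hT' : finGroupType)
    (s' : {group gT'} -> {group hT'}) (t' : {group hT'} -> {group gT'}) m :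
    integral_iso s' t' -> s' 1%G = 1%G ->
    (forall U : {group gT'}, cyclic U -> #|U| < m -> #|s' U| = #|U|) ->
    (forall L : {group hT'}, cyclic L -> #|L| < m -> #|t' L| = #|L|) ->
    forall U : {group gT'}, cyclic U -> #|U| < m.+1 -> #|s' U| = #|U|.
  move=> st' s1' IHs IHt U cU; rewrite ltnS leq_eqVlt => /predU1P[eU|]; last first.
    exact: IHs.
  apply/eqP; rewrite eqn_leq (order_leq st' s1') //=; last by rewrite eU.
  rewrite leqNgt; apply/negP=> lt_sU; have [csU _ _] := cyclic_weight st' s1' cU.
  have [_ _ /(_ U) /conjugate_card e _] := st'.
  by move: (lt_sU); rewrite -e IHt ?ltnn // -eU.
elim: n => [//|n [IHs IHt]]; split; first exact: (step _ _ s t).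
exact: (step _ _ t s).
Qed.

Lemma normalised_card_Ldiv (gT hT : finGroupType)
    (s : {group gT} -> {group hT}) (t : {group hT} -> {group gT}) (d : nat) :
    integral_iso s t -> s 1%G = 1%G ->
  #|('Ldiv_d() : {set gT})%g| = #|('Ldiv_d() : {set hT})%g|.
Proof.
move=> st s1; have ts := integral_iso_sym st; have t1 := normalised_sym st s1.
pose x (K : {group gT}) : int := (#|K| %| d : nat).
have xJ : class_function x by move=> K g; rewrite /x /= cardJg.
have cardE (fT : finGroupType) (f : fT -> {group gT}) :
    (forall h, #|f h| = #[h]%g) ->
    (#|('Ldiv_d() : {set fT})%g|%:Z = \sum_(h : fT) x (f h))%R.
  move=> fE; rewrite -(big_morph _ PoszD (erefl 0%:Z)); congr Posz.
  rewrite -sum1_card big_mkcond /=; apply: eq_bigr => h _.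
  by rewrite fE order_dvdn !inE; case: eqP.
apply/eqP; rewrite -eqz_nat (cardE _ (fun g => <[g]>%G)) //.
rewrite (cardE _ (fun h => t <[h]>%G)) => [|h]; last first.
  by rewrite (cyclic_order ts t1) ?cycle_cyclic.
rewrite !sum_weight //; apply/eqP/eq_bigr => K _; congr (_ * Posz _)%R.
rewrite -/(weight K); have [cK | ncK] := boolP (cyclic K).
  have [_ _ ->] := cyclic_weight st s1 cK.
  by apply: eq_card => h; rewrite !inE (integral_iso_conj_adj st).
transitivity 0; first by apply/eqP; rewrite -leqn0 leqNgt weight_cyclic.
apply/esym/eqP; rewrite cards_eq0; apply/eqP/setP=> h; rewrite !inE.
apply: contraNF ncK; rewrite conjugate_sym => /conjugate_cyclic->.
by have [] := cyclic_weight ts t1 (cycle_cyclic h).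
Qed.

End OrderType.

(** * Decomposition of finite G-sets *)

Section GSets.

Local Open Scope group_scope.
Local Open Scope nat_scope.
Variable gT : finGroupType.
Implicit Types (K L U V : {group gT}).

Lemma transitive_iso (T T' : finType) (to : {action gT &-> T})
    (uo : {action gT &-> T'}) x x' :
    (forall y, exists g, to x g = y) -> (forall y, exists g, uo x' g = y) ->
    (forall g, (to x g == x) = (uo x' g == x')) ->
  action_iso to uo.
Proof.
move=> transT transT' stab.
have pickT y : {g | to x g == y}.
  by apply: sigW; have [g <-] := transT y; exists g.
have pickT' y : {g | uo x' g == y}.
  by apply: sigW; have [g <-] := transT' y; exists g.
have stabE g h : (to x g == to x h) = (uo x' g == uo x' h).
  rewrite -(inj_eq (@act_inj _ _ _ to h^-1)) -(inj_eq (@act_inj _ _ _ uo h^-1)).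
  by rewrite !actK -!actM stab.
have pickE y : to x (sval (pickT y)) = y by apply/eqP/(svalP (pickT y)).
have pickE' y : uo x' (sval (pickT' y)) = y by apply/eqP/(svalP (pickT' y)).
pose f y := uo x' (sval (pickT y)); pose f' y := to x (sval (pickT' y)).
apply: (@action_isoI _ _ _ _ _ f f') => [y | y | y g].
- by rewrite /f' -[RHS]pickE; apply/eqP; rewrite stabE pickE'.
- by rewrite /f -[RHS]pickE'; apply/eqP; rewrite -stabE pickE.
- by rewrite /f -actM; apply/eqP; rewrite -stabE actM !pickE.
Qed.

Section SubAction.

Variables (T : finType) (to : {action gT &-> T}) (P : pred T).
Hypothesis toP : forall x g, P (to x g) = P x.

Fact sub_fun_subproof (u : {x | P x}) g : P (to (val u) g).
Proof. by rewrite toP (valP u). Qed.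

Definition sub_fun (u : {x | P x}) g : {x | P x} :=
  exist _ (to (val u) g) (sub_fun_subproof u g).

Fact sub_fun1 : sub_fun^~ 1%g =1 id.
Proof. by move=> u; apply: val_inj; rewrite /= act1. Qed.
Fact sub_funM u : act_morph sub_fun u.
Proof. by move=> g h; apply: val_inj; rewrite /= actM. Qed.
Definition sub_action := TotalAction sub_fun1 sub_funM.

Lemma card_fix_sub K : #|'Fix_sub_action(K)| = #|'Fix_to(K) :&: [set x | P x]|.
Proof.
rewrite -(card_imset _ val_inj); apply: eq_card => x; rewrite !inE.
apply/imsetP/andP => [[u /afixP uK ->]|[/subsetP xK Px]].
  split; last exact: (valP u).
  by apply/subsetP=> g /uK/(congr1 val) /= e; rewrite inE e.
exists (exist _ x Px) => //; apply/afixP=> g /xK; rewrite inE => /eqP xg.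
exact: val_inj.
Qed.

End SubAction.

Lemma class_of_split (T : finType) (to : {action gT &-> T}) (P : pred T)
    (toP : forall x g, P (to x g) = P x)
    (toC : forall x g, predC P (to x g) = predC P x) :
  class_of to = (class_of (sub_action toP) + class_of (sub_action toC))%R.
Proof.
rewrite -[RHS]/(class_add _ _) class_of_add; apply/class_ofP/action_iso_sym.
pose f (z : {x | P x} + {x | predC P x}) :=
  match z with inl u => val u | inr v => val v end.
have f_inj : injective f.
  case=> -[x Px] [] [y Py] /= e; subst y.
  - by congr inl; apply: val_inj.
  - by case/negP: (Py).
  - by case/negP: (Px).
  - by congr inr; apply: val_inj.
exists f; last by case.
have f_surj x : exists z, f z == x.
  have [Px|Px] := boolP (P x); first by exists (inl (exist _ x Px)) => /=.
  by exists (inr (exist _ x Px)) => /=.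
exists (fun x => xchoose (f_surj x)) => x; last exact/eqP/(xchooseP (f_surj x)).
exact/f_inj/eqP/(xchooseP (f_surj (f x))).
Qed.

Fact rcosets_act U (A : {set gT}) g :
  (('Rs)%act A g \in rcosets U [set: gT]) = (A \in rcosets U [set: gT]).
Proof.
by rewrite (acts_act (actsRs_rcosets U [set: gT])) ?inE.
Qed.

Definition coset_action U := sub_action (@rcosets_act U).

Lemma card_fix_coset U K : #|'Fix_(coset_action U)(K)| = mark U K.
Proof.
rewrite card_fix_sub setIC; congr #|pred_of_set (_ :&: _)|.
by apply/setP=> A; rewrite inE.
Qed.

Lemma coset_action_trans U (u v : {A | A \in rcosets U [set: gT]}) :
  exists g, coset_action U u g = v.
Proof.
case: u v => A AU [B BU].
have [[a _ eA] [b _ eB]] := (rcosetsP AU, rcosetsP BU).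
exists (a^-1 * b)%g; apply: val_inj => /=.
by rewrite /= rcosetE eA eB -rcosetM mulKVg.
Qed.

Lemma transitive_class (T : finType) (to : {action gT &-> T}) x :
  (forall y, exists g, to x g = y) ->
  class_of to = class_of (coset_action 'C[x | to]%G).
Proof.
move=> transT; apply/class_ofP; set U := 'C[x | to]%G.
have U1 : gval U \in rcosets U [set: gT].
  by apply/rcosetsP; exists 1%g; rewrite ?inE ?rcoset1.
apply: (@transitive_iso _ _ _ _ x (exist _ (gval U) U1)) => // [y | g].
  exact: coset_action_trans.
rewrite -(inj_eq val_inj) /= rcosetE; apply/eqP/eqP => [/astab1P xg|Ug].
  by rewrite rcoset_id.
by apply/astab1P; rewrite -/(gval U) -Ug rcoset_refl.
Qed.

Lemma coset_action_conj U V : conjugate U V ->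
  class_of (coset_action U) = class_of (coset_action V).
Proof.
case/conjugateP=> h ->.
have Uh : U :* h \in rcosets U [set: gT] by apply/rcosetsP; exists h; rewrite ?inE.
rewrite (@transitive_class _ (coset_action U) (exist _ (U :* h) Uh)).
  congr (class_of (coset_action _)); apply/val_inj/setP=> g /=.
  apply/astab1P/idP => [/(congr1 val) /= | Ug].
    rewrite rcosetE => e; rewrite mem_conjg conjgE invgK mulgA.
    by rewrite -mem_rcoset -e -rcosetM rcoset_refl.
  apply: val_inj; rewrite /= rcosetE -rcosetM; apply/rcoset_eqP.
  by move: Ug; rewrite mem_rcoset mem_conjg conjgE invgK mulgA.
exact: coset_action_trans.
Qed.

(** A [G]-set is the disjoint union of its orbits. *)
Lemma class_decomposition (c : gset_class gT) :
  exists2 m : {group gT} -> nat, forall U, m U != 0 -> is_rep U &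
    c = (\sum_(U : {group gT}) class_of (coset_action U) *+ m U)%R.
Proof.
elim/class_ofW: c => T to; have [n] := ubnP #|T|.
elim: n T to => // n IHn T to leTn.
have [T0 | [x _]] := set_0Vmem [set: T].
  exists (fun=> 0) => [U|]; first by rewrite eqxx.
  rewrite big1 //; have noT (y : T) : False by have := in_setT y; rewrite T0 inE.
  apply/class_ofP; exists (fun y => False_rect _ (noT y)) => [|y]; last by case: noT.
  by exists (fun v : void => match v with end) => [y|[]]; case: (noT y).
pose P y := y \in orbit to [set: gT] x.
have toP y g : P (to y g) = P y.
  by rewrite /P orbit_actr ?inE.
have toC y g : predC P (to y g) = predC P y by rewrite /= toP.
rewrite (class_of_split toP toC).
have Px : P x by apply: orbit_refl.
have [|m mrep ->] := IHn _ (sub_action toC).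
  rewrite card_sig; apply: leq_trans (_ : #|predC P| < #|T|) leTn => //.
  by rewrite -(cardC P) -[X in X < _]add0n ltn_add2r; apply/card_gt0P; exists x.
rewrite (@transitive_class _ (sub_action toP) (exist _ x Px)) => [|y]; last first.
  case: y => y Py; case/orbitP: (Py) => g _ eg; exists g.
  exact: val_inj.
set U := 'C[_ | _]%G.
exists (fun V => (V == class_rep U) + m V) => [V|].
  by have [-> _|_] := eqVneq V (class_rep U); [apply: is_rep_rep | apply: mrep].
rewrite (coset_action_conj (class_repP U)); under [RHS]eq_bigr do rewrite mulrnDr.
rewrite big_split /=; congr (_ + _)%R.
rewrite (bigD1 (class_rep U)) //= eqxx big1 ?addr0 // => V /negPf->.
by rewrite mulr0n.
Qed.

End GSets.

(** * The Burnside ring as a ring of functions *)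

Section BurnsideMarks.

Local Open Scope group_scope.
Local Open Scope quotient_scope.
Local Open Scope ring_scope.
Variable gT : finGroupType.
Implicit Types (K L U V : {group gT}) (b : burnside gT).

Definition gset_mark K (c : gset_class gT) : nat :=
  #|'Fix_(gset_act (generic_quotient.repr c))(K)|.

Lemma gset_mark_class K (T : finType) (to : {action gT &-> T}) :
  gset_mark K (class_of to) = #|'Fix_to(K)|.
Proof.
have [f bf fa] : action_iso to (gset_act (generic_quotient.repr (class_of to))).
  exact: action_iso_trans (mk_gsetP to) (gset_repr _).
have f_inj := bij_inj bf; rewrite /gset_mark -(card_imset _ f_inj).
apply/esym/eq_card => y; apply/imsetP/afixP => [[x /afixP xK ->] g gK|yK].
  by rewrite -fa xK.
case: bf => f' fK f'K; exists (f' y); last by rewrite f'K.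
by apply/afixP=> g gK; apply: f_inj; rewrite fa f'K yK.
Qed.

Lemma gset_markD K (c d : gset_class gT) :
  gset_mark K (c + d) = (gset_mark K c + gset_mark K d)%N.
Proof.
elim/class_ofW: c => T to; elim/class_ofW: d => T' uo.
rewrite -[_ + _]/(class_add _ _) class_of_add !gset_mark_class.
rewrite -(card_imset _ (@inl_inj T T')) -(card_imset _ (@inr_inj T T')).
rewrite -[RHS]cardsUI (_ : _ :&: _ = set0) ?cards0 ?addn0; last first.
  by apply/setP=> z; rewrite !inE; apply/andP=> -[/imsetP[x _ ->] /imsetP[]].
apply: eq_card => z; rewrite [RHS]inE; apply/afixP/orP.
  case: z => [x|y] zK; [left|right]; apply/imsetP; [exists x|exists y] => //.
    by apply/afixP=> g /zK[].
  by apply/afixP=> g /zK[].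
by case=> /imsetP[x /afixP xK ->] g gK /=; rewrite xK.
Qed.

Lemma gset_markM K (c d : gset_class gT) :
  gset_mark K (c * d) = (gset_mark K c * gset_mark K d)%N.
Proof.
elim/class_ofW: c => T to; elim/class_ofW: d => T' uo.
rewrite -[_ * _]/(class_mul _ _) class_of_mul !gset_mark_class -cardsX.
apply: eq_card => -[x y]; rewrite in_setX; apply/afixP/andP.
  by move=> zK; split; apply/afixP=> g /zK[].
by case=> /afixP xK /afixP yK g gK; rewrite /= /prod_fun /= xK ?yK.
Qed.

Lemma gset_mark1 K : gset_mark K 1 = 1%N.
Proof.
rewrite -[1 in LHS]/(class1 gT) -[class1 gT]/(class_of (triv_action gT unit)).
rewrite gset_mark_class (_ : 'Fix_(_)(K) = setT) ?cardsT ?card_unit //.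
by apply/setP=> u; rewrite [RHS]inE; apply/afixP.
Qed.

Definition burnside_mark K b : int :=
  (gset_mark K (generic_quotient.repr b).1)%:Z
  - (gset_mark K (generic_quotient.repr b).2)%:Z.

Lemma burnside_mark_pi K z :
  burnside_mark K (\pi_(groth (gset_class gT)) z)
    = (gset_mark K z.1)%:Z - (gset_mark K z.2)%:Z.
Proof.
have /asboolP[k /(congr1 (gset_mark K))] := groth_repr z.
rewrite !gset_markD => /addIn e; rewrite /burnside_mark.
set r := generic_quotient.repr _ in e *.
apply/eqP; rewrite subr_eq addrAC eq_sym subr_eq -!PoszD eqz_nat.
by rewrite -e addnC.
Qed.

Lemma burnside_markD K : {morph burnside_mark K : a b / a + b}.
Proof.
elim/quotW=> a; elim/quotW=> b; rewrite -[_ + _]/(groth_add _ _) !piE.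
rewrite !burnside_mark_pi /= !gset_markD !PoszD opprD; exact: addrACA.
Qed.

Lemma burnside_markM K : {morph burnside_mark K : a b / a * b}.
Proof.
elim/quotW=> a; elim/quotW=> b; rewrite -[_ * _]/(groth_mul _ _) !piE.
rewrite !burnside_mark_pi /= !gset_markD !gset_markM !PoszD !PoszM.
by rewrite mulrBl !mulrBr opprB opprD addrACA -!addrA; congr (_ + _);
   rewrite addrCA.
Qed.

Lemma burnside_mark1 K : burnside_mark K 1 = 1.
Proof.
rewrite -[1 in LHS]/(groth1 _) !piE burnside_mark_pi /= gset_mark1.
have := gset_markD K 0 0; rewrite addr0 => /eqP.
by rewrite -{1}[gset_mark K 0]addn0 eqn_add2l eq_sym => /eqP->.
Qed.

Lemma burnside_mark0 K : burnside_mark K 0 = 0.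
Proof. by apply: (addIr (burnside_mark K 0)); rewrite -burnside_markD !add0r. Qed.

Lemma burnside_markN K : {morph burnside_mark K : a / - a}.
Proof.
by move=> a; apply/eqP; rewrite -addr_eq0 -burnside_markD addNr burnside_mark0.
Qed.

Lemma burnside_mark_sum K (I : finType) (F : I -> burnside gT) :
  burnside_mark K (\sum_i F i) = \sum_i burnside_mark K (F i).
Proof. exact: (big_morph _ (burnside_markD K) (burnside_mark0 K)). Qed.

Lemma burnside_markMz K b (n : int) :
  burnside_mark K (b *~ n) = n * burnside_mark K b.
Proof.
have mn m : burnside_mark K (b *+ m) = m%:Z * burnside_mark K b.
  elim: m => [|m IHm]; first by rewrite mulr0n burnside_mark0 mul0r.
  by rewrite mulrS burnside_markD IHm -addn1 PoszD mulrDl mul1r addrC.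
by case: n => m; rewrite ?NegzE ?mulrNz ?burnside_markN -?pmulrn mn ?mulNr.
Qed.

Definition coset_elt U : burnside gT :=
  \pi_(groth (gset_class gT)) (class_of (coset_action U), 0).

Lemma burnside_mark_coset K U : burnside_mark K (coset_elt U) = (mark U K)%:Z.
Proof.
rewrite burnside_mark_pi /= gset_mark_class card_fix_coset.
have := gset_markD K 0 0; rewrite addr0 => /eqP.
by rewrite -{1}[gset_mark K 0]addn0 eqn_add2l eq_sym => /eqP->; rewrite subr0.
Qed.

Lemma burnside_decomposition b :
  exists2 c : {group gT} -> int, forall U, c U != 0 -> is_rep U &
    b = \sum_(U : {group gT}) coset_elt U *~ c U.
Proof.
elim/quotW: b => -[a a'].
pose i (c : gset_class gT) : burnside gT := \pi_(groth (gset_class gT)) (c, 0).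
have iD c d : i (c + d) = i c + i d.
  by rewrite -[RHS]/(groth_add _ _) /i !piE /pair_add /= addr0.
have i0 : i 0 = 0 by rewrite /i -[RHS]/(groth0 _) !piE.
have -> : \pi_(groth (gset_class gT)) (a, a') = i a - i a' :> burnside gT.
  rewrite -[RHS]/(groth_add _ (groth_opp _)) /i !piE /pair_add /pair_opp /=.
  by rewrite addr0 add0r.
have iE (m : {group gT} -> nat) :
    i (\sum_(U : {group gT}) class_of (coset_action U) *+ m U)
      = \sum_(U : {group gT}) coset_elt U *~ (m U)%:Z.
  rewrite (big_morph i iD i0); apply: eq_bigr => U _; rewrite -pmulrn.
  by elim: (m U) => [|k IHk]; rewrite ?mulr0n // !mulrS iD IHk.
have [[m mrep ->] [m' m'rep ->]] := (class_decomposition a, class_decomposition a').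
exists (fun U => (m U)%:Z - (m' U)%:Z) => [U|].
  have [->|/mrep//] := eqVneq (m U) 0%N; have [->|/m'rep//] := eqVneq (m' U) 0%N.
  by rewrite subrr eqxx.
by rewrite !iE -sumrB; apply: eq_bigr => U _; rewrite mulrzBr.
Qed.

Lemma burnside_mark_integral b : integral (burnside_mark^~ b).
Proof.
have [c _ ->] := burnside_decomposition b.
have : integral (fun K => \sum_(U : {group gT}) c U * (mark U K)%:Z).
  by apply: integral_sum => U; apply: integral_mark.
congr integral; apply/funext=> K; rewrite burnside_mark_sum; apply: eq_bigr => U _.
by rewrite burnside_markMz burnside_mark_coset.
Qed.

Lemma integral_burnside_mark x : integral x -> exists b, forall K, burnside_mark K b = x K.
Proof.
case/integral_marks=> c defx.
exists (\sum_(U : {group gT}) coset_elt U *~ c U) => K.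
rewrite burnside_mark_sum defx; apply: eq_bigr => U _.
by rewrite burnside_markMz burnside_mark_coset.
Qed.

(** Burnside: a largest [U] occurring in [b] would be detected by its mark. *)
Lemma burnside_mark_inj a b :
  (forall K, burnside_mark K a = burnside_mark K b) -> a = b.
Proof.
move=> eab; apply/eqP; rewrite -subr_eq0; apply/eqP.
have {eab} : forall K, burnside_mark K (a - b) = 0.
  by move=> K; rewrite burnside_markD burnside_markN eab subrr.
have [c crep ->] := burnside_decomposition (a - b) => m0.
rewrite big1 // => U _; apply/eqP; apply: contraT => cU.
have {cU} cU : c U != 0 by apply: contraNneq cU => ->; rewrite mulr0z.
have [V cV maxV] := @arg_maxnP _ U (fun V => c V != 0) (fun V => #|V|) cU.
have := m0 V; rewrite burnside_mark_sum (bigD1 V) //= big1 ?addr0.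
  rewrite burnside_markMz burnside_mark_coset mark_self => /eqP.
  by rewrite mulf_eq0 (negPf cV) eqz_nat eqn0Ngt indexg_gt0.
move=> W neWV; rewrite burnside_markMz burnside_mark_coset.
have [->|cW] := eqVneq (c W) 0; first by rewrite mul0r.
have [->|mWV] := posnP (mark W V); first by rewrite mulr0.
case/eqP: neWV; apply: is_rep_inj (crep _ cW) (crep _ cV) _.
apply: (mark_gt0_card mWV); apply/eqP; rewrite eqn_leq; apply/andP; split.
  exact: dvdn_leq (cardG_gt0 W) (mark_dvd mWV).
exact: maxV.
Qed.

(** The elements whose marks are [#|G|] on one class and [0] elsewhere are
    orthogonal and add up to [#|G|], so that a ring morphism to the integers
    is nonzero on one of them, and then equals the corresponding mark. *)
Lemma burnside_hom_mark (phi : burnside gT -> int) :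
    {morph phi : a b / a + b} -> {morph phi : a b / a * b} -> phi 1 = 1 ->
  exists K, forall b, phi b = burnside_mark K b.
Proof.
move=> phiD phiM phi1; pose N : int := #|[set: gT]|%:Z.
have N_neq0 : N != 0 by rewrite eqz_nat -lt0n (cardG_gt0 [set: gT]%G).
have phi0 : phi 0 = 0 by apply: (addIr (phi 0)); rewrite -phiD !add0r.
have phiN b : phi (- b) = - phi b.
  by apply/eqP; rewrite -addr_eq0 -phiD addNr phi0.
have phiMz b n : phi (b *~ n) = n * phi b.
  have mn m : phi (b *+ m) = m%:Z * phi b.
    elim: m => [|m IHm]; first by rewrite mulr0n phi0 mul0r.
    by rewrite mulrS phiD IHm -addn1 PoszD mulrDl mul1r addrC.
  by case: n => m; rewrite ?NegzE ?mulrNz ?phiN -?pmulrn mn ?mulNr.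
have /choice[d dE] K : exists b : burnside gT,
    forall L, burnside_mark L b = N * indicator K L.
  exact/integral_burnside_mark/integral_card_indicator.
have sum_d : \sum_(K : {group gT} | is_rep K) d K = 1 *~ N.
  apply: burnside_mark_inj => L; rewrite burnside_markMz burnside_mark1 mulr1.
  rewrite (big_morph _ (burnside_markD L) (burnside_mark0 L)).
  rewrite (bigD1 (class_rep L)) ?is_rep_rep //= dE /indicator.
  rewrite conjugate_sym class_repP mulr1 big1 ?addr0 // => K /andP[rK neK].
  rewrite dE /indicator (negPf (_ : ~~ conjugate K L)) ?mulr0 //.
  by apply: contra neK => KL; rewrite -(eqP rK) class_rep_eq.
have [K phiK] : exists K, phi (d K) != 0.
  have [K phiK|phi_d] := pickP (fun K => phi (d K) != 0); first by exists K.
  have := congr1 phi sum_d; rewrite (big_morph phi phiD phi0) phiMz phi1 mulr1.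
  rewrite big1 => [e|K _]; last by apply/eqP; rewrite -[_ == _]negbK phi_d.
  by rewrite -e eqxx in N_neq0.
exists K => b; apply: (mulIf phiK); rewrite -phiM -phiMz; congr (phi _).
apply: burnside_mark_inj => L; rewrite burnside_markM burnside_markMz dE.
rewrite scaled_indicatorE; case: ifP => KL; last by rewrite !mulr0.
by rewrite (class_function_conj (proj1 (burnside_mark_integral b)) KL).
Qed.

End BurnsideMarks.

(** * Isomorphisms of Burnside rings *)

Section RingIso.

Local Open Scope ring_scope.

Lemma burnside_iso_integral_iso (gT hT : finGroupType)
    (f : burnside gT -> burnside hT) (f' : burnside hT -> burnside gT) :
    {morph f : a b / a + b} -> {morph f : a b / a * b} -> f 1 = 1 ->
    cancel f f' -> cancel f' f ->
  exists (s : {group gT} -> {group hT}) (t : {group hT} -> {group gT}),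
    integral_iso s t.
Proof.
move=> fD fM f1 fK f'K.
have f'D : {morph f' : a b / a + b}.
  by move=> a b; apply: (can_inj fK); rewrite fD !f'K.
have f'M : {morph f' : a b / a * b}.
  by move=> a b; apply: (can_inj fK); rewrite fM !f'K.
have f'1 : f' 1 = 1 by apply: (can_inj fK); rewrite f'K f1.
have /choice[s sE] K : exists L, forall b, burnside_mark K (f' b) = burnside_mark L b.
  apply: burnside_hom_mark => [a b|a b|].
  - by rewrite f'D burnside_markD.
  - by rewrite f'M burnside_markM.
  - by rewrite f'1 burnside_mark1.
have /choice[t tE] L : exists K, forall a, burnside_mark L (f a) = burnside_mark K a.
  apply: burnside_hom_mark => [a b|a b|].
  - by rewrite fD burnside_markD.
  - by rewrite fM burnside_markM.
  - by rewrite f1 burnside_mark1.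
exists s, t; split=> [x xB|x xB|K|L].
- have [b bE] := integral_burnside_mark xB; have := burnside_mark_integral (f' b).
  by congr integral; apply/funext=> K; rewrite sE bE.
- have [a aE] := integral_burnside_mark xB; have := burnside_mark_integral (f a).
  by congr integral; apply/funext=> L; rewrite tE aE.
- apply: congruent_conj_eq => x /integral_burnside_mark[a aE].
  by rewrite -!aE -tE -sE fK.
- apply: congruent_conj_eq => x /integral_burnside_mark[b bE].
  by rewrite -!bE -sE -tE f'K.
Qed.

End RingIso.

(** * The group corresponding to the trivial group *)

Section BasePoint.

Local Open Scope group_scope.
Local Open Scope ring_scope.
Local Open Scope nat_scope.

Lemma radical_squarefree n : 0 < n -> (forall p, p \in primes n -> n`_p = p) ->
  radical n = n.
Proof.
move=> n_gt0 sqf.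
rewrite [RHS](prod_prime_decomp n_gt0) prime_decompE big_map /radical.
by rewrite big_seq [RHS]big_seq; apply: eq_bigr => p /sqf; rewrite p_part.
Qed.

Lemma radical_dvd_squarefree n m : 0 < m ->
  (forall p, prime p -> p %| m -> m`_p = p) -> n %| m -> radical n = n.
Proof.
move=> m_gt0 sqf nm; have n_gt0 := dvdn_gt0 m_gt0 nm.
apply: radical_squarefree => // p; rewrite mem_primes => /and3P[p_pr _ pn].
have dn : n`_p %| p.
  by rewrite -{2}(sqf p p_pr (dvdn_trans pn nm)) partn_dvd.
apply/eqP; rewrite eqn_dvd dn -[X in X %| _](part_pnat_id (pnat_id p_pr)).
exact: partn_dvd.
Qed.

Lemma totient_squarefree_ndvd n p : 0 < n -> radical n = n -> prime p ->
  (forall q, q \in primes n -> q < p) -> ~~ (p %| totient n).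
Proof.
move=> n_gt0 rad p_pr lt_p; have := totient_radicalE n_gt0.
rewrite rad mulnC => /eqP; rewrite eqn_pmul2l // => /eqP->.
rewrite /totient_radical big_seq; apply: (big_ind (fun m => ~~ (p %| m))).
- by rewrite dvdn1 gtn_eqF ?prime_gt1.
- by move=> a b; rewrite Euclid_dvdM // negb_or => -> ->.
move=> q qn; have q_pr : prime q by move: qn; rewrite mem_primes => /andP[].
rewrite gtnNdvd //; first by rewrite -ltnS prednK ?prime_gt1 ?prime_gt0.
by apply: leq_ltn_trans (leq_pred q) (lt_p q qn).
Qed.

Section Structure.

(** The least multiple of the indicator of [V] that is a combination of marks is
    as large as for the trivial group, which is what distinguishes the image
    [V] of the trivial group under an isomorphism. *)
Variable gT : finGroupType.
Variable V : {group gT}.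
Hypothesis baseV : forall m,
  integral (fun L => (m%:Z * indicator V L)%R) -> #|[set: gT]| %| m.

Let N := #|[set: gT]|.
Let N_gt0 : 0 < N. Proof. exact: cardG_gt0 [set: gT]%G. Qed.
Let cardN : #|'N(V) : V| * #|V| * #|[set: gT] : 'N(V)| = N.
Proof. by rewrite card_norm_index Lagrange ?subsetT. Qed.

(** If the bound of [integral_at_indicator] left some room at [p], already
    [#|G| / p] times the indicator of [V] would be integral. *)
Lemma base_no_room p : prime p -> p %| N -> #|'N(V) : V|`_p %| N %/ p ->
  ~~ (p * #|'N(V) : V|`_p %| N %/ p)
  /\ exists2 W : {group gT}, W <| V & #|V : W| = p.
Proof.
move=> p_pr pN iN.
have tight : ~ (p * #|'N(V) : V|`_p %| N %/ p \/
                (forall W : {group gT}, W <| V -> #|V : W| != p)).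
  move=> room; have : N %| N %/ p.
    apply/baseV/(@integral_indicator_of_prime _ p); last exact: integral_at_indicator.
    rewrite dvdn_divRL // -/N -[X in _ %| X](partnC p N_gt0) mulnC dvdn_mul //.
    by rewrite -{1}(part_pnat_id (pnat_id p_pr)) partn_dvd.
  have := ltn_Pdiv (prime_gt1 p_pr) N_gt0.
  by move=> ltN /dvdn_leq; rewrite divn_gt0 ?prime_gt0 ?(dvdn_leq N_gt0 pN) // leqNgt ltN => /(_ isT).
split; first by apply/negP=> room; apply: tight; left.
have [/existsP[W /andP[nW /eqP iW]]|no] :=
  boolP [exists W : {group gT}, (W <| V) && (#|V : W| == p)]; first by exists W.
case: tight; right=> W nW; apply: contra no => iW; apply/existsP; exists W.
by rewrite nW.
Qed.

Lemma base_normal : V <| [set: gT].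
Proof.
rewrite /normal subsetT /= -indexg_eq1; apply: contraT => i_neq1.
set i := #|_ : _| in i_neq1; have i_gt1 : 1 < i by rewrite ltn_neqAle eq_sym i_neq1 indexg_gt0.
pose p := pdiv i; have p_pr : prime p by apply: pdiv_prime.
have [pi pN] : p %| i /\ p %| N.
  by split; [apply: pdiv_dvd | rewrite -cardN dvdn_mull ?pdiv_dvd].
have eNp : N %/ p = #|'N(V) : V| * #|V| * (i %/ p) by rewrite -cardN -/i muln_divA.
have [|tight [W nW iW]] := base_no_room p_pr pN.
  by rewrite eNp -mulnA dvdn_mulr // dvdn_part.
case/negP: tight; rewrite eNp mulnC dvdn_mulr // dvdn_mul ?dvdn_part //.
by rewrite -iW dvdn_indexg.
Qed.

Let cardNV : #|'N(V) : V| * #|V| = N.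
Proof.
case/andP: base_normal => _ nV; rewrite card_norm_index.
by congr #|pred_of_set _|; apply/eqP; rewrite eqEsubset subsetT.
Qed.

Lemma base_Sylow p : prime p -> p %| #|V| ->
  #|V|`_p = p /\ exists2 W : {group gT}, W <| V & #|V : W| = p.
Proof.
move=> p_pr pV; have pN : p %| N by rewrite -cardNV dvdn_mull.
have eNp : N %/ p = #|'N(V) : V| * (#|V| %/ p) by rewrite -cardNV muln_divA.
have [|tight exW] := base_no_room p_pr pN.
  by rewrite eNp dvdn_mulr // dvdn_part.
split=> //; rewrite p_part; have : 0 < logn p #|V| by rewrite logn_gt0 mem_primes p_pr cardG_gt0.
case e: (logn p #|V|) => [//|[|a]] _; first by rewrite expn1.
case/negP: tight; rewrite eNp mulnC dvdn_mul ?dvdn_part // dvdn_divRL //.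
have : p ^ 2 %| #|V| by rewrite pfactor_dvdn // e.
by rewrite expnS expn1.
Qed.

(** Each prime [p] divides [#|V|] exactly once and is the order of a quotient
    of [V], so it cannot divide the order of the derived subgroup. *)
Lemma base_cyclic : cyclic V.
Proof.
apply: nil_Zgroup_cyclic.
  apply/forall_inP=> S /SylowP[p p_pr sylS].
  have [pS|pS] := boolP (p %| #|V|).
    by apply: prime_cyclic; rewrite (card_Hall sylS) (base_Sylow p_pr pS).1.
  have -> : S = 1%G; last exact: cyclic1.
  apply/val_inj/card1_trivg; rewrite (card_Hall sylS) part_p'nat // p'natE //.
apply: abelian_nil; apply/derG1P/card1_trivg/eqP; apply: contraT => V'_neq1.
pose p := pdiv #|V^`(1)%g|; have p_pr : prime p.
  by apply: pdiv_prime; rewrite ltn_neqAle eq_sym V'_neq1 cardG_gt0.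
have pV' : p %| #|V^`(1)%g| := pdiv_dvd _.
have pV : p %| #|V| := dvdn_trans pV' (cardSg (der_sub 1 V)).
have [V_p [W nW iW]] := base_Sylow p_pr pV.
have sV'W : V^`(1)%g \subset W.
  apply: der1_min; first exact: normal_norm.
  by rewrite cyclic_abelian // prime_cyclic // card_quotient ?normal_norm // iW.
have : p ^ 2 %| #|V|.
  rewrite -(Lagrange (normal_sub nW)) iW expnS expn1 dvdn_mul //.
  exact: dvdn_trans pV' (cardSg sV'W).
rewrite pfactor_dvdn ?cardG_gt0 // => lt1.
have e1 : logn p #|V| == 1.
  by rewrite -(eqn_exp2l _ _ (prime_gt1 p_pr)) expn1 -p_part V_p.
by rewrite (eqP e1) in lt1.
Qed.

End Structure.
End BasePoint.

(** * Groups close to the base point *)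

Section Neighbours.

Local Open Scope group_scope.
Local Open Scope ring_scope.
Local Open Scope nat_scope.

Lemma integral_iso_base (gT hT : finGroupType)
    (s : {group gT} -> {group hT}) (t : {group hT} -> {group gT}) m :
    integral_iso s t -> integral (fun L => (m%:Z * indicator (s 1%G) L)%R) ->
  #|[set: hT]| %| m.
Proof.
move=> st /(integral_iso_indicatorE st)/integral_indicator_self.
by rewrite norm1 indexg1 (integral_iso_card st).
Qed.

Lemma cyclic_normal_sub (gT : finGroupType) (V K : {group gT}) :
  V <| [set: gT] -> cyclic V -> K \subset V -> K <| [set: gT].
Proof.
move=> nV cV sKV; rewrite /normal subsetT.
exact: subset_trans (normal_norm nV) (cyclic_sub_norm cV sKV).
Qed.

Variables (gT hT : finGroupType).
Variables (s : {group gT} -> {group hT}) (t : {group hT} -> {group gT}).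
Hypothesis st : integral_iso s t.

Let V := s 1%G.
Let V_normal : V <| [set: hT].
Proof. by apply: base_normal => m; apply: integral_iso_base st. Qed.
Let V_cyclic : cyclic V.
Proof. by apply: base_cyclic => m; apply: integral_iso_base st. Qed.
Let V_Sylow p : prime p -> p %| #|V| -> #|V|`_p = p.
Proof.
by move=> p_pr pV; have [] := @base_Sylow _ V (fun m => integral_iso_base st) p p_pr pV.
Qed.

Variables (p : nat) (K Q : {group hT}).
Hypotheses (p_pr : prime p) (pV : p %| #|V|).
Hypotheses (sKV : K \subset V) (cardK : #|K| = #|V|`_p^').
Hypotheses (sQV : Q \subset V) (cardQ : #|Q| = p).

Let A := t K.
Let N := #|[set: gT]|.
Let eN : #|[set: hT]| = N. Proof. exact/esym/(integral_iso_card st). Qed.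
Let ts := integral_iso_sym st.
Let cardV : #|V| = #|K| * p.
Proof. by rewrite cardK -{2}(V_Sylow p_pr pV) mulnC partnC ?cardG_gt0. Qed.
Let p'K : p^'.-nat #|K|. Proof. by rewrite cardK part_pnat. Qed.
Let K_normal : K <| [set: hT].
Proof. exact: cyclic_normal_sub V_normal V_cyclic sKV. Qed.
Let neqKV : #|K| != #|V|.
Proof. by rewrite cardV neq_ltn ltn_Pmulr ?prime_gt1. Qed.
Let tV : t V = 1%G.
Proof. by have [_ _ /(_ 1%G)/conjugate_trivg] := st. Qed.
Let cong_AV : congruent p A 1%G.
Proof.
rewrite -tV; apply: (integral_iso_congruent ts); apply: congruent_normal => //.
  exact: normalS sKV (normal_sub V_normal) K_normal.
by rewrite -divgS // cardV mulKn ?cardG_gt0 // pnat_id.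
Qed.

(** Like [V], its subgroup [K] is normal, cyclic and of squarefree order, so the
    multiples of its indicator are as constrained as those of [V]; hence [A]
    too satisfies the hypotheses of the lemmas on base points. *)
Lemma neighbour_normal : A <| [set: gT] /\ #|A| = p.
Proof.
have K_rad : radical #|K| = #|K|.
  exact: radical_dvd_squarefree (cardG_gt0 V) V_Sylow (cardSg sKV).
have baseA m : integral (fun L => (m%:Z * indicator A L)%R) -> #|[set: gT]| %| m.
  move/(integral_iso_indicatorE ts)/integral_indicator_cyclic=> /(_ (cyclicS sKV V_cyclic)).
  rewrite K_rad card_norm_index -/N -eN.
  have /andP[_ nK] := K_normal; have -> // : 'N(K) = [set: hT].
  by apply/eqP; rewrite eqEsubset subsetT.
split; first exact: base_normal baseA.
have pA : p.-group A.
  exact: congruent_pgroup p_pr (pgroup1 _ p) (congruent_sym cong_AV).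
have A_neq1 : #|A| != 1.
  rewrite -trivg_card1; apply: contra neqKV => /eqP A1.
  have : conjugate K (s A) by have [_ _ _] := st; apply.
  have -> : A = 1%G by apply: val_inj.
  by move/conjugate_card=> ->.
have [_ pdA _] : [/\ prime p, p %| #|A| & exists m, #|A| = p ^ m.+1].
  by apply: pgroup_pdiv; rewrite // trivg_card1.
by rewrite -(part_pnat_id pA) (base_Sylow baseA p_pr pdA).1.
Qed.

Section Line.

Variable D : {group hT}.
Hypotheses (cardD : #|D| = p) (neqDQ : D :!=: Q) (cDK : D \subset 'C(K)).

Let W := (K <*> D)%G.
Let M := (#|[set: hT]|`_p^')%N.
Let coKD : coprime #|K| #|D|.
Proof. by rewrite cardD coprime_sym (pnat_coprime (pnat_id p_pr)). Qed.
Let eW : W = (K * D)%g :> {set hT}.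
Proof. by rewrite /= norm_joinEr // (subset_trans cDK) ?cent_sub. Qed.
Let cardW : #|W| = #|K| * p.
Proof. by rewrite eW coprime_cardMg // cardD. Qed.
Let cW : cyclic W.
Proof.
have cK := cyclicS sKV V_cyclic.
have cD : cyclic D by rewrite prime_cyclic // cardD.
have := cyclicM cK cD cDK coKD; rewrite -eW; exact: id.
Qed.
Let sKW : K \subset W. Proof. exact: joing_subl. Qed.
Let neqWV : W != V.
Proof.
apply: contra neqDQ => /eqP eWV; rewrite (eq_subG_cyclic cW) ?cardD ?cardQ //.
  exact: joing_subr.
by rewrite eWV.
Qed.
Let p'W : #|W|`_p^' = #|K|.
Proof. by rewrite cardW partnM ?(prime_gt0 p_pr) // part_pnat_id // part_p'nat ?muln1 // pnatNK pnat_id. Qed.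

(** The marks of [H / W], truncated to the groups with the [p']-part of [W]. *)
Let x (L : {group hT}) : int :=
  (M%:Z * (if (#|L|`_p^')%N == #|K| then (mark W L)%:Z else 0))%R.
Let xB : integral x. Proof. exact: integral_block p_pr (integral_mark W). Qed.

Let supp_x L : x L != 0%R -> conjugate K L || conjugate W L.
Proof.
rewrite /x; case: ifP => [/eqP p'L | _]; last by rewrite mulr0 eqxx.
have [->|mL _] := posnP (mark W L); first by rewrite mulr0 eqxx.
have : #|L|`_p %| p.
  rewrite -(dvdn_pmul2r (cardG_gt0 K)) -{1}p'L partnC ?cardG_gt0 //.
  by rewrite mulnC -cardW mark_dvd.
case/primeP: (p_pr) => _ pP /pP/orP[] /eqP pL.
  case/mark_gt0P: mL => g sLW; apply/orP; left; rewrite conjugate_sym.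
  apply/conjugateP; exists g; apply/val_inj/eqP.
  rewrite (eq_subG_cyclic (H := K) (K := (L :^ g)%G) cW) //= cardJg.
  by rewrite -(partnC p (cardG_gt0 L)) p'L pL mul1n.
apply/orP; right; apply: mark_gt0_card => //.
by rewrite -(partnC p (cardG_gt0 L)) p'L pL cardW mulnC.
Qed.

Let xV : x V = 0%R.
Proof.
apply/eqP; apply: contraT => /supp_x/orP[] VL.
  by move: neqKV; rewrite (conjugate_card VL) eqxx.
by rewrite conjugate_sym in VL; case/eqP: neqWV; apply: conjugate_normal VL.
Qed.

Let xK : x K = (M * mark W K)%:Z.
Proof. by rewrite /x part_pnat_id // eqxx PoszM. Qed.
Let xW : x W = (M * #|'N(W) : W|)%:Z.
Proof. by rewrite /x p'W eqxx mark_self PoszM. Qed.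
Let markWK : mark W K * #|W| = N.
Proof. by rewrite mark_normal. Qed.

Let yB : integral (x \o s). Proof. by case: st => sB _ _ _; apply: sB. Qed.

Let supp_y U : (x \o s) U != 0%R -> conjugate A U || conjugate (t W) U.
Proof.
by move/supp_x; rewrite ![conjugate _ (s U)]conjugate_sym !(integral_iso_conj_adj st)
  ![conjugate U _]conjugate_sym.
Qed.

Let D0 := t W.

Let WsD0 : conjugate W (s D0). Proof. by have [_ _ _] := st; apply. Qed.
Let KsA : conjugate K (s A). Proof. by have [_ _ _] := st; apply. Qed.
Let y1 : (x \o s) 1%G = 0%R. Proof. exact: xV. Qed.
Let yD0 : (x \o s) D0 = (M * #|'N(W) : W|)%:Z.
Proof. by rewrite -xW; apply: class_function_conj (proj1 xB) WsD0. Qed.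
Let yA : (x \o s) A = (M * mark W K)%:Z.
Proof. by rewrite -xK; apply: class_function_conj (proj1 xB) KsA. Qed.

Let cong_AD0 : congruent p A D0.
Proof.
apply: (integral_iso_congruent ts); apply: congruent_normal => //.
  exact: normalS sKW (subsetT _) K_normal.
by rewrite -divgS // cardW mulKn ?cardG_gt0 // pnat_id.
Qed.
Let pD0 : p.-group D0.
Proof.
apply: (congruent_pgroup p_pr (pgroup1 _ p)).
exact: congruent_trans (congruent_sym cong_AV) cong_AD0.
Qed.
Let pdD0 : p %| #|D0|.
Proof.
have : D0 :!=: 1%g.
  apply: contra neqWV => /eqP D01; apply/eqP.
  have e1 : D0 = 1%G by apply: val_inj.
  have := WsD0; rewrite e1 conjugate_sym; exact: conjugate_normal.
by case/(pgroup_pdiv pD0).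
Qed.
Let not_AD0 : ~~ conjugate A D0.
Proof.
rewrite (integral_iso_conjE ts); apply/negP=> /conjugate_card/eqP.
by rewrite cardW -{2}[#|K|]muln1 eqn_pmul2l ?cardG_gt0 // gtn_eqF ?prime_gt1.
Qed.
Let p'M : ~~ (p %| M).
Proof. by rewrite -p'natE // part_pnat. Qed.
Let W_rad : radical #|W| = #|W|.
Proof.
apply: radical_squarefree => // q; rewrite mem_primes => /and3P[q_pr _ qW].
rewrite cardW partnM ?(prime_gt0 p_pr) //.
have [->|neq_qp] := eqVneq q p.
  by rewrite part_p'nat // mul1n part_pnat_id ?pnat_id.
have qK : q %| #|K|.
  by move: qW; rewrite cardW Euclid_dvdM // [X in _ || X]dvdn_prime2 // (negPf neq_qp) orbF.
have := V_Sylow q_pr (dvdn_trans qK (cardSg sKV)).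
by rewrite cardV partnM ?(prime_gt0 p_pr).
Qed.

(** The transported function is supported on [A] and [D0] and vanishes at the
    trivial group. If [#|D0| > p], then [pgroup_support_dvd] applies, so that
    its value leaves room for [integral_at_indicator] at [D0], whereas
    [integral_indicator_cyclic] leaves none at [W]. *)
Lemma line_card : #|D0| = p.
Proof.
have [[|[|a]] eD0] := p_natP pD0.
- by have := pdD0; rewrite eD0 dvdn1 gtn_eqF ?prime_gt1.
- by rewrite eD0 expn1.
have big : p * #|'N(D0) : D0| %| M * #|'N(W) : W|.
  have := pgroup_support_dvd p_pr pD0 pdD0 yB; rewrite yD0 dvdzE; apply.
    move=> U /supp_y/orP[/conjugate_card-> _ | -> //].
    by rewrite neighbour_normal.2 eD0 !expnS mulKn ?prime_gt0 // dvdn_mulr.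
  by rewrite y1 mulr0.
have : integral (fun U => (M * #|'N(W) : W|)%:Z * indicator D0 U)%R.
  apply: (@integral_indicator_of_prime _ p); first by rewrite -/N -eN dvdn_mulr.
  have room : p * #|'N(D0) : D0|`_p %| M * #|'N(W) : W|.
    by apply: dvdn_trans big; rewrite dvdn_mul ?dvdn_part.
  apply: integral_at_indicator => //; last by left.
  exact: dvdn_trans (dvdn_mull _ _) room.
move/(integral_iso_indicatorE ts)/(integral_indicator_cyclic _ cW).
rewrite mulnC dvdn_pmul2r ?indexg_gt0 // W_rad => dW.
by case/negP: p'M; apply: dvdn_trans dW; rewrite cardW dvdn_mull.
Qed.

(** With both [A] and the second neighbour of order [p], the orbit count of [y]
    is [2 * (p - 1) * M / #|W|], whose denominator [p] must cancel. *)
Lemma line_even : p = 2.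
Proof.
have cD0 : cyclic D0 by rewrite prime_cyclic // line_card.
have [_ cardA] := neighbour_normal.
have cA : cyclic A by rewrite prime_cyclic // cardA.
have totp : totient p = p.-1 by rewrite -{1}[p]expn1 totient_pfactor // muln1.
have eD0 : #|'N(D0)| = #|'N(W)|.
  have := integral_iso_index_radical ts cW cD0; rewrite W_rad card_norm_index -/D0.
  rewrite line_card (radical_squarefree (prime_gt0 p_pr)); last first.
    move=> q; rewrite primes_prime // inE => /eqP->.
    by rewrite part_pnat_id ?pnat_id.
  by rewrite -{1}line_card card_norm_index.
have := integral_sum_cycle yB; rewrite (sum_weight (fun g : gT => <[g]>%G) (proj1 yB)).
have neqr : class_rep D0 != class_rep A.
  by rewrite class_rep_eq conjugate_sym not_AD0.
rewrite (bigD1 (class_rep A)) ?is_rep_rep //.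
rewrite (bigD1 (class_rep D0)) ?is_rep_rep ?neqr // big1; last first.
  move=> U /andP[/andP[rU neA] neD0]; have [e|] := eqVneq ((x \o s) U) 0%R.
    by rewrite e mul0r.
  case/supp_y/orP; rewrite -class_rep_eq (eqP rU) eq_sym.
    by rewrite (negPf neA).
  by rewrite (negPf neD0).
have wE U : #|[set g | conjugate (class_rep U) <[g]>%G]| = weight U.
  by apply: eq_card => g; rewrite !inE -(conjugate_eql (class_repP U)).
rewrite !(class_function_conj (proj1 yB) (class_repP _)) yA yD0 !wE.
rewrite -!PoszM /= addr0 -PoszD dvdzE /= => dN.
have wA : weight A * N = p.-1 * N.
  rewrite -totp -cardA -(weight_card cA); congr (_ * #|pred_of_set _|).
  apply/eqP; rewrite eqEsubset subsetT andbT.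
  exact: normal_norm neighbour_normal.1.
have wD0 : weight D0 * #|'N(W)| = p.-1 * N.
  by rewrite -eD0 weight_card // line_card totp.
have : N * #|W| %| 2 * (M * p.-1) * N.
  apply: dvdn_trans (dvdn_mul dN (dvdnn #|W|)) _.
  have -> : (M * mark W K * weight A + M * #|'N(W) : W| * weight D0) * #|W|
      = M * (weight A * (mark W K * #|W|) + weight D0 * (#|'N(W) : W| * #|W|)).
    by rewrite mulnDl mulnDr; congr (_ + _);
      rewrite -!mulnA; congr (_ * _); rewrite mulnCA.
  by rewrite markWK card_norm_index wA wD0 addnn -mul2n mulnCA !mulnA.
rewrite mulnC dvdn_pmul2r ?cardG_gt0 // cardW => dW.
have : p %| 2 * (M * p.-1) by apply: dvdn_trans dW; apply: dvdn_mull.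
have np1 : ~~ (p %| p.-1).
  apply/negP=> /dvdn_leq; rewrite -subn1 subn_gt0 prime_gt1 // => /(_ isT).
  by rewrite subn1 leqNgt ltn_predL prime_gt0.
rewrite !Euclid_dvdM // (negPf p'M) (negPf np1) !orbF.
by rewrite dvdn_prime2 // => /eqP.
Qed.

End Line.

End Neighbours.

(** * Small p-groups avoiding the base point *)

Section UniqueLine.

Local Open Scope group_scope.
Local Open Scope ring_scope.
Local Open Scope nat_scope.

Section OrderTwo.

Variables (gT hT : finGroupType).
Variables (s : {group gT} -> {group hT}) (t : {group hT} -> {group gT}).
Hypotheses (st : integral_iso s t) (cardV : #|s 1%G| = 2).

Lemma base2_neighbour : t 1%G <| [set: gT] /\ #|t 1%G| = 2.
Proof.
apply: (neighbour_normal st (K := 1%G) (p := 2)) => //; first by rewrite cardV.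
  exact: sub1G.
by rewrite cards1 cardV part_p'nat // pnatNK.
Qed.

Lemma base2_line (Z : {group hT}) : #|Z| = 2 -> Z != s 1%G -> #|t Z| = 2.
Proof.
move=> cZ neZ; have <- : (1 <*> Z)%G = Z by apply: val_inj; apply: joing1G.
apply: (line_card st (Q := s 1%G)) => //; rewrite ?cardV ?cards1 ?sub1G //.
  by rewrite part_p'nat // pnatNK.
by rewrite centsC sub1G.
Qed.

End OrderTwo.

(** If a group [D] of order 4 avoided the base point [V], the marks of [H / D],
    transported, would vanish at the trivial group and be supported on groups of
    order 2 and one other 2-group, against [pgroup_support_dvd]. *)
Lemma base2_order4 (gT hT : finGroupType)
    (s : {group gT} -> {group hT}) (t : {group hT} -> {group gT})
    (D : {group hT}) :
  integral_iso s t -> #|s 1%G| = 2 -> #|D| = 4 -> s 1%G \subset D.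
Proof.
move=> st cardV cardD; apply: contraT => nVD.
have ts := integral_iso_sym st; have [nA cardA] := base2_neighbour st cardV.
set V := s 1%G in cardV nVD; set A := t 1%G in nA cardA.
have nV : V <| [set: hT] := (base2_neighbour ts cardA).1.
pose W := t D; have [sB tB tsK stL] := st.
have DsW : conjugate D (s W) := stL D.
have yB : integral ((fun L => (mark D L)%:Z) \o s) := sB _ (integral_mark D).
have two_pr : prime 2 by [].
have pD : 2.-group D by rewrite /pgroup cardD.
have pV : 2.-group V by rewrite /pgroup cardV.
have nat_index (gT' : finGroupType) (P : {group gT'}) :
    2.-group P -> congruent 2 1%G P.
  move=> pP; apply: congruent_normal => //; first exact: normal1.
  by rewrite indexg1.
have VD : congruent 2 V D.
  exact: congruent_trans (congruent_sym (nat_index _ _ pV)) (nat_index _ _ pD).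
have tV : t V = 1%G by apply: conjugate_trivg; apply: tsK.
have pW : 2.-group W.
  by apply: (congruent_pgroup two_pr (pgroup1 _ 2)); rewrite -tV;
     exact: (integral_iso_congruent ts VD).
have [[|[|a]] eW] := p_natP pW.
- move: DsW; have -> : W = 1%G by apply/val_inj/card1_trivg.
  by move/conjugate_card; rewrite -/V cardV cardD.
- have [eWA|neWA] := eqVneq W A.
    have : conjugate 1%G (s W) by rewrite eWA; apply: stL.
    by move/conjugate_card; rewrite (conjugate_card DsW) cardD cards1.
  have := base2_line ts cardA eW neWA.
  by rewrite (conjugate_card DsW) cardD.
have y1 : mark D (s 1%G) = 0.
  by apply/eqP; rewrite eqn0Ngt; apply: contra nVD; apply: mark_normal_gt0.
have dW : 2 %| #|W| by rewrite eW expnS dvdn_mulr.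
have big : 2 * #|'N(W) : W| %| #|'N(D) : D|.
  have := pgroup_support_dvd two_pr pW dW yB.
  rewrite /= (mark_conjugate _ DsW) mark_self dvdzE; apply; last first.
    by rewrite y1 mulr0.
  move=> U mU nWU; have {mU} mU : 0 < mark D (s U) by rewrite lt0n.
  rewrite eW expnS mulKn // expnS dvdn_mulr //.
  have nDU : #|s U| != #|D|.
    apply: contra nWU => /eqP eU; rewrite conjugate_sym.
    by rewrite -(integral_iso_conj_adj st) conjugate_sym mark_gt0_card.
  have dU := mark_dvd mU; rewrite cardD in dU nDU.
  have [sU1|sU2] : #|s U| = 1 \/ #|s U| = 2.
    by move: dU nDU; case: #|s U| => [|[|[|[|[|n]]]]] // _ _; [left | right].
  - have : conjugate 1%G (s U).
      by have -> : s U = 1%G; [apply/val_inj/card1_trivg | apply: conjugate_refl].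
    rewrite conjugate_sym (integral_iso_conj_adj st) conjugate_sym => /conjugate_card->.
    by rewrite cardA.
  have neV : s U != V.
    apply: contra nVD => /eqP eUV; rewrite eUV in mU; exact: mark_normal_gt0 nV mU.
  have := base2_line st cardV sU2 neV; rewrite (conjugate_card (tsK U)) => ->.
  by [].
(* The factor [M] takes care of the odd primes. *)
set M := #|[set: gT]|`_2^'.
have : integral (fun U => (M * #|'N(D) : D|)%:Z * indicator W U)%R.
  apply: (@integral_indicator_of_prime _ 2); first exact: dvdn_mulr.
  have room : 2 * #|'N(W) : W|`_2 %| M * #|'N(D) : D|.
    by apply: dvdn_mull; apply: dvdn_trans big; rewrite dvdn_mul ?dvdn_part.
  apply: integral_at_indicator => //; last by left.
  exact: dvdn_trans (dvdn_mull _ _) room.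
move/(integral_iso_indicatorE ts) => mB.
have := pgroup_support_dvd two_pr pD _ mB; rewrite cardD => /(_ isT).
rewrite !scaled_indicatorE conjugate_refl dvdzE.
case: ifP => [/conjugate_card|_]; first by rewrite cards1 cardD.
rewrite mulr0 dvdz0 /= => dM.
have : 2 * #|'N(D) : D| %| M * #|'N(D) : D|.
  by apply: dM => // L; rewrite scaled_indicatorE; case: ifP.
rewrite dvdn_pmul2r ?indexg_gt0 // => dM2.
have := part_pnat 2^' #|[set: gT]|; rewrite -/M p'natE // dM2.
by [].
Qed.

End UniqueLine.

Section UniqueLineGeneral.

Local Open Scope group_scope.
Local Open Scope ring_scope.
Local Open Scope nat_scope.

Lemma prime_centralises_cyclic (gT : finGroupType) (K D : {group gT}) p :
    prime p -> #|D| = p -> K <| [set: gT] -> cyclic K -> ~~ (p %| totient #|K|) ->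
  D \subset 'C(K).
Proof.
move=> p_pr cD /andP[_ nK] cK ntot; rewrite -ker_conj_aut ker_trivg_morphim.
rewrite (subset_trans (subsetT _) nK) /=.
have : #|conj_aut K @* D| %| p by rewrite -cD dvdn_morphim.
case/primeP: (p_pr) => _ pP /pP/orP[] /eqP e.
  by rewrite (card1_trivg e).
case/negP: ntot; rewrite -card_Aut_cyclic // -e.
exact: cardSg (Aut_conj_aut _ _).
Qed.

(** If the base point [V] is nontrivial and [p] is its largest prime, its
    subgroup [Q] of order [p] lies in every nontrivial [p]-subgroup, up to the
    subgroups of order 2 when [p = 2]. *)
Lemma base_unique_line (gT hT : finGroupType)
    (s : {group gT} -> {group hT}) (t : {group hT} -> {group gT})
    p (K Q D : {group hT}) :
    integral_iso s t -> prime p -> p %| #|s 1%G| ->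
    (forall q, q \in primes #|s 1%G| -> q <= p) ->
    K \subset s 1%G -> #|K| = #|s 1%G|`_p^' -> Q \subset s 1%G -> #|Q| = p ->
    p.-group D -> ~~ (Q \subset D) ->
  #|D| %| gcdn 2 p.
Proof.
move=> st p_pr pV maxp sKV cK sQV cQ pD nQD; set V := s 1%G in pV maxp sKV cK sQV.
have baseV m : integral (fun L => (m%:Z * indicator V L)%R) -> #|[set: hT]| %| m.
  exact: integral_iso_base st.
have [nV cyV] := (base_normal baseV, base_cyclic baseV).
have V_Sylow q : prime q -> q %| #|V| -> #|V|`_q = q.
  by move=> q_pr qV; have [] := base_Sylow baseV q_pr qV.
have [D1|D_neq1] := eqVneq D 1%G; first by rewrite D1 cards1 dvd1n.
have [_ pdD _] : [/\ prime p, p %| #|D| & exists m, #|D| = p ^ m.+1].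
  by apply: pgroup_pdiv.
have [x Dx ox] := Cauchy p_pr pdD.
have sxD : <[x]> \subset D by rewrite cycle_subG.
have p'K : p^'.-nat #|K| by rewrite cK part_pnat.
have cDK : <[x]> \subset 'C(K).
  apply: (prime_centralises_cyclic p_pr) => //.
  - exact: cyclic_normal_sub nV cyV sKV.
  - exact: cyclicS cyV.
  apply: totient_squarefree_ndvd => //.
    exact: radical_dvd_squarefree (cardG_gt0 V) V_Sylow (cardSg sKV).
  move=> q; rewrite mem_primes => /and3P[q_pr _ qK].
  rewrite ltn_neqAle maxp ?andbT; last first.
    by rewrite mem_primes q_pr cardG_gt0 (dvdn_trans qK) // cardSg.
  by apply: contraTneq p'K => <-; rewrite p'natE // negbK.
have neQ : <[x]>%G :!=: Q by apply: contraNneq nQD => <-.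
have p2 : p = 2 := line_even st p_pr pV sKV cK sQV cQ ox neQ cDK.
rewrite p2 in p_pr pV maxp cQ pD *; have V2 : #|V| = 2.
  rewrite -(partnC 2 (cardG_gt0 V)) (V_Sylow 2) //.
  have -> : #|V|`_2^' = 1; last by [].
  apply/eqP; rewrite partn_eq1 ?cardG_gt0 // pnatNK; apply/pnatP=> // q q_pr qV.
  rewrite inE /= eqn_leq prime_gt1 // andbT maxp //.
  by rewrite mem_primes q_pr cardG_gt0.
have [[|[|a]] eD] := p_natP pD; rewrite eD //.
have [|D' [sD' _ cD']] := @normal_pgroup 2 _ 2 D D pD (normal_refl D).
  by rewrite eD pfactorK.
have eQV : Q :=: V by apply/eqP; rewrite eqEcard sQV cQ V2.
case/negP: nQD; rewrite eQV; apply: subset_trans sD'.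
exact: base2_order4 st V2 cD'.
Qed.

End UniqueLineGeneral.

(** * Exchanging p'-groups with their products by Q *)

Section Swap.

Local Open Scope group_scope.
Local Open Scope ring_scope.
Local Open Scope nat_scope.

Variables (gT : finGroupType) (p : nat) (Q : {group gT}).
Hypotheses (p_pr : prime p) (cardQ : #|Q| = p) (nQ : Q <| [set: gT]).
Hypothesis unique_line : forall D : {group gT},
  p.-group D -> ~~ (Q \subset D) -> #|D| %| gcdn 2 p.
Implicit Types (C U W P : {group gT}) (x : {group gT} -> int).

Let gcdn_odd : p != 2 -> gcdn 2 p = 1.
Proof.
move=> p_odd; apply/eqP; rewrite -/(coprime _ _) prime_coprime //.
by rewrite dvdn_prime2 // eq_sym.
Qed.

Definition p_complement W :=
  odflt W [pick C : {group gT} | (C \subset W) && (#|C| == #|W|`_p^')].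

(** An involution on classes of subgroups ([swapK]) that exchanges the trivial
    group with [Q], and more generally a [p']-group with its product by [Q]. *)
Definition swap W :=
  if ~~ (p %| #|W|) then (Q <*> W)%G
  else if (Q \subset W) && (#|W|`_p == p) then p_complement W else W.

Let QN (A : {set gT}) : A \subset 'N(Q).
Proof. exact: subset_trans (subsetT _) (normal_norm nQ). Qed.
Let QJ g : Q :^ g = Q. Proof. by apply/normP/(subsetP (QN setT)); rewrite inE. Qed.
Let p'coprime W : ~~ (p %| #|W|) -> coprime #|Q| #|W|.
Proof. by rewrite cardQ prime_coprime. Qed.
Let cardQW W : ~~ (p %| #|W|) -> #|Q <*> W| = p * #|W|.
Proof. by move=> p'W; rewrite norm_joinEr ?QN // coprime_cardMg ?p'coprime // cardQ. Qed.
Let solQ : solvable Q. Proof. by rewrite abelian_sol // cyclic_abelian // prime_cyclic // cardQ. Qed.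

Lemma partn_p'p W : ~~ (p %| #|W|) -> (#|Q <*> W|`_p = p) * (#|Q <*> W|`_p^' = #|W|).
Proof.
move=> p'W; have pW : p^'.-nat #|W| by rewrite p'natE.
rewrite cardQW // !partnM ?(prime_gt0 p_pr) // (part_p'nat pW) (part_pnat_id pW).
by rewrite part_pnat_id ?pnat_id // part_p'nat ?pnatNK ?pnat_id // muln1 mul1n.
Qed.

Lemma p_complementP W : Q \subset W -> #|W|`_p = p ->
  [/\ p_complement W \subset W, #|p_complement W| = #|W|`_p^',
      ~~ (p %| #|p_complement W|) & Q <*> p_complement W = W].
Proof.
move=> sQW Wp; have nQW : Q <| W := normalS sQW (subsetT _) nQ.
have hallQ : Hall W Q.
  rewrite /Hall sQW cardQ -divgS // cardQ -(partnC p (cardG_gt0 W)) Wp.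
  rewrite mulKn ?prime_gt0 // (pnat_coprime (pnat_id p_pr)) //.
  exact: part_pnat.
have /splitsP[C /complP[tiQC defW]] := SchurZassenhaus_split hallQ nQW.
have cardC : #|W|`_p^' = #|C|.
  have cW : #|W| = p * #|C| by rewrite -defW TI_cardMg // cardQ.
  apply/eqP; rewrite -(eqn_pmul2l (prime_gt0 p_pr)) -cW -{1}Wp.
  by rewrite partnC ?cardG_gt0.
rewrite /p_complement; case: pickP => [C' /andP[sC'W /eqP cC']|/(_ C)] /=; last first.
  by rewrite cardC eqxx andbT -{1}defW mulG_subr.
have p'C' : ~~ (p %| #|C'|) by rewrite cC' -p'natE // part_pnat.
split=> //; apply/eqP; rewrite eqEcard join_subG sQW sC'W /=.
by rewrite cardQW // cC' -{1}Wp partnC ?cardG_gt0.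
Qed.

Lemma swap_p' W : ~~ (p %| #|W|) -> swap W = (Q <*> W)%G.
Proof. by rewrite /swap => ->. Qed.

Lemma swap_conj W C : Q \subset W -> #|W|`_p = p -> C \subset W ->
  #|C| = #|W|`_p^' -> conjugate C (swap W).
Proof.
move=> sQW Wp sCW cC; have [sDW cD p'D QD] := p_complementP sQW Wp.
have pW : p %| #|W| by rewrite -{1}Wp dvdn_part.
rewrite /swap pW sQW Wp eqxx /=.
have sC : C \subset (Q * p_complement W)%g by rewrite -norm_joinEr ?QN // QD.
have [x _ eC] := SchurZassenhaus_trans_sol solQ (QN _) sC (p'coprime p'D) (etrans cC (esym cD)).
rewrite conjugate_sym; apply/conjugateP; exists x; exact: val_inj.
Qed.

Lemma swap_id W : p %| #|W| -> ~~ ((Q \subset W) && (#|W|`_p == p)) -> swap W = W.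
Proof. by rewrite /swap => -> /negPf->. Qed.

Lemma swapJ W g : conjugate (swap W)  (swap (W :^ g)%G).
Proof.
have [pW|p'W] := boolP (p %| #|W|); last first.
  rewrite !swap_p' ?cardJg //; apply/conjugateP; exists g.
  by apply: val_inj; rewrite /= conjYg QJ.
have QW : (Q \subset W :^ g) = (Q \subset W) by rewrite -{1}(QJ g) conjSg.
have [/andP[sQW /eqP Wp]|nW] := boolP ((Q \subset W) && (#|W|`_p == p)); last first.
  by rewrite !swap_id ?cardJg ?QW //; apply: conjugateJ.
have [sDW cD p'D QD] := p_complementP sQW Wp.
have e : swap W = p_complement W by rewrite /swap pW sQW Wp eqxx.
rewrite e; apply: conjugate_trans (conjugateJ _ g) _.
by apply: swap_conj; rewrite ?QW ?cardJg ?conjSg.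
Qed.

Lemma swapK W : conjugate W (swap (swap W)).
Proof.
have [pW|p'W] := boolP (p %| #|W|); last first.
  rewrite [swap W]swap_p' //; apply: swap_conj; rewrite ?partn_p'p //.
    exact: joing_subl.
  exact: joing_subr.
have [/andP[sQW /eqP Wp]|nW] := boolP ((Q \subset W) && (#|W|`_p == p)); last first.
  by rewrite !swap_id // conjugate_refl.
have [sDW cD p'D QD] := p_complementP sQW Wp.
have -> : swap W = p_complement W by rewrite /swap pW sQW Wp eqxx.
rewrite swap_p' // (_ : (Q <*> _)%G = W) ?conjugate_refl //; exact: val_inj.
Qed.

Lemma swap_class x : class_function x -> class_function (x \o swap).
Proof. by move=> xJ W g; apply: class_function_conj (swapJ W g). Qed.

Lemma index_gcdn2 U (R : {group gT}) : ~~ (p %| #|U|) -> U \subset R -> p.-nat #|R : U| ->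
  ~~ (Q \subset R) -> #|R : U| %| gcdn 2 p.
Proof.
move=> p'U sUR pR nQR; have [S sylS] := Sylow_exists p R.
have -> : #|R : U| = #|S|.
  rewrite (card_Hall sylS) -(Lagrange sUR) partnM ?indexg_gt0 //.
  by rewrite part_p'nat ?p'natE // mul1n part_pnat_id.
apply: unique_line (pHall_pgroup sylS) _.
by apply: contra nQR => /subset_trans; apply; apply: pHall_sub sylS.
Qed.

(** The orbits of [P / U] on the points fixed by [U] but not by [Q] are long:
    a stabiliser does not contain [Q]. *)
Lemma mark_swap_dvd U P (H : {group gT}) : ~~ (p %| #|U|) -> U <| P -> Q \subset P ->
    p.-nat #|P : U| ->
  #|P : U| %| gcdn 2 p * (mark H U - mark H (Q <*> U)%G).
Proof.
move=> p'U nUP sQP pP; have [sUP nPU] := andP nUP.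
pose X := 'Fix_(rcosets H [set: gT] | 'Rs)(U).
pose Y := 'Fix_(rcosets H [set: gT] | 'Rs)(Q <*> U).
have actX (V : {group gT}) : P \subset 'N(V) ->
    [acts P, on 'Fix_(rcosets H [set: gT] | 'Rs)(V) | 'Rs].
  move=> nPV; apply: actsI; last exact: acts_fix_norm.
  exact: subset_trans (subsetT _) (actsRs_rcosets _ _).
have nPQU : P \subset 'N(Q <*> U) by rewrite normsY ?QN.
have actXY : [acts P, on X :\: Y | 'Rs].
  exact: actsD (actX _ nPU) (actX (Q <*> U)%G nPQU).
have -> : mark H U - mark H (Q <*> U)%G = #|X :\: Y|.
  rewrite cardsD (setIidPr _) //; apply: setIS.
  by apply: afixS; apply: joing_subr.
rewrite -(acts_sum_card_orbit actXY) big_distrr /=; apply: dvdn_sum => T.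
case/imsetP=> A; rewrite inE => /andP[YA XA] ->; rewrite card_orbit.
set R := 'C_P[A | 'Rs]%G; have sRP : R \subset P := subsetIl _ _.
have /andP[rcA /afixP fixU] : (A \in rcosets H [set: gT]) && (A \in 'Fix_('Rs)(U)).
  by rewrite -in_setI.
have sUR : U \subset R.
  rewrite subsetI sUP; apply/subsetP=> u Uu; apply/astab1P; exact: fixU.
have nQR : ~~ (Q \subset R).
  apply: contra YA => sQR; rewrite inE rcA /=.
  have sC : Q <*> U \subset 'C[A | 'Rs].
    by apply: subset_trans (subsetIr P _); rewrite join_subG sQR.
  by apply/afixP=> g QUg; apply/astab1P/(subsetP sC).
rewrite -(Lagrange_index sRP sUR) mulnC dvdn_mul //.
apply: index_gcdn2 => //.
by apply: pnat_dvd pP; rewrite -(Lagrange_index sRP sUR) dvdn_mull.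
Qed.

(** The divisibility that the exchange of [U] and [Q <*> U] requires when [Q]
    lies in [P]. *)
Lemma integral_swap_dvd U P x : integral x -> ~~ (p %| #|U|) -> U <| P -> Q \subset P ->
    p.-nat #|P : U| ->
  (#|P : U|%:Z %| ((gcdn 2 p)%:Z * (x (Q <*> U)%G - x U))%R)%Z.
Proof.
move=> /integral_marks[c defx] p'U nUP sQP pP.
rewrite !defx -sumrB mulr_sumr; apply: rpred_sum => H _.
rewrite -mulrBr mulrCA; apply: dvdz_mull.
have := mark_swap_dvd H p'U nUP sQP pP.
have le : mark H (Q <*> U)%G <= mark H U.
  by apply: subset_leq_card; apply: setIS; apply: afixS; apply: joing_subr.
rewrite -[(_ - _)%R]opprB mulrN rpredN subzn // -PoszM dvdzE /=; exact: id.
Qed.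

Lemma joing_mul U g q : q \in Q -> (Q <*> U) <*> <[q * g]> = Q <*> (U <*> <[g]>).
Proof.
move=> Qq; rewrite -joingA.
have sub (a b : gT) : a \in Q <*> (U <*> <[b]>) ->
    Q <*> (U <*> <[a]>) \subset Q <*> (U <*> <[b]>).
  rewrite !join_subG joing_subl cycle_subG /= => ->; rewrite andbT.
  by rewrite (subset_trans (joing_subl U <[b]>)) ?joing_subr.
have memb (b : gT) : b \in Q <*> (U <*> <[b]>).
  by rewrite (subsetP (joing_subr _ _)) // (subsetP (joing_subr _ _)) ?cycle_id.
have memq (A : {set gT}) : q \in Q <*> A by rewrite (subsetP (joing_subl _ _)).
apply/eqP; rewrite eqEsubset; apply/andP; split; apply: sub.
  by rewrite groupM ?memb ?memq.
by rewrite -[X in X \in _](mulKg q) groupM ?groupV ?memb ?memq.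
Qed.

Lemma sum_joing_mul (F : gT -> int) P : ~~ (p %| #|P|) ->
    (forall q g, q \in Q -> F (q * g)%g = F g) ->
  (\sum_(h in (Q <*> P)%G) F h = p%:Z * \sum_(g in P) F g)%R.
Proof.
move=> p'P FQ; have tiQP : Q :&: P = 1%g := coprime_TIg (p'coprime p'P).
have eQP : Q <*> P = (Q * P)%g by rewrite norm_joinEr ?QN.
rewrite (partition_big (remgr Q P) (mem P)) /=; last first.
  by move=> h; rewrite eQP => QPh; apply: mem_remgr.
rewrite mulr_sumr; apply: eq_bigr => g Pg.
rewrite (eq_bigr (fun=> F g)) => [|h /andP[QPh /eqP <-]]; last first.
  rewrite eQP in QPh; rewrite {1}(divgr_eq Q P h) FQ //.
  exact: mem_divgr.
rewrite sumr_const -[in RHS]cardQ -natz mulr_natl -(card_rcoset Q g).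
congr (_ *+ _)%R; apply: eq_card => h.
rewrite -[LHS]/((h \in Q <*> P) && (remgr Q P h == g)) eQP.
apply/andP/rcosetP => [[QPh /eqP e]|[q Qq ->]].
  exists (divgr Q P h); last by rewrite -e -divgr_eq.
  by apply: mem_divgr.
by rewrite mem_mulg // remgrMid.
Qed.

Section Congruences.

Variables (x : {group gT} -> int) (U P : {group gT}) (l : nat).
Hypotheses (xB : integral x) (nUP : U <| P) (lP : l.-nat #|P : U|).

Let sUP : U \subset P. Proof. exact: normal_sub. Qed.
Let nPU : P \subset 'N(U). Proof. exact: normal_norm. Qed.
Let sWP g : g \in P -> U <*> <[g]> \subset P.
Proof. by move=> Pg; rewrite join_subG sUP cycle_subG. Qed.
Let nUW g : g \in P -> U <| U <*> <[g]>.
Proof. by move=> Pg; apply: normalS (joing_subl _ _) (sWP Pg) nUP. Qed.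
Let xJ V C : conjugate C V -> x V = x C.
Proof. exact: class_function_conj (proj1 xB). Qed.

(** The congruence for [U] in [P] becomes that for their products by [Q]. *)
Lemma swap_congruence_p' : ~~ (p %| #|P|) -> congruence_at (x \o swap) U P.
Proof.
move=> p'P; have nQUP : (Q <*> U)%G <| (Q <*> P)%G.
  rewrite /normal join_subG joing_subl (subset_trans sUP) ?joing_subr //=.
  by rewrite join_subG (subset_trans (joing_subl Q U)) ?normG // normsY ?QN.
have := proj2 xB _ _ nQUP; rewrite /congruence_at.
rewrite (sum_joing_mul (F := fun h => x ((Q <*> U) <*> <[h]>)%G)) //; last first.
  by move=> q g Qq; congr x; apply: val_inj; rewrite /= joing_mul // -joingA.
rewrite cardQW // PoszM dvdz_mul2l ?eqz_nat -?lt0n ?prime_gt0 //.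
congr (_ %| _)%Z; apply: eq_bigr => g Pg; rewrite /= swap_p'.
  by congr x; apply: val_inj; rewrite /= joingA.
by apply: contra p'P => /dvdn_trans; apply; apply: cardSg; apply: sWP.
Qed.

(** Conversely, complements of [Q] in [U] and [P] give the congruence. *)
Lemma swap_congruence_pQ : Q \subset U -> #|P|`_p = p ->
  congruence_at (x \o swap) U P.
Proof.
move=> sQU Pp; have sQP := subset_trans sQU sUP.
have [sP0 cP0 p'P0 QP0] := p_complementP sQP Pp; set P0 := p_complement P in sP0 cP0 p'P0 QP0.
pose U0 := (U :&: P0)%G.
have nU0 : U0 <| P0.
  by rewrite /normal subsetIr normsI ?normG // (subset_trans sP0).
have QU0 : Q <*> U0 = U.
  rewrite norm_joinEr ?QN //= setIC group_modl // -norm_joinEr ?QN // QP0.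
  exact/setIidPr.
have eU : (Q <*> U0)%G = U by apply: val_inj.
have sW0 g : g \in P0 -> U0 <*> <[g]> \subset P0.
  by move=> Pg; rewrite join_subG subsetIr cycle_subG.
rewrite /congruence_at -{1 2}QP0 cardQW //.
rewrite (sum_joing_mul (F := fun h => (x \o swap) (U <*> <[h]>)%G)) //; last first.
  move=> q g Qq; congr ((x \o swap) _); apply: val_inj => /=.
  by rewrite -QU0 joing_mul // joingA.
rewrite PoszM dvdz_mul2l ?eqz_nat -?lt0n ?prime_gt0 //.
rewrite (eq_bigr (fun g => x (U0 <*> <[g]>)%G)) => [|g Pg]; first exact: (proj2 xB).
have p'W : ~~ (p %| #|U0 <*> <[g]>|).
  by apply: contra p'P0 => /dvdn_trans; apply; apply: cardSg; apply: sW0.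
have eW : (U <*> <[g]>)%G = (Q <*> (U0 <*> <[g]>))%G.
  by apply: val_inj; rewrite /= -{1}QU0 joingA.
rewrite /= eW; apply: xJ.
by apply: swap_conj; rewrite ?partn_p'p ?joing_subl ?joing_subr.
Qed.

(** No group between [U] and [P] is moved: [U] has index prime to [p] in a moved
    one, so it would contain [Q]. *)
Lemma swap_congruence_fixed : p %| #|U| ->
    ~~ ((Q \subset U) && (#|U|`_p == p)) -> congruence_at (x \o swap) U P.
Proof.
move=> pU nQU; rewrite /congruence_at.
rewrite (eq_bigr (fun g => x (U <*> <[g]>)%G)) => [|g Pg]; first exact: (proj2 xB).
rewrite /= swap_id //; first exact: dvdn_trans pU (cardSg (joing_subl _ _)).
apply: contra nQU => /andP[sQW /eqP Wp].
have nUWg := nUW Pg; have sUW := normal_sub nUWg.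
have pUp : p %| #|U|`_p by rewrite -{1}(part_pnat_id (pnat_id p_pr)) partn_dvd.
have Up : #|U|`_p = p.
  apply/eqP; rewrite eqn_dvd pUp andbT -[X in _ %| X]Wp.
  by rewrite partn_dvd ?cardSg.
rewrite Up eqxx andbT -quotient_sub1 ?(subset_trans sQW) ?normal_norm //.
apply/trivgP/card1_trivg/eqP; rewrite -dvdn1.
have <- : gcdn #|Q| #|U <*> <[g]> : U| = 1.
  have := Wp; rewrite -(Lagrange sUW) partnM ?indexg_gt0 // Up => /eqP.
  rewrite -[X in _ == X]muln1 eqn_pmul2l ?prime_gt0 // => /eqP iW.
  apply/eqP; rewrite -/(coprime _ _) cardQ prime_coprime // -p'natE //.
  by rewrite -partn_eq1 ?indexg_gt0 // iW.
rewrite dvdn_gcd dvdn_quotient -card_quotient ?normal_norm //.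
exact: cardSg (quotientS _ sQW).
Qed.

(** Frattini: [P] is the product of [Q] and the normaliser in [P] of a complement
    of [Q] in [U]. *)
Lemma swap_index_dvd : p.-nat #|P : U| -> Q \subset U -> #|U|`_p = p ->
  #|P|`_p != p -> (#|P : U|%:Z %| (x (swap U) - x U)%R)%Z.
Proof.
move=> pP sQU Up Pp; have [sU0 cU0 p'U0 QU0] := p_complementP sQU Up.
set U0 := p_complement U in sU0 cU0 p'U0 QU0.
have eU : (Q <*> U0)%G = U by apply: val_inj.
have iU0 : #|U : U0| = p.
  by rewrite -divgS // -{1}QU0 cardQW // mulnK ?cardG_gt0.
have frattini g : g \in P -> exists2 q, q \in Q & (g * q^-1)%g \in 'N(U0).
  move=> Pg; have sK : U0 :^ g \subset (Q * U0)%g.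
    by rewrite -norm_joinEr ?QN // QU0 -(normP (subsetP nPU g Pg)) conjSg.
  have [q Qq e] := SchurZassenhaus_trans_sol (K1 := (U0 :^ g)%G) solQ (QN _) sK
    (p'coprime p'U0) (cardJg _ _).
  by exists q => //; apply/normP; rewrite conjsgM e conjsgK.
have [nQU0|nQU0] := boolP (Q \subset 'N(U0)).
  have nU0P : U0 <| P.
    rewrite /normal (subset_trans sU0) //; apply/subsetP=> g /frattini[q Qq].
    by rewrite groupMr // groupV (subsetP nQU0).
  have iP : #|P : U0| = #|P : U| * p by rewrite -iU0 Lagrange_index.
  have pP0 : p.-nat #|P : U0| by rewrite iP pnatM pP pnat_id.
  have := integral_swap_dvd xB p'U0 nU0P (subset_trans sQU sUP) pP0.
  have xU0 : x (swap U) = x U0 by apply/xJ/swap_conj.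
  rewrite eU iP xU0 -[(x U - _)%R]opprB mulrN rpredN.
  have /dvdnP[e ep] := dvdn_gcdr 2 p.
  have -> : #|P : U| * p = gcdn 2 p * (#|P : U| * e).
    by rewrite [X in _ * X = _]ep mulnA mulnC.
  rewrite [X in (X %| _)%Z]PoszM dvdz_mul2l ?eqz_nat -?lt0n ?gcdn_gt0 //.
  by apply: dvdz_trans; rewrite PoszM dvdz_mulr.
case/negP: Pp; have sQP := subset_trans sQU sUP.
(* For [p = 2] the complement has index 2 in [U], hence is normalised by [Q]. *)
have p_odd : p != 2.
  apply: contra nQU0 => /eqP p2; apply: subset_trans sQU _.
  by apply/normal_norm/index2_normal; rewrite // iU0.
have p'P1 : ~~ (p %| #|'N_P(U0)|).
  have [S sylS] := Sylow_exists p 'N_P(U0).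
  have := unique_line (pHall_pgroup sylS); rewrite (card_Hall sylS).
  rewrite gcdn_odd // dvdn1 partn_eq1 ?cardG_gt0 // p'natE //; apply.
  apply: contra nQU0 => sQS; apply: subset_trans sQS _.
  by apply: subset_trans (pHall_sub sylS) (subsetIr _ _).
have eP : (Q * 'N_P(U0))%g = P.
  apply/eqP; rewrite eqEsubset mul_subG ?subsetIl //=.
  apply/subsetP=> g Pg; have [q Qq nq] := frattini g Pg.
  rewrite -normC ?QN //; apply/mulsgP; exists (g * q^-1)%g q; rewrite ?mulgKV //.
  by rewrite inE nq andbT groupM // groupV (subsetP sQP).
have : #|P| %| p * #|'N_P(U0)|.
  by rewrite -cardQ mul_cardG eP dvdn_mulr.
move/(partn_dvd p); rewrite muln_gt0 prime_gt0 // cardG_gt0 => /(_ isT).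
rewrite partnM ?(prime_gt0 p_pr) // (part_pnat_id (pnat_id p_pr)).
rewrite [X in _ * X]part_p'nat ?p'natE // muln1 => dP.
rewrite eqn_dvd dP -{1}(part_pnat_id (pnat_id p_pr)) partn_dvd //.
by rewrite -{1}cardQ cardSg.
Qed.

Let pW_gt g : p.-nat #|P : U| -> g \in P -> g \notin U ->
  p %| #|U <*> <[g]> : U|.
Proof.
move=> pP Pg Ug; have sW := sWP Pg; have sUW := joing_subl U <[g]>.
have pWU : p.-nat #|U <*> <[g]> : U| := pnat_dvd (indexSg sUW sW) pP.
have := joing_cycle_card Ug; rewrite -(Lagrange sUW).
have [[|a] ->] := p_natP pWU; first by rewrite expn0 muln1 ltnn.
by rewrite expnS dvdn_mulr.
Qed.

Lemma swap_congruence_Q : p.-nat #|P : U| -> Q \subset U -> #|U|`_p = p ->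
  #|P|`_p != p -> congruence_at (x \o swap) U P.
Proof.
move=> pP sQU Up Pp; have xUP := proj2 xB _ _ nUP.
move: (xUP); rewrite /congruence_at !sum_joing_cycle // => {}xUP.
have -> : (\sum_(g in P :\: U) (x \o swap) (U <*> <[g]>)%G
    = \sum_(g in P :\: U) x (U <*> <[g]>)%G)%R.
  apply: eq_bigr => g; rewrite inE => /andP[Ug Pg].
  have pW := pW_gt pP Pg Ug; rewrite /= swap_id //.
    by rewrite -(Lagrange (joing_subl U <[g]>)) dvdn_mull.
  rewrite negb_and -(Lagrange (joing_subl U <[g]>)) partnM ?indexg_gt0 // Up.
  apply/orP; right; rewrite -[X in _ != X]muln1 eqn_pmul2l ?prime_gt0 //.
  by rewrite partn_eq1 ?indexg_gt0 // p'natE // negbK.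
rewrite -[(x \o swap) U](subrK (x U)) mulrDr -addrA rpredDr //.
rewrite -(Lagrange sUP) PoszM; apply: dvdz_mul => //.
exact: swap_index_dvd.
Qed.

(** If [Q] lies in [P], only [U] and [Q <*> U] are moved; they are exchanged, and
    contribute with multiplicities [1] and [p.-1], so that the sum changes by
    [2 - p] times the difference of the two values. Otherwise only [U] is moved,
    and it has index at most 2. *)
Lemma swap_congruence_p'U : p.-nat #|P : U| -> ~~ (p %| #|U|) ->
  congruence_at (x \o swap) U P.
Proof.
move=> pP p'U; have xUP := proj2 xB _ _ nUP.
pose z : int := (x (Q <*> U)%G - x U)%R.
pose d g := ((x \o swap) (U <*> <[g]>)%G - x (U <*> <[g]>)%G)%R.
rewrite /congruence_at (eq_bigr (fun g => d g + x (U <*> <[g]>)%G)%R); last first.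
  by move=> g _; rewrite subrK.
rewrite big_split /= rpredDr //.
have dU g : g \in U -> d g = z by move=> Ug; rewrite /d joing_cycle_in //= swap_p'.
have cQU := cardQW p'U.
have dP g : g \in P -> g \notin U ->
    d g = if Q \subset P then if g \in Q <*> U then (- z)%R else 0%R else 0%R.
  move=> Pg Ug; have pW := pW_gt pP Pg Ug; have sUW := joing_subl U <[g]>.
  have pW' : p %| #|U <*> <[g]>| by rewrite -(Lagrange sUW) dvdn_mull.
  have WQU : Q \subset U <*> <[g]> -> #|U <*> <[g]>|`_p = p ->
      (U <*> <[g]>)%G = (Q <*> U)%G.
    move=> sQW Wp; apply/val_inj/esym/eqP; rewrite eqEcard join_subG sQW sUW /=.
    have pWU : p.-nat #|U <*> <[g]> : U| := pnat_dvd (indexSg sUW (sWP Pg)) pP.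
    move: Wp; rewrite -(Lagrange sUW) partnM ?indexg_gt0 // part_p'nat ?p'natE //.
    by rewrite mul1n part_pnat_id // cQU => ->; rewrite mulnC.
  have [/andP[sQW /eqP Wp]|nW] := boolP ((Q \subset U <*> <[g]>) && (#|U <*> <[g]>|`_p == p)).
    have eW := WQU sQW Wp; rewrite (subset_trans sQW (sWP Pg)).
    have -> : g \in Q <*> U.
      have : g \in (U <*> <[g]>)%G by rewrite (subsetP (joing_subr _ _)) ?cycle_id.
      by rewrite eW.
    rewrite /d eW /= opprB; congr (_ - _)%R; apply: xJ.
    by apply: swap_conj; rewrite ?partn_p'p ?joing_subl ?joing_subr.
  rewrite /d /= swap_id // subrr; case: ifP => // sQP; case: ifP => // QUg.
  case/negP: nW; have eW : U <*> <[g]> = Q <*> U.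
    apply/eqP; rewrite eqEcard join_subG joing_subr cycle_subG QUg /= cQU.
    by rewrite -(Lagrange sUW) mulnC leq_mul2l dvdn_leq ?orbT ?indexg_gt0.
  by rewrite eW joing_subl partn_p'p //=.
rewrite (big_setID U) /= (setIidPr sUP) (eq_bigr (fun=> z)) => [|g]; last exact: dU.
rewrite sumr_const.
have [sQP|nQP] := boolP (Q \subset P); last first.
  rewrite big1 ?addr0 => [|g]; last first.
    by rewrite inE => /andP[Ug Pg]; rewrite dP // (negPf nQP).
  rewrite -mulr_natl natz -(Lagrange sUP) PoszM; apply: dvdz_mul => //.
  have := index_gcdn2 p'U sUP pP nQP.
  have [p2|p_odd] := eqVneq p 2; last first.
    by rewrite gcdn_odd // dvdn1 => /eqP->; rewrite dvd1z.
  have -> : gcdn 2 p = p by rewrite {1}p2 gcdnn p2.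
  move=> iP; apply: (@dvdz_trans p%:Z); first by rewrite dvdzE.
  apply: (congruent_sym _ xB); apply: congruent_normal => //.
    apply: index2_normal; first exact: joing_subr.
    by rewrite -divgS ?joing_subr // cQU mulnK ?cardG_gt0.
  by rewrite -divgS ?joing_subr // cQU mulnK ?cardG_gt0 // pnat_id.
have sQUP : Q <*> U \subset P by rewrite join_subG sQP.
rewrite (big_setID (Q <*> U)) /= [X in (_ + (_ + X))%R]big1 ?addr0; last first.
  move=> g; rewrite !inE => /and3P[QUg Ug Pg].
  by rewrite dP // sQP (negPf QUg).
rewrite (eq_bigr (fun=> (- z)%R)) => [|g]; last first.
  by rewrite !inE => /andP[/andP[Ug Pg] QUg]; rewrite dP // sQP QUg.
rewrite sumr_const.
have -> : #|(P :\: U) :&: (Q <*> U)| = p.-1 * #|U|.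
  rewrite setIDAC (setIidPr sQUP) cardsD (setIidPr (joing_subr _ _)) cQU.
  by rewrite -{1}(prednK (prime_gt0 p_pr)) mulSn addKn.
rewrite mulNrn -![(z *+ _)%R]mulr_natl -mulrBl !natz PoszM.
rewrite -[X in (X - _)%R]mul1r -mulrBl -(Lagrange sUP) PoszM [X in (X * _)%R]mulrC -mulrA.
apply: dvdz_mul => //; have := integral_swap_dvd xB p'U nUP sQP pP; rewrite -/z.
(* For [p = 2] the two multiplicities agree and nothing is to be proved. *)
have [p2|p_odd] := eqVneq p 2; first by rewrite p2 subrr mul0r dvdz0.
by rewrite gcdn_odd // mul1r; apply: dvdz_mull.
Qed.

Lemma swap_congruence : congruence_at (x \o swap) U P.
Proof.
have [pP|p'P] := boolP (p %| #|P|); last exact: swap_congruence_p'.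
have pl : p %| #|P : U| -> p.-nat #|P : U|.
  move=> pPU; have : p \in \pi(#|P : U|) by rewrite mem_primes p_pr indexg_gt0.
  by move/(pnatPpi lP); rewrite inE => /eqP->.
have [pU|p'U] := boolP (p %| #|U|); last first.
  apply: swap_congruence_p'U => //; apply: pl.
  by move: pP; rewrite -(Lagrange sUP) Euclid_dvdM // (negPf p'U).
have [/andP[sQU /eqP Up]|nQU] := boolP ((Q \subset U) && (#|U|`_p == p)); last first.
  exact: swap_congruence_fixed.
have [Pp|Pp] := eqVneq (#|P|`_p) p; first exact: swap_congruence_pQ.
apply: swap_congruence_Q => //; apply: pl; apply: contraR Pp => p'PU.
by rewrite -(Lagrange sUP) partnM ?indexg_gt0 // Up [X in _ * X]part_p'nat ?p'natE // muln1.
Qed.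

End Congruences.

Lemma integral_swap x : integral x -> integral (x \o swap).
Proof.
move=> xB; apply: integralP => [|l l_pr U P nUP lP]; first exact: swap_class (proj1 xB).
exact: swap_congruence xB nUP lP.
Qed.

End Swap.

(** * Reduction to bijections fixing the trivial group *)

Section Normalisation.

Local Open Scope group_scope.
Local Open Scope ring_scope.
Local Open Scope nat_scope.

(** The largest prime of the order of the base point is removed by a swap. *)
Lemma integral_iso_normalise (gT hT : finGroupType)
    (s : {group gT} -> {group hT}) (t : {group hT} -> {group gT}) :
    integral_iso s t ->
  exists (s' : {group gT} -> {group hT}) (t' : {group hT} -> {group gT}),
    integral_iso s' t' /\ s' 1%G = 1%G.
Proof.
have [n] := ubnP #|s 1%G|; elim: n s t => // n IHn s t leVn st.
set V := s 1%G in leVn.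
have [V1|V_neq1] := eqVneq V 1%G; first by exists s, t.
have V_gt1 : 1 < #|V| by rewrite cardG_gt1; apply: contra V_neq1 => /eqP V1; apply/eqP/val_inj.
pose p := max_pdiv #|V|; have p_pr : prime p by apply: max_pdiv_prime.
have pV : p %| #|V| := max_pdiv_dvd _.
have maxp q : q \in primes #|V| -> q <= p by apply: max_pdiv_max.
have baseV m : integral (fun L => (m%:Z * indicator V L)%R) -> #|[set: hT]| %| m.
  exact: integral_iso_base st.
have [nV cV] := (base_normal baseV, base_cyclic baseV).
have [V_p _] := base_Sylow baseV p_pr pV.
have [K nKV cK] := cyclic_Sylow_complement p cV; have sKV := normal_sub nKV.
have [a Va oa] := Cauchy p_pr pV.
pose Q := <[a]>%G; have sQV : Q \subset V by rewrite cycle_subG.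
have cQ : #|Q| = p by [].
have nQ : Q <| [set: hT] := cyclic_normal_sub nV cV sQV.
have line D := @base_unique_line _ _ s t p K Q D st p_pr pV maxp sKV cK sQV cQ.
have sw_conj A B : conjugate A B -> conjugate (swap p Q A) (swap p Q B).
  by case/conjugateP=> g ->; apply: swapJ.
have [sB tB tsK stL] := st.
have sts : integral_iso (swap p Q \o s) (t \o swap p Q).
  split=> [x xB|x xB|U|L].
  - exact: sB (integral_swap p_pr cQ nQ line xB).
  - exact: (integral_swap p_pr cQ nQ line (tB _ xB)).
  - apply: conjugate_trans (tsK U) _; apply: (integral_iso_conj (integral_iso_sym st)).
    exact: swapK.
  - by apply: conjugate_trans (swapK p_pr cQ nQ L) _; apply/sw_conj/stL.
apply: (IHn _ _ _ sts) => /=; rewrite -/V.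
rewrite (conjugate_card (swap_conj p_pr cQ nQ sQV V_p sKV cK)) cK.
rewrite -ltnS; apply: leq_trans leVn; rewrite ltnS.
rewrite -[X in _ < X](partnC p (cardG_gt0 V)) V_p.
by rewrite ltn_Pmull ?prime_gt1 ?part_gt0.
Qed.

End Normalisation.

Theorem theorem8 (G H : finGroupType)
    (isoBGH : exists f : {rmorphism burnside G -> burnside H}, bijective f) :
  same_order_type G H.
Proof.
have [f [f' fK f'K]] := isoBGH => d _.
have [s [t st]] := burnside_iso_integral_iso (@GRing.rmorphD _ _ f)
  (@GRing.rmorphM _ _ f) (@GRing.rmorph1 _ _ f) fK f'K.
have [s' [t' [st' s'1]]] := integral_iso_normalise st.
exact: normalised_card_Ldiv st' s'1.
Qed.
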